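(* There is an algorithm that, given as input a vertex-facet incidence matrix of a simple or simplicial $d$-polytope $P$, computes the Hasse diagram $\mathcal{L}$ of the face lattice of $P$ in time $$O(d\cdot\alpha\cdot\varphi),$$ where $\alpha$ is the number of vertex-facet incidences of $P$ and $\varphi$ is the total number of faces of $P$. Its space requirements (without output space) can be bounded by $O(\varphi\cdot m)$ if $P$ is simple, and by $O(\varphi\cdot n)$ if $P$ is simplicial, where $n$ is the number of vertices and $m$ the number of facets of $P$.
   Context: A $d$-polytope $P$ is a $d$-dimensional bounded convex polyhedron. It is simple if every vertex lies in exactly $d$ facets, and simplicial if every facet contains exactly $d$ vertices. Its set $\mathcal{F}$ of faces (including $\varnothing$ and $P$ itself), ordered by inclusion, is the face lattice of $P$, and $\varphi:=|\mathcal{F}|$. A vertex-facet incidence matrix of $P$ is a matrix $A=(a_{fv})\in\{0,1\}^{m\times n}$, with rows indexed by the facets $F=\{1,\dots,m\}$ and columns by the vertices $V=\{1,\dots,n\}$, such that $a_{fv}=1$ if facet $f$ contains vertex $v$ and $a_{fv}=0$ otherwise; $\alpha$ is the number of ones in $A$. No data other than $A$ (in particular no geometric data and no orientation of the graph of $P$) are given. The Hasse diagram $\mathcal{L}$ is the (unlabeled, abstract) directed graph whose nodes correspond to the elements of $\mathcal{F}$, with an arc $(\ell_H,\ell_G)$ between the nodes corresponding to $H,G\in\mathcal{F}$ if and only if $H\subsetneq G$ and $\dim G=\dim H+1$ (with $\dim\varnothing=-1$). Running times refer to the uniform time measure (every arithmetic operation or comparison takes one unit of time); memory requirements refer to the bit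 model (number of bits). The constants in the $O$-notation are absolute, and $O(f)$ means at most a constant times $\max\{1,f\}$. *)

(* Defs.v *)
From HB Require Import structures.
From mathcomp Require Import all_boot all_order all_algebra.
From mathcomp Require Import finmap.
From mathcomp Require Import all_classical reals topology normedtype.

Set Implicit Arguments.
Unset Strict Implicit.
Unset Printing Implicit Defensive.

Import Order.TTheory GRing.Theory Num.Theory.
Import numFieldNormedType.Exports.

Local Open Scope classical_set_scope.
Local Open Scope ring_scope.

Section Polytopes.
Variables (R : realType) (k : nat).
Implicit Types (P F G H S : set 'rV[R]_k).

(* Points are affinely independent iff their homogenizations (x, 1) are
   linearly independent. *)
Definition affinely_independent (p : nat) (X : 'M[R]_(p, k)) : bool :=
  row_free (row_mx X (const_mx 1 : 'cV[R]_p)).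

(* The maximal number of affinely independent points of S, minus one; at most
   k + 1 points of R^k are affinely independent, and affdim set0 = -1. *)
Definition affdim S : int :=
  (\max_(p < k.+2 | `[< exists X : 'M[R]_(p, k),
      affinely_independent X /\ forall i, S (row i X) >]) val p)%:Z - 1.

Definition polyhedron P : Prop :=
  exists (q : nat) (M : 'M[R]_(k, q)) (b : 'rV[R]_q),
    P = [set x | forall i, (x *m M) 0 i <= b 0 i].

Definition polytope (d : nat) P : Prop :=
  [/\ polyhedron P, bounded_set P & affdim P = d%:Z].

(* c = 0 yields the two improper faces, P (delta = 0) and set0 (delta = 1). *)
Definition faces P : set (set 'rV[R]_k) :=
  [set F | exists (c : 'cV[R]_k) (delta : R),
     (forall x, P x -> (x *m c) 0 0 <= delta) /\
     F = P `&` [set x | (x *m c) 0 0 = delta]].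

Definition vertices P : set 'rV[R]_k := [set v | faces P [set v]].

Definition facets P : set (set 'rV[R]_k) :=
  [set F | faces P F /\ affdim F = affdim P - 1].

Definition simple (d : nat) P : Prop :=
  forall v, vertices P v -> ([set F | facets P F /\ F v] #= `I_d)%card.

Definition simplicial (d : nat) P : Prop :=
  forall F, facets P F -> ([set v | vertices P v /\ F v] #= `I_d)%card.

Definition num_faces P : nat := #|` fset_set (faces P)|%fset.

Definition incidence_matrix (m n : nat) P (A : 'M[bool]_(m, n)) : Prop :=
  exists (facet : 'I_m -> set 'rV[R]_k) (vertex : 'I_n -> 'rV[R]_k),
    [/\ set_bij setT (facets P) facet,
        set_bij setT (vertices P) vertex &
        forall f v, A f v <-> facet f (vertex v)].

Definition hasse_arc H G : Prop := H `<` G /\ affdim G = affdim H + 1.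

(* The Hasse diagram, with its nodes numbered 0, ..., N - 1 in an arbitrary
   way, is written as N followed by the two ends of every arc, each arc being
   listed exactly once. *)
Definition encodes_hasse_diagram P (out : seq nat) : Prop :=
  exists (N : nat) (arcs : seq ('I_N * 'I_N)) (face : 'I_N -> set 'rV[R]_k),
    [/\ set_bij setT (faces P) face,
        uniq arcs,
        forall i j, (i, j) \in arcs <-> hasse_arc (face i) (face j) &
        out = N :: flatten [seq [:: val a.1; val a.2] | a <- arcs]].

End Polytopes.

Definition num_incidences (m n : nat) (A : 'M[bool]_(m, n)) : nat :=
  (\sum_(f < m) \sum_(v < n) A f v)%N.

(* A random access machine over the natural numbers, programmed in structured
   form.  It has registers, an indirectly addressed memory and a write-only
   output.  Sub is truncated subtraction.  There is deliberately no unit-cost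
   multiplication, division or bit operation. *)
Inductive test : Type :=
  | Lt of nat & nat
  | Eq of nat & nat.

Inductive prog : Type :=
  | Const of nat & nat            (* r_x := c *)
  | Add of nat & nat & nat        (* r_x := r_y + r_z *)
  | Sub of nat & nat & nat        (* r_x := r_y - r_z *)
  | MemGet of nat & nat           (* r_x := memory[r_y] *)
  | MemSet of nat & nat           (* memory[r_x] := r_y *)
  | Emit of nat                   (* output r_x *)
  | Seq of prog & prog
  | If of test & prog & prog
  | While of test & prog.

(* Cells beyond the end of a list hold 0; writing to such a cell extends the
   list up to that address. *)
Record state : Type := State {
  regs : seq nat;
  memory : seq nat;
  output : seq nat
}.

Definition reg (s : state) (x : nat) : nat := nth 0%N (regs s) x.

Definition set_reg (s : state) (x a : nat) : state :=
  State (set_nth 0%N (regs s) x a) (memory s) (output s).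

Definition set_mem (s : state) (i a : nat) : state :=
  State (regs s) (set_nth 0%N (memory s) i a) (output s).

Definition emit (s : state) (a : nat) : state :=
  State (regs s) (memory s) (rcons (output s) a).

Definition eval_test (b : test) (s : state) : bool :=
  match b with
  | Lt x y => (reg s x < reg s y)%N
  | Eq x y => reg s x == reg s y
  end.

Definition bit_length (a : nat) : nat := (trunc_log 2 a).+1.

(* Every cell up to the largest address written so far is charged at least one
   bit, so that no information can be hidden in addresses.  The input is part
   of the memory and is charged; the output is not. *)
Definition bits_used (s : state) : nat :=
  (\sum_(a <- regs s ++ memory s) bit_length a)%N.

(* exec c s t p s': started in s, c halts in s' after t units of time, and p is
   the maximum of bits_used over all states passed through. *)
Inductive exec : prog -> state -> nat -> nat -> state -> Prop :=
  | ExecConst x c s (s' := set_reg s x c) :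
      exec (Const x c) s 1 (maxn (bits_used s) (bits_used s')) s'
  | ExecAdd x y z s (s' := set_reg s x (reg s y + reg s z)%N) :
      exec (Add x y z) s 1 (maxn (bits_used s) (bits_used s')) s'
  | ExecSub x y z s (s' := set_reg s x (reg s y - reg s z)%N) :
      exec (Sub x y z) s 1 (maxn (bits_used s) (bits_used s')) s'
  | ExecMemGet x y s (s' := set_reg s x (nth 0%N (memory s) (reg s y))) :
      exec (MemGet x y) s 1 (maxn (bits_used s) (bits_used s')) s'
  | ExecMemSet x y s (s' := set_mem s (reg s x) (reg s y)) :
      exec (MemSet x y) s 1 (maxn (bits_used s) (bits_used s')) s'
  | ExecEmit x s :
      exec (Emit x) s 1 (bits_used s) (emit s (reg s x))
  | ExecSeq c1 c2 s0 s1 s2 t1 t2 p1 p2 :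
      exec c1 s0 t1 p1 s1 -> exec c2 s1 t2 p2 s2 ->
      exec (Seq c1 c2) s0 (t1 + t2) (maxn p1 p2) s2
  | ExecIfTrue b c1 c2 s s' t p :
      eval_test b s -> exec c1 s t p s' ->
      exec (If b c1 c2) s t.+1 p s'
  | ExecIfFalse b c1 c2 s s' t p :
      ~~ eval_test b s -> exec c2 s t p s' ->
      exec (If b c1 c2) s t.+1 p s'
  | ExecWhileTrue b c s0 s1 s2 t1 t2 p1 p2 :
      eval_test b s0 -> exec c s0 t1 p1 s1 ->
      exec (While b c) s1 t2 p2 s2 ->
      exec (While b c) s0 (t1 + t2).+1 (maxn p1 p2) s2
  | ExecWhileFalse b c s :
      ~~ eval_test b s -> exec (While b c) s 1 (bits_used s) s.

(* Memory initially holds m, n and the entries of A in row-major order. *)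
Definition input (m n : nat) (A : 'M[bool]_(m, n)) : state :=
  State [::]
    [:: m, n & [seq nat_of_bool (A f v) | f <- enum 'I_m, v <- enum 'I_n]]
    [::].

(* The value of O(f) for the constant C. *)
Definition big_O (C f : nat) : nat := (C * maxn 1 f)%N.

(* Main.v *)
Require Import Defs.
From mathcomp Require Import all_boot all_order all_algebra.
From mathcomp Require Import all_classical reals topology normedtype.
From mathcomp Require Import lra zify.

(* Call items the facets of a simple polytope, or the vertices of a simplicial
   one, and blocks the vertices, respectively the facets.  Every block contains
   exactly d items.  The d inequalities tight at a vertex of a simple polytope are
   linearly independent and can be relaxed one by one, and the d vertices of a
   facet of a simplicial polytope are affinely independent; hence the nonempty
   faces of a simple polytope, and the proper faces of a simplicial one, correspond
   to the sets of items that lie in a common block, and the face lattice is this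
   simplicial complex together with one more face.

   The complex is stored as a trie of decreasing lists of items.  Every node S is
   compared with every block v, which takes at most d lookups; only if S lies in v,
   all items of v that are greater than the head of S are tried.  With q items, p
   blocks and D sets in the complex, the comparisons take time O(p d D) and the
   extensions time O(p 2^d q), which is O(p d D) again because q 2^d <= 2 d D; and
   alpha = p d.  An arc deletes one item from a set, and the smaller set is found by
   climbing and descending in the trie.  A node has q + 4 cells, only boundedly many
   of which receive numbers other than 0 and 1 per created node, each of
   O(log D) = O(q) bits, so that O(D q) bits suffice. *)

Set Implicit Arguments.
Unset Strict Implicit.
Unset Printing Implicit Defensive.

Local Open Scope nat_scope.

(** * Time and space of programs *)

(** On the geometric side, P is rewritten as equations together with inequalities, exactly one per
    facet. A nonempty face is then determined by the inequalities active at one of its relative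
    interior points, and its dimension is the rank of a kernel. Vertices are produced by simplex
    steps, which is where boundedness enters. The two cases are dual in statement but not in proof:
    at a vertex of a simple polytope one moves a little into P, whereas on a facet of a simplicial
    polytope barycentric coordinates exclude further vertices from the face spanned by some of its
    vertices. Dimension 0 stands apart: the only facet of a point is the empty set, which no such
    inequality cuts out, and d * alpha * phi vanishes, so that the time must be bounded by a
    constant. On the machine side there is neither multiplication nor a dictionary. A set has
    exactly one decreasing list, so a path in the trie finds its node, and all addresses are
    obtained by adding stored steps. *)

Definition weight (mem : seq nat) : nat := \sum_(a <- mem) trunc_log 2 a.

(** Cells skipped by the write are filled with zeros, which weigh nothing since [trunc_log 2 0] is
    0; the weight of the overwritten value is not given back. *)
Lemma weight_set_nth mem i a : weight (set_nth 0 mem i a) <= weight mem + trunc_log 2 a.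
Proof.
have weight_cons x s : weight (x :: s) = trunc_log 2 x + weight s by rewrite /weight big_cons.
have log0 : trunc_log 2 0 = 0 by [].
elim: mem i => [|x mem IHmem] [|i] /=; rewrite ?weight_cons.
- by rewrite addnC.
- have -> s : weight (ncons i 0 s) = weight s.
    by elim: i => //= i IHi; rewrite weight_cons IHi.
  by rewrite !weight_cons log0 /weight !big_nil; lia.
- by lia.
- by have := IHmem i; lia.
Qed.

Lemma all_set_nth (p : pred nat) s i a : p 0 -> p a -> all p s -> all p (set_nth 0 s i a).
Proof.
move=> p0 pa ps; apply/(all_nthP 0) => j _; rewrite nth_set_nth /=.
case: eqP => // _; have [lt_j|le_j] := ltnP j (size s); first exact/all_nthP.
by rewrite nth_default.
Qed.

Section WeakestPrecondition.
(* At most [NR] registers are used, all numbers stay below [B], and only the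
   first [K] memory cells are written. *)
Variables NR B K : nat.

Definition fits (s : state) : Prop :=
  [/\ size (regs s) <= NR, all (leq^~ B) (regs s), all (leq^~ B) (memory s) &
      size (memory s) <= K].

(* Zero and one cost a single bit, so the bits beyond one per cell are paid for
   by the [z] memory writes, [trunc_log 2 B] each. *)
Definition peak_bound (s : state) (z : nat) : nat :=
  NR * (trunc_log 2 B).+1 + K + weight (memory s) + z * trunc_log 2 B.

(** The space clause is conditional on [fits], which every rule below preserves: it has to be
    checked for the initial state alone. *)
Definition runs (c : prog) (s : state) (t z : nat) (s' : state) : Prop :=
  exists2 p, exec c s t p s' & fits s ->
    [/\ fits s', weight (memory s') <= weight (memory s) + z * trunc_log 2 B &
        p <= peak_bound s z].

(** The counters of time and writes run through the postcondition, so that only their final values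
    are compared with a bound. *)
Definition wp (c : prog) (s : state) (t z : nat) (Q : state -> nat -> nat -> Prop) : Prop :=
  exists dt dz s', runs c s dt dz s' /\ Q s' (t + dt) (z + dz).

Lemma bits_used_bound s : fits s -> bits_used s <= peak_bound s 0.
Proof.
move=> [size_r all_r all_m size_m]; rewrite /bits_used big_cat /peak_bound mul0n addn0 -addnA.
rewrite leq_add //.
  apply: leq_trans (_ : \sum_(a <- regs s) (trunc_log 2 B).+1 <= _).
    rewrite !big_seq; apply: leq_sum => a /(allP all_r) leB.
    by rewrite ltnS leq_trunc_log.
  by rewrite big_const_seq count_predT iter_addn_0 mulnC leq_mul2r size_r orbT.
rewrite /bit_length (eq_bigr (fun a => trunc_log 2 a + 1)) => [|a _]; last by rewrite addn1.
by rewrite big_split /= addnC leq_add2r sum1_size.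
Qed.

Lemma peak_bound_le s s' y z : weight (memory s') <= weight (memory s) + y * trunc_log 2 B ->
  peak_bound s' z <= peak_bound s (y + z).
Proof. by rewrite /peak_bound mulnDl; lia. Qed.

Lemma reg_le s x : fits s -> reg s x <= B.
Proof.
move=> [_ all_r _ _]; rewrite /reg; have [lt_x|le_x] := ltnP x (size (regs s)).
  exact: (allP all_r _ (mem_nth 0 lt_x)).
by rewrite nth_default.
Qed.

Lemma fits_set_reg s x a : x < NR -> a <= B -> fits s -> fits (set_reg s x a).
Proof.
move=> lt_x le_a [size_r all_r all_m size_m]; split=> //=.
  by rewrite size_set_nth geq_max lt_x.
exact: all_set_nth.
Qed.

Lemma wp_set_reg c s x a t z (Q : state -> nat -> nat -> Prop) :
    exec c s 1 (maxn (bits_used s) (bits_used (set_reg s x a))) (set_reg s x a) ->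
    x < NR -> (fits s -> a <= B) ->
    Q (set_reg s x a) t.+1 z -> wp c s t z Q.
Proof.
move=> ex lt_x le_a Qs; exists 1, 0, (set_reg s x a); rewrite addn1 addn0; split=> //.
exists (maxn (bits_used s) (bits_used (set_reg s x a))) => // fs.
have fs' := fits_set_reg lt_x (le_a fs) fs.
split=> //; first by rewrite addn0.
by rewrite geq_max !bits_used_bound.
Qed.

Lemma wp_const x a s t z (Q : state -> nat -> nat -> Prop) :
  x < NR -> a <= B -> Q (set_reg s x a) t.+1 z -> wp (Const x a) s t z Q.
Proof. by move=> lt_x le_a; apply: wp_set_reg => //; exact: ExecConst. Qed.

Lemma wp_add x y y' s t z (Q : state -> nat -> nat -> Prop) :
  x < NR -> reg s y + reg s y' <= B ->
  Q (set_reg s x (reg s y + reg s y')) t.+1 z -> wp (Add x y y') s t z Q.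
Proof. by move=> lt_x le_a; apply: wp_set_reg => //; exact: ExecAdd. Qed.

Lemma wp_sub x y y' s t z (Q : state -> nat -> nat -> Prop) :
  x < NR -> Q (set_reg s x (reg s y - reg s y')) t.+1 z -> wp (Defs.Sub x y y') s t z Q.
Proof.
move=> lt_x; apply: wp_set_reg => //; first exact: ExecSub.
by move=> /(@reg_le _ y); apply: leq_trans; exact: leq_subr.
Qed.

Lemma wp_get x y s t z (Q : state -> nat -> nat -> Prop) :
  x < NR -> Q (set_reg s x (nth 0 (memory s) (reg s y))) t.+1 z -> wp (MemGet x y) s t z Q.
Proof.
move=> lt_x; apply: wp_set_reg => //; first exact: ExecMemGet.
move=> [_ _ all_m _]; have [lt_y|le_y] := ltnP (reg s y) (size (memory s)).
  exact: (allP all_m _ (mem_nth 0 lt_y)).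
by rewrite nth_default.
Qed.

Lemma wp_set x y s t z (Q : state -> nat -> nat -> Prop) :
  reg s x < K -> Q (Defs.set_mem s (reg s x) (reg s y)) t.+1 z.+1 -> wp (MemSet x y) s t z Q.
Proof.
move=> lt_x Qs; exists 1, 1, (Defs.set_mem s (reg s x) (reg s y)); rewrite !addn1; split=> //.
exists (maxn (bits_used s) (bits_used (Defs.set_mem s (reg s x) (reg s y)))).
  exact: ExecMemSet.
move=> fs; have [size_r all_r all_m size_m] := fs.
have fs' : fits (Defs.set_mem s (reg s x) (reg s y)).
  split=> //=; last by rewrite size_set_nth geq_max lt_x.
  by apply: all_set_nth => //; exact: reg_le.
have le_w : weight (memory (Defs.set_mem s (reg s x) (reg s y))) <=
    weight (memory s) + 1 * trunc_log 2 B.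
  apply: leq_trans (weight_set_nth _ _ _) _; rewrite leq_add2l mul1n.
  by rewrite leq_trunc_log // reg_le.
split=> //; rewrite geq_max; apply/andP; split.
  apply: leq_trans (bits_used_bound fs) _.
  by rewrite /peak_bound leq_add2l leq_mul2r orbT.
by apply: leq_trans (bits_used_bound fs') _; rewrite -[1]addn0; exact: peak_bound_le.
Qed.

Lemma wp_emit x s t z (Q : state -> nat -> nat -> Prop) :
  Q (emit s (reg s x)) t.+1 z -> wp (Emit x) s t z Q.
Proof.
move=> Qs; exists 1, 0, (emit s (reg s x)); rewrite addn1 addn0; split=> //.
exists (bits_used s); first exact: ExecEmit.
by move=> fs; split=> //; [rewrite addn0|exact: bits_used_bound].
Qed.

(** [b] is 0 for a sequence and 1 for a loop iteration, which also pays for its test. The second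
    peak can be bounded from the first state, because the weight gained meanwhile is covered by the
    writes of [c1]. *)
Lemma runs_trans c1 c2 c b s s1 s2 t1 t2 z1 z2 :
    (forall p1 p2, exec c1 s t1 p1 s1 -> exec c2 s1 t2 p2 s2 ->
       exec c s (t1 + t2 + b) (maxn p1 p2) s2) ->
    runs c1 s t1 z1 s1 -> runs c2 s1 t2 z2 s2 ->
  runs c s (t1 + t2 + b) (z1 + z2) s2.
Proof.
move=> ex [p1 ex1 fit1] [p2 ex2 fit2]; exists (maxn p1 p2); first exact: ex.
move=> fs; have [fs1 w1 le1] := fit1 fs; have [fs2 w2 le2] := fit2 fs1; split=> //.
  by apply: leq_trans w2 _; rewrite mulnDl addnA leq_add2r.
rewrite geq_max; apply/andP; split.
  by apply: leq_trans le1 _; rewrite /peak_bound leq_add2l leq_mul2r leq_addr orbT.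
by apply: leq_trans le2 _; exact: peak_bound_le.
Qed.

Lemma wp_seq c1 c2 s t z Q :
  wp c1 s t z (fun s1 t1 z1 => wp c2 s1 t1 z1 Q) -> wp (Seq c1 c2) s t z Q.
Proof.
move=> [t1 [z1 [s1 [run1 [t2 [z2 [s2 [run2 Qs]]]]]]]].
exists (t1 + t2 + 0), (z1 + z2), s2; split; last by rewrite addn0 !addnA.
by apply: runs_trans run1 run2 => p1 p2; rewrite addn0; exact: ExecSeq.
Qed.

Lemma wp_if b c1 c2 s t z Q :
  (if eval_test b s then wp c1 s t.+1 z Q else wp c2 s t.+1 z Q) -> wp (If b c1 c2) s t z Q.
Proof.
case: ifP => [bs|/negbT bs] [dt [dz [s' [[p ex fit] Qs]]]];
  exists dt.+1, dz, s'; (split; last by rewrite addnS); exists p => //.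
- exact: ExecIfTrue.
- exact: ExecIfFalse.
Qed.

Lemma wp_while b c s t z (Q : state -> nat -> nat -> Prop) :
  (if eval_test b s then wp c s t.+1 z (fun s1 t1 z1 => wp (While b c) s1 t1 z1 Q)
   else Q s t.+1 z) -> wp (While b c) s t z Q.
Proof.
case: ifP => [bs|/negbT bs].
  move=> [t1 [z1 [s1 [run1 [t2 [z2 [s2 [run2 Qs]]]]]]]].
  exists (t1 + t2 + 1), (z1 + z2), s2; split; last first.
    by move: Qs; rewrite !addnA addSn addSn addn1.
  by apply: runs_trans run1 run2 => p1 p2; rewrite addn1; exact: ExecWhileTrue.
move=> Qs; exists 1, 0, s; rewrite addn1 addn0; split=> //.
exists (bits_used s); first exact: ExecWhileFalse.
by move=> fs; split=> //; [rewrite addn0|exact: bits_used_bound].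
Qed.

End WeakestPrecondition.

(** Symbolic execution: the register file is a literal list, so that reading and writing registers
    computes, and the side conditions become linear arithmetic. *)
Ltac wp_simpl :=
  cbv [reg set_reg Defs.set_mem emit regs memory output eval_test]; cbn [nth set_nth].
Ltac wp_step := wp_simpl;
  first [ apply: wp_seq
        | apply: wp_const; [by []|lia|]
        | apply: wp_add; [by []|wp_simpl; try lia|]
        | apply: wp_sub; [by []|]
        | apply: wp_get; [by []|]
        | apply: wp_set; [wp_simpl; try lia|]
        | apply: wp_emit ]; wp_simpl.

(** * The trie of a complex *)

(* Constants 0, ..., 4 are kept in the registers of the same number. *)
Local Notation rItems := 5.     (* number of items *)
Local Notation rBlocks := 6.    (* number of blocks *)
(* The entry of item f, block v is stored at 2 + f * rItemStep + v * rBlockStep. *)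
Local Notation rItemStep := 7.
Local Notation rBlockStep := 8.
Local Notation rWidth := 9.     (* cells per node: rItems + 4 *)
Local Notation rBase := 10.     (* address of the root *)
Local Notation rDim := 11.
Local Notation rSwap := 12.     (* 1 if arcs are output reversed *)
Local Notation rCur := 13.      (* address of the node being processed *)
Local Notation rTop := 14.      (* first free address *)
Local Notation rCount := 15.    (* number of nodes *)
Local Notation r16 := 16.
Local Notation r17 := 17.
Local Notation r18 := 18.
Local Notation r19 := 19.
Local Notation r20 := 20.
Local Notation r21 := 21.
Local Notation r22 := 22.
Local Notation r23 := 23.
Local Notation "c1 ;; c2" := (Seq c1 c2) (at level 80, right associativity).

(* A node is a decreasing list S = f :: S' of items, and occupies the cells
     0: f + 1, or 0 for the root;   1: 2 + (f + 1) * rItemStep;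
     2: address of S';              3: number of the node;
     4 + g: address of g :: S, or 0 if there is no such node.
   For the block v = r16, r17 is v * rBlockStep, r18 and r19 are the address and
   the label of a suffix of S, r22 tells whether S is contained in v, and r21 is
   2 + r20 * rItemStep for the item r20 by which S is to be extended. *)
Definition test_loop : prog :=
  While (Lt 0 r19)
   (Add r23 r18 1 ;; MemGet r23 r23 ;; Add r23 r23 r17 ;; Defs.Sub r23 r23 rItemStep ;;
    MemGet r22 r23 ;;
    If (Eq r22 0) (Const r19 0)
      (Add r23 r18 2 ;; MemGet r18 r23 ;; MemGet r19 r18)).

(** The machine has no empty instruction; [Const r22 0] takes its place in a branch with nothing to
    do. *)
Definition extend_loop : prog :=
  While (Lt r20 rItems)
   (Add r23 r21 r17 ;; MemGet r22 r23 ;;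
    If (Lt 0 r22)
      (Add r23 rCur 4 ;; Add r23 r23 r20 ;; MemGet r22 r23 ;;
       If (Eq r22 0)
         (MemSet r23 rTop ;; Add r19 r20 1 ;; MemSet rTop r19 ;;
          Add r22 rTop 1 ;; Add r23 r21 rItemStep ;; MemSet r22 r23 ;;
          Add r22 r22 1 ;; MemSet r22 rCur ;;
          Add r22 r22 1 ;; MemSet r22 rCount ;;
          Add rCount rCount 1 ;; Add rTop rTop rWidth)
         (Const r22 0))
      (Const r22 0) ;;
    Add r20 r20 1 ;; Add r21 r21 rItemStep).

Definition block_loop : prog :=
  While (Lt r16 rBlocks)
   (Add r18 rCur 0 ;; MemGet r19 r18 ;; Const r22 1 ;; test_loop ;;
    If (Eq r22 0) (Const r22 0)
      (MemGet r20 rCur ;; Add r21 rCur 1 ;; MemGet r21 r21 ;; extend_loop) ;;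
    Add r16 r16 1 ;; Add r17 r17 rBlockStep).

Definition build_loop : prog :=
  While (Lt rCur rTop)
   (Const r16 0 ;; Const r17 0 ;; block_loop ;; Add rCur rCur rWidth).

Section Machine.
Variables (M Nb sf sv W base d dir : nat) (bl : nat -> nat -> bool) (D B K : nat).
Hypothesis W_eq : W = M + 4.
Hypothesis K_eq : K = base + D * W.
Hypothesis B_ge : K + W + M * sf + Nb * sv + sf + sv + M + Nb + D + 10 <= B.
Hypothesis matrix_lt_base : forall f v, f < M -> v < Nb -> 2 + f * sf + v * sv < base.

Notation ST cur top cnt v vs q l f fs x y mem out :=
  (State [:: 0; 1; 2; 3; 4; M; Nb; sf; sv; W; base; d; dir; cur; top; cnt;
             v; vs; q; l; f; fs; x; y] mem out).
Notation wp := (wp 24 B K).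

(** The shift by one leaves 0 for the root and makes [label S <= f] say that [f] exceeds all items
    of the decreasing list [S]. *)
Definition label (S : seq nat) : nat := if S is f :: _ then f.+1 else 0.

(** The order of [L] is the order of creation: the index of a list in [L] is the number of its node
    and fixes its address. *)
Record trie (L : seq (seq nat)) : Prop := Trie {
  trie_uniq : uniq L;
  trie_root : [::] \in L;
  trie_root_index : index [::] L = 0;
  trie_node : forall (f : nat) (S : seq nat), f :: S \in L ->
    [/\ S \in L, label S <= f, f < M & exists2 v, v < Nb & all (bl^~ v) (f :: S)]
}.

(** Required of every trie, not only of the finished one, because addresses must stay below [K]
    while the trie is growing. *)
Hypothesis trie_size : forall L, trie L -> size L <= D.

Definition addr (L : seq (seq nat)) (S : seq nat) : nat := base + index S L * W.

(** Cells past the last node read as 0, so the child cells of a new node already say that it has no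
    children; this keeps the number of writes per node constant. *)
Record stored (mem : seq nat) (L : seq (seq nat)) : Prop := Stored {
  stored_label : forall S : seq nat, S \in L -> nth 0 mem (addr L S) = label S;
  stored_row : forall S : seq nat, S \in L -> nth 0 mem (addr L S + 1) = 2 + label S * sf;
  stored_parent : forall (f : nat) (S : seq nat), f :: S \in L -> nth 0 mem (addr L (f :: S) + 2) = addr L S;
  stored_number : forall S : seq nat, S \in L -> nth 0 mem (addr L S + 3) = index S L;
  stored_child : forall (S : seq nat) (f : nat), S \in L -> label S <= f < M ->
    nth 0 mem (addr L S + 4 + f) = if f :: S \in L then addr L (f :: S) else 0;
  stored_free : forall a, base + size L * W <= a -> nth 0 mem a = 0;
  stored_matrix : forall f v, f < M -> v < Nb ->
    nth 0 mem (2 + f * sf + v * sv) = bl f v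
}.

Lemma addr_lt L (S : seq nat) : trie L -> S \in L -> addr L S + W <= K.
Proof.
move=> trL SL; rewrite K_eq /addr -addnA leq_add2l -mulSnr leq_mul2r.
by rewrite (leq_trans _ (trie_size trL)) ?orbT // index_mem.
Qed.

Lemma wp_test_loop L (S : seq nat) (cur top cnt v vs q f fs x y : nat)
    mem out t z (Q : state -> nat -> nat -> Prop) :
    trie L -> stored mem L -> S \in L -> v < Nb -> vs = v * sv -> 0 < x -> q = addr L S ->
    (forall q' x' y' t' : nat, (x' == 0) = ~~ all (bl^~ v) S -> t' <= t + 12 * size S + 1 ->
       Q (ST cur top cnt v vs q' 0 f fs x' y' mem out) t' z) ->
  wp test_loop (ST cur top cnt v vs q (label S) f fs x y mem out) t z Q.
Proof.
move=> trL stL + lt_v vsE; elim: S q x y t => [|g S IHS] q x y t SL x0 -> HQ.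
  apply: wp_while; wp_simpl; rewrite ltnn; apply: HQ; last by lia.
  by rewrite eqn0Ngt x0.
have [SL' le_g lt_g _] := trie_node trL SL.
have lt_addr := addr_lt trL SL.
have le_gM : g * sf + sf <= M * sf by rewrite -mulSnr leq_mul2r lt_g orbT.
have le_vN : v * sv <= Nb * sv by rewrite leq_mul2r ltnW ?orbT.
apply: wp_while; wp_simpl; rewrite /=.
do 4 wp_step; rewrite (stored_row stL SL) /=; do 5 wp_step.
(* Cell 1 of a node points to the row of the item after its head, where the extension of the node
   starts; the row of the head itself is one step back. *)
rewrite (_ : 2 + g.+1 * sf + vs - sf = 2 + g * sf + v * sv); last by rewrite vsE; lia.
wp_step; rewrite (stored_matrix stL) //; apply: wp_if; wp_simpl.
case: (boolP (bl g v)) => blg /=.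
  do 4 wp_step; rewrite (stored_parent stL SL); wp_step; rewrite (stored_label stL SL').
  apply: IHS => // q' x' y' t' x'E le_t'; apply: HQ; last by rewrite /=; lia.
  by rewrite /= blg.
wp_step; apply: wp_while; wp_simpl; rewrite ltnn; apply: HQ; last by rewrite /=; lia.
by rewrite /= (negPf blg).
Qed.

Lemma index_rcons (L : seq (seq nat)) (S S' : seq nat) : S \in L ->
  index S (rcons L S') = index S L.
Proof. by move=> SL; rewrite -cats1 index_cat SL. Qed.

Lemma addr_rcons (L : seq (seq nat)) (S S' : seq nat) : S \in L ->
  addr (rcons L S') S = addr L S.
Proof. by move=> SL; rewrite /addr index_rcons. Qed.

Lemma addr_last (L : seq (seq nat)) (S : seq nat) : S \notin L ->
  addr (rcons L S) S = base + size L * W.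
Proof. by move=> SL; rewrite /addr -cats1 index_cat (negPf SL) /= eqxx addn0. Qed.

Lemma addr_inj (L : seq (seq nat)) (S S' : seq nat) o o' : S \in L -> S' \in L ->
  o < W -> o' < W -> addr L S + o = addr L S' + o' -> S = S' /\ o = o'.
Proof.
move=> SL SL' lt_o lt_o'; rewrite /addr -!addnA => /eqP; rewrite eqn_add2l => /eqP eq_o.
have eq_i : index S L = index S' L.
  have := congr1 (divn^~ W) eq_o; rewrite !divnMDl ?divn_small //; lia.
split; last by move: eq_o; rewrite eq_i; lia.
by rewrite -(nth_index [::] SL) eq_i nth_index.
Qed.

Lemma addr_lt_free (L : seq (seq nat)) (S : seq nat) : S \in L ->
  base <= addr L S /\ addr L S + W <= base + size L * W.
Proof.
move=> SL; rewrite /addr leq_addr -addnA leq_add2l -mulSnr leq_mul2r.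
by rewrite index_mem SL orbT.
Qed.

Lemma trie_rcons L (S : seq nat) f v : trie L -> S \in L -> label S <= f < M ->
    f :: S \notin L -> v < Nb -> all (bl^~ v) (f :: S) ->
  trie (rcons L (f :: S)).
Proof.
move=> trL SL /andP[le_f lt_f] fS lt_v all_v; split.
- by rewrite rcons_uniq fS trie_uniq.
- by rewrite mem_rcons inE trie_root.
- by rewrite index_rcons ?trie_root // trie_root_index.
- move=> g T; rewrite !mem_rcons !inE => /predU1P[[-> ->]|gT].
    by rewrite SL orbT; split=> //; exists v.
  by have [-> -> -> ex_v] := trie_node trL gT; rewrite orbT.
Qed.

Definition add_node (mem : seq nat) (a f top cur cnt : nat) : seq nat :=
  set_nth 0 (set_nth 0 (set_nth 0 (set_nth 0 (set_nth 0 mem a top)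
    top f.+1) (top + 1) (2 + f.+1 * sf)) (top + 2) cur) (top + 3) cnt.

Lemma nth_add_node mem a f top cur cnt b : nth 0 (add_node mem a f top cur cnt) b =
  if b == top + 3 then cnt else if b == top + 2 then cur else
  if b == top + 1 then 2 + f.+1 * sf else if b == top then f.+1 else
  if b == a then top else nth 0 mem b.
Proof. by rewrite /add_node; do 5! rewrite nth_set_nth /=. Qed.

(** Of the five writes of [add_node], one fills the child cell of [S] and four fall into the free
    area; every other cell keeps its value. *)
Lemma stored_add_node mem L (S : seq nat) (f : nat) : trie L -> stored mem L -> S \in L ->
    label S <= f < M -> f :: S \notin L ->
  stored (add_node mem (addr L S + 4 + f) f (base + size L * W) (addr L S) (size L))
    (rcons L (f :: S)).
Proof.
move=> trL stL SL /andP[le_f lt_f] fS.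
have [le_S lt_S] := addr_lt_free SL.
have old (T : seq nat) o : T \in L -> o < W ->
    nth 0 (add_node mem (addr L S + 4 + f) f (base + size L * W) (addr L S) (size L)) (addr L T + o) =
    if (T == S) && (o == 4 + f) then base + size L * W else nth 0 mem (addr L T + o).
  move=> TL lt_o; have [_ lt_T] := addr_lt_free TL; rewrite nth_add_node.
  do 4! (rewrite ifF; last lia).
  case: eqP => [|ne]; first by rewrite -addnA => /addr_inj[] //; [lia|move=> -> ->; rewrite !eqxx].
  by case: andP => // -[/eqP eT /eqP eo]; case: ne; rewrite eT eo addnA.
have mem_old (T : seq nat) : T \in rcons L (f :: S) -> T \in L \/ T = f :: S.
  by rewrite mem_rcons inE => /predU1P[->|]; [right|left].
have new o : o < W ->
    nth 0 (add_node mem (addr L S + 4 + f) f (base + size L * W) (addr L S) (size L))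
      (addr (rcons L (f :: S)) (f :: S) + o) =
    nth 0 [:: f.+1; 2 + f.+1 * sf; addr L S; size L] o.
  move=> lt_o; rewrite (addr_last fS) nth_add_node.
  case: o lt_o => [|[|[|[|o]]]] lt_o; rewrite ?addn0 /=.
  - by do 3! (rewrite ifF; last lia); rewrite eqxx.
  - by rewrite ifF; [rewrite ifF; [rewrite eqxx|lia]|lia].
  - by rewrite ifF; [rewrite eqxx|lia].
  - by rewrite eqxx.
  - by do 5! (rewrite ifF; last lia); rewrite nth_nil (stored_free stL) //; lia.
have lt_W o : o < 4 -> o < W by rewrite W_eq; lia.
split.
- move=> T /mem_old[TL|->]; last by rewrite -[X in nth 0 _ X]addn0 new ?lt_W.
  by rewrite addr_rcons // -[X in nth 0 _ X]addn0 old ?lt_W // andbF addn0 stored_label.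
- move=> T /mem_old[TL|->]; last by rewrite new ?lt_W.
  by rewrite addr_rcons // old ?lt_W // andbF stored_row.
- move=> g T /mem_old[gT|[-> ->]]; last by rewrite new ?lt_W // addr_rcons.
  have [TL _ _ _] := trie_node trL gT.
  by rewrite !addr_rcons // old ?lt_W // andbF (stored_parent stL gT).
- move=> T /mem_old[TL|->].
    by rewrite addr_rcons // old ?lt_W // andbF stored_number // index_rcons.
  by rewrite new ?lt_W // -cats1 index_cat (negPf fS) /= eqxx addn0.
- move=> T g /mem_old[TL|->] /andP[le_g lt_g].
    rewrite addr_rcons // -[X in nth 0 _ X]addnA old //; last by rewrite W_eq; lia.
    rewrite eqn_add2l addnA mem_rcons inE.
    have [/andP[/eqP-> /eqP->]|ne] := boolP ((T == S) && (g == f)).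
      by rewrite eqxx addr_last.
    rewrite stored_child ?le_g //.
    have -> /= : (g :: T == f :: S) = false.
      by apply: contraNF ne => /eqP[-> ->]; rewrite !eqxx.
    by case: ifP => // gT; rewrite addr_rcons.
  rewrite -[X in nth 0 _ X]addnA new; last by rewrite W_eq; lia.
  rewrite nth_default; last by rewrite /=; lia.
  (* No child of the new node can be present yet, since a trie contains the tail of each of its
     lists. *)
  rewrite ifF // mem_rcons inE; apply/negP => /predU1P[/(congr1 size)|].
    by rewrite /=; lia.
  by case/(trie_node trL) => /(negP fS).
- move=> a; rewrite size_rcons mulSnr addnA => le_a; rewrite nth_add_node.
  by do 5! (rewrite ifF; last lia); rewrite (stored_free stL) //; lia.
- move=> g v lt_g lt_v; have := matrix_lt_base lt_g lt_v => lt_b; rewrite nth_add_node.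
  by do 5! (rewrite ifF; last lia); rewrite (stored_matrix stL).
Qed.

(** Writes are charged to the nodes created, five each; an item outside the block, or one whose
    child exists already, causes none. *)
Lemma wp_extend_loop (S : seq nat) (v vs : nat) out (Q : state -> nat -> nat -> Prop) :
    v < Nb -> vs = v * sv -> all (bl^~ v) S ->
  forall n f L cur q l x y mem t z,
    n = M - f -> f <= M -> label S <= f ->
    trie L -> stored mem L -> S \in L -> cur = addr L S ->
    (forall L' l' x' y' mem' t',
       trie L' -> stored mem' L' -> prefix L L' ->
       (forall g, f <= g < M -> bl g v -> g :: S \in L') ->
       t' <= t + 30 * n + 1 ->
       Q (ST cur (base + size L' * W) (size L') v vs q l' M (2 + M * sf) x' y' mem' out)
         t' (z + 5 * (size L' - size L))) ->
  wp extend_loop (ST cur (base + size L * W) (size L) v vs q l f (2 + f * sf) x y mem out)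
    t z Q.
Proof.
move=> lt_v vsE all_v; elim=> [|n IHn] f L cur q l x y mem t z nE le_f lab_f trL stL SL curE HQ.
  have fM : f = M by lia.
  apply: wp_while; wp_simpl; rewrite fM ltnn.
  have := HQ L l x y mem t.+1 trL stL (prefix_refl _); rewrite subnn !muln0 !addn0.
  by apply; [move=> g; lia|lia].
have lt_f : f < M by lia.
have le_fM : f * sf + sf <= M * sf by rewrite -mulSnr leq_mul2r lt_f orbT.
have le_vN : v * sv <= Nb * sv by rewrite leq_mul2r ltnW ?orbT.
have lt_addr := addr_lt trL SL.
have le_top : base + size L * W <= K by rewrite K_eq leq_add2l leq_mul2r trie_size ?orbT.
apply: wp_while; wp_simpl; rewrite lt_f.
do 4 wp_step; rewrite vsE (stored_matrix stL) // -vsE.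
wp_step; apply: wp_if; wp_simpl.
have skip x' y' t' : (bl f v -> f :: S \in L) -> t' <= t + 15 ->
  wp (Add r20 r20 1 ;; Add r21 r21 rItemStep)
     (ST cur (base + size L * W) (size L) v vs q l f (2 + f * sf) x' y' mem out) t' z
     (fun s1 t1 z1 => wp extend_loop s1 t1 z1 Q).
  move=> fS le_t'; do 3 wp_step.
  rewrite (_ : 2 + f * sf + sf = 2 + (f + 1) * sf); last by lia.
  apply: (IHn) => //; [lia|lia|lia|].
  move=> L' l' x'' y'' mem' t'' trL' stL' preL ext le_t''; apply: HQ => //; last by lia.
  move=> g; rewrite leq_eqVlt => /andP[/predU1P[<-|lt_g] lt_gM].
    by move=> /fS fL; have /prefixP[L'' ->] := preL; rewrite mem_cat fL.
  by apply: ext; rewrite addn1 lt_g.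
case: (boolP (bl f v)) => blf; last first.
  by wp_step; apply: skip; [rewrite (negPf blf)|lia].
rewrite /=; do 6 wp_step; rewrite curE stored_child ?lab_f // -curE.
apply: wp_if; wp_simpl; have [fS|fS] := boolP (f :: S \in L).
  (* The matrix lies below [base], so no node has address 0, and 0 can stand for a missing child. *)
  rewrite /= ifF; last by have [] := addr_lt_free fS; have := matrix_lt_base lt_f lt_v; lia.
  by wp_step; apply: skip => //; lia.
rewrite /=.
have trL' : trie (rcons L (f :: S)).
  by apply: (trie_rcons (v := v)); rewrite ?lab_f //= blf.
have stL' : stored (add_node mem (cur + 4 + f) f (base + size L * W) cur (size L))
    (rcons L (f :: S)) by rewrite curE; apply: stored_add_node; rewrite ?lab_f.
have := trie_size trL'; rewrite size_rcons => lt_D.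
have le_top' : base + size L * W + W <= K.
  by rewrite K_eq -addnA leq_add2l -mulSnr leq_mul2r lt_D orbT.
do 23 wp_step; do 3 wp_step.
set s1 := State _ _ _.
have -> : s1 = ST cur (base + size (rcons L (f :: S)) * W) (size (rcons L (f :: S))) v vs q
    (f + 1) f.+1 (2 + f.+1 * sf) (base + size L * W + 1 + 1 + 1) (2 + f * sf + sf)
    (add_node mem (cur + 4 + f) f (base + size L * W) cur (size L)) out.
  by rewrite /s1 size_rcons /add_node; repeat first [reflexivity | lia | f_equal].
apply: IHn; rewrite ?mem_rcons ?inE ?SL ?orbT ?addr_rcons //; try lia.
move=> L' l' x' y' mem' t' trL'' stL'' preL ext le_t'.
have [E L'E] := prefixP preL.
have preL' : prefix L L' by apply/prefixP; exists ((f :: S) :: E); rewrite L'E cat_rcons.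
rewrite (_ : _ + 5 * _ = z + 5 * (size L' - size L)); last first.
  by rewrite L'E size_cat size_rcons; lia.
apply: HQ => //; last by lia.
move=> g; rewrite leq_eqVlt => /andP[/predU1P[<- _ _|lt_g lt_gM]].
  by rewrite L'E mem_cat mem_rcons inE eqxx.
by apply: ext; rewrite lt_g.
Qed.

Lemma wp_block_loop (S : seq nat) out (Q : state -> nat -> nat -> Prop) :
  forall n v L cur q l f fs x y mem t z,
    n = Nb - v -> v <= Nb -> trie L -> stored mem L -> S \in L -> cur = addr L S ->
    (forall L' q' l' f' fs' x' y' mem' t',
       trie L' -> stored mem' L' -> prefix L L' ->
       (forall w g, v <= w < Nb -> all (bl^~ w) S -> label S <= g < M -> bl g w -> g :: S \in L') ->
       t' <= t + \sum_(v <= w < Nb) (30 + 12 * size S + (all (bl^~ w) S) * (30 * M)) + 1 ->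
       Q (ST cur (base + size L' * W) (size L') Nb (Nb * sv) q' l' f' fs' x' y' mem' out)
         t' (z + 5 * (size L' - size L))) ->
  wp block_loop (ST cur (base + size L * W) (size L) v (v * sv) q l f fs x y mem out) t z Q.
Proof.
elim=> [|n IHn] v L cur q l f fs x y mem t z nE le_v trL stL SL -> HQ.
  have vN : v = Nb by lia.
  apply: wp_while; wp_simpl; rewrite vN ltnn.
  have := HQ L q l f fs x y mem t.+1 trL stL (prefix_refl _); rewrite subnn !muln0 !addn0.
  by rewrite vN; apply; [move=> w g; lia|lia].
have lt_v : v < Nb by lia.
have le_vN : v * sv + sv <= Nb * sv by rewrite -mulSnr leq_mul2r lt_v orbT.
have lt_addr := addr_lt trL SL.
have le_top : base + size L * W <= K by rewrite K_eq leq_add2l leq_mul2r trie_size ?orbT.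
have le_lab : label S <= M.
  by case: (S) SL => // g S' /(trie_node trL)[].
have le_labM : label S * sf <= M * sf by rewrite leq_mul2r le_lab orbT.
apply: wp_while; wp_simpl; rewrite lt_v.
do 4 wp_step; rewrite addn0 (stored_label stL SL).
do 3 wp_step; apply: (wp_test_loop (L := L) (S := S)) => // q1 x1 y1 t1 x1E le_t1.
wp_step; apply: wp_if; wp_simpl.
have next L' q' l' f' fs' x' y' mem' t' : trie L' -> stored mem' L' -> prefix L L' ->
    (forall g, all (bl^~ v) S -> label S <= g < M -> bl g v -> g :: S \in L') ->
    t' <= t + 20 + 12 * size S + (all (bl^~ v) S) * (30 * M) ->
  wp (Add r16 r16 1 ;; Add r17 r17 rBlockStep)
     (ST (addr L S) (base + size L' * W) (size L') v (v * sv) q' l' f' fs' x' y' mem' out) t'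
     (z + 5 * (size L' - size L)) (fun s1 t1 z1 => wp block_loop s1 t1 z1 Q).
  move=> trL' stL' preL ext le_t'; do 3 wp_step.
  rewrite (_ : v * sv + sv = (v + 1) * sv); last by lia.
  have [E L'E] := prefixP preL.
  apply: IHn => //; [lia|lia|by rewrite L'E mem_cat SL|by rewrite /addr L'E index_cat SL|].
  move=> L'' q'' l'' f'' fs'' x'' y'' mem'' t'' trL'' stL'' preL' ext' le_t''.
  have [E' L''E] := prefixP preL'.
  rewrite (_ : z + _ + _ = z + 5 * (size L'' - size L)); last first.
    by rewrite L''E L'E !size_cat; lia.
  apply: HQ => //.
  - by apply/prefixP; exists (E ++ E'); rewrite catA -L'E.
  - move=> w g; rewrite leq_eqVlt => /andP[/predU1P[<-|lt_w] lt_wN] all_w lt_g blg.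
      by rewrite L''E mem_cat ext.
    by apply: (ext' w) => //; rewrite addn1 lt_w.
  - rewrite big_ltn //; rewrite (addn1 v) in le_t''.
    move: le_t'' le_t'; set s1 := \sum_(_ <= _ < _) _; set s2 := _ * (30 * M).
    by clear; lia.
rewrite x1E; case: (boolP (all (bl^~ v) S)) => all_v /=; last first.
  wp_step.
  have := next L q1 0 f fs 0 y1 mem t1.+2 trL stL (prefix_refl _).
  rewrite subnn muln0 addn0; apply => [g|]; first by rewrite (negPf all_v).
  by rewrite (negPf all_v); lia.
do 2 wp_step; rewrite (stored_label stL SL).
do 4 wp_step; rewrite (stored_row stL SL).
apply: (wp_extend_loop lt_v _ all_v (n := M - label S)) => //.
move=> L' l' x' y' mem' t' trL' stL' preL ext le_t'.
by apply: next => //; [move=> g _; exact: ext|lia].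
Qed.

Definition node_cost (S : seq nat) : nat :=
  \sum_(0 <= w < Nb) (30 + 12 * size S + (all (bl^~ w) S) * (30 * M)) + 10.

Definition closed_at (L : seq (seq nat)) (S : seq nat) : Prop := forall w g,
  w < Nb -> all (bl^~ w) S -> label S <= g < M -> bl g w -> g :: S \in L.

Lemma addr_nth L i : trie L -> i < size L -> addr L (nth [::] L i) = base + i * W.
Proof. by move=> trL lt_i; rewrite /addr index_uniq // trie_uniq. Qed.

(** [L] is also the queue of the traversal: the nodes before [i] have been expanded, and new ones
    are appended at the end. Since [L] grows meanwhile, the induction is on [D - i]. Closedness
    survives later growth because [L] remains a prefix. *)
Lemma wp_build_loop out (Q : state -> nat -> nat -> Prop) :
  forall n i L v vs q l f fs x y mem t z,
    n = D - i -> i <= size L -> trie L -> stored mem L ->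
    (forall j, j < i -> closed_at L (nth [::] L j)) ->
    (forall L' v' vs' q' l' f' fs' x' y' mem' t',
       trie L' -> stored mem' L' -> prefix L L' ->
       (forall S, S \in L' -> closed_at L' S) ->
       t' <= t + \sum_(i <= j < size L') node_cost (nth [::] L' j) + 1 ->
       Q (ST (base + size L' * W) (base + size L' * W) (size L') v' vs' q' l' f' fs' x' y' mem' out)
         t' (z + 5 * (size L' - size L))) ->
  wp build_loop
    (ST (base + i * W) (base + size L * W) (size L) v vs q l f fs x y mem out) t z Q.
Proof.
elim=> [|n IHn] i L v vs q l f fs x y mem t z nE le_i trL stL closedL HQ;
  have le_D := trie_size trL; have le_DW : D * W <= K by rewrite K_eq leq_addl.
  have iL : i = size L by lia.
  apply: wp_while; wp_simpl; rewrite iL ltnn.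
  have := HQ L v vs q l f fs x y mem t.+1 trL stL (prefix_refl _).
  rewrite iL subnn big_geq // !muln0 !addn0; apply; last by lia.
  by move=> S SL; rewrite -(nth_index [::] SL); apply: closedL; rewrite iL index_mem.
have [lt_i|le_iL] := ltnP i (size L); last first.
  have iL : i = size L by lia.
  apply: wp_while; wp_simpl; rewrite iL ltnn.
  have := HQ L v vs q l f fs x y mem t.+1 trL stL (prefix_refl _).
  rewrite iL subnn big_geq // !muln0 !addn0; apply; last by lia.
  by move=> S SL; rewrite -(nth_index [::] SL); apply: closedL; rewrite iL index_mem.
have lt_iW : i * W < size L * W by rewrite ltn_mul2r lt_i W_eq addnS.
have le_iW : i * W + W <= size L * W by rewrite -mulSnr leq_mul2r lt_i orbT.
have le_top : base + size L * W <= K by rewrite K_eq leq_add2l leq_mul2r le_D orbT.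
apply: wp_while; wp_simpl; rewrite ltn_add2l lt_iW.
do 5 wp_step.
set S := nth [::] L i; have SL : S \in L by exact: mem_nth.
rewrite -{1}(mul0n sv); apply: (wp_block_loop (S := S) (n := Nb - 0)) => //.
  by rewrite addr_nth.
move=> L' q' l' f' fs' x' y' mem' t' trL' stL' preL ext le_t'.
have [E L'E] := prefixP preL.
have nthL' j : j < size L -> nth [::] L' j = nth [::] L j by move=> lt_j; rewrite L'E nth_cat lt_j.
wp_step; rewrite -addnA -mulSnr.
apply: IHn => //; [lia|by rewrite L'E size_cat; lia| |].
  move=> j; rewrite ltnS leq_eqVlt => /predU1P[->|lt_j].
    by rewrite nthL' // => w g lt_w all_w lt_g blg; apply: (ext w).
  rewrite nthL'; last by lia.
  by move=> w g lt_w all_w lt_g blg; rewrite L'E mem_cat (closedL _ lt_j w g).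
move=> L'' v'' vs'' q'' l'' f'' fs'' x'' y'' mem'' t'' trL'' stL'' preL' closedL'' le_t''.
have [E' L''E] := prefixP preL'.
rewrite (_ : z + _ + _ = z + 5 * (size L'' - size L)); last first.
  by rewrite L''E L'E !size_cat; lia.
apply: HQ => //; first by apply/prefixP; exists (E ++ E'); rewrite catA -L'E.
have size_le : size L <= size L'' by rewrite L''E L'E !size_cat; lia.
rewrite big_ltn; last by lia.
have -> : nth [::] L'' i = S by rewrite L''E nth_cat L'E size_cat ltn_addr // nth_cat lt_i.
by move: le_t'' le_t'; rewrite /node_cost; lia.
Qed.

End Machine.

(** * Output of the arcs *)

Definition climb_loop : prog :=
  While (Lt r23 r20) (Add r19 r17 2 ;; MemGet r17 r19 ;; Add r23 r23 1).

(** The items in front of the deleted one must be put back from the smallest to the largest, but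
    parent pointers lead from larger items to smaller ones. Hence each is found anew by climbing
    from the current node, which makes the time per arc quadratic in the size of the set. *)
Definition descend_loop : prog :=
  While (Lt 0 r20)
   (Defs.Sub r20 r20 1 ;; Add r17 rCur 0 ;; Const r23 0 ;; climb_loop ;;
    MemGet r19 r17 ;; Add r19 r19 r22 ;; Add r19 r19 3 ;; MemGet r22 r19).

(** The first argument is the larger set, or the extra face. In a simple polytope a larger set is a
    smaller face and comes first; in a simplicial one the order is reversed. *)
Definition emit_arc (x y : nat) : prog :=
  If (Eq rSwap 0) (Emit x ;; Emit y) (Emit y ;; Emit x).

Definition arc_loop : prog :=
  While (Lt 0 r19)
   (Add r23 r18 2 ;; MemGet r18 r23 ;; Add r22 r18 0 ;; Add r20 r16 0 ;; descend_loop ;;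
    Add r23 r22 3 ;; MemGet r23 r23 ;; emit_arc r21 r23 ;;
    Add r16 r16 1 ;; MemGet r19 r18).

(** When [arc_loop] ends, [r16] has counted the items of the node. A node with d items is a whole
    block and is joined to the extra face, whose number is [rCount]. *)
Definition output_loop : prog :=
  While (Lt rCur rTop)
   (Const r16 0 ;; Add r18 rCur 0 ;; MemGet r19 r18 ;; Add r23 rCur 3 ;; MemGet r21 r23 ;;
    arc_loop ;;
    If (Eq r16 rDim) (emit_arc rCount r21) (Const r22 0) ;;
    Add rCur rCur rWidth).

Section Output.
Variables (M Nb sf sv W base d dir : nat) (bl : nat -> nat -> bool) (D B K : nat).
Hypothesis W_eq : W = M + 4.
Hypothesis K_eq : K = base + D * W.
Hypothesis B_ge : K + W + M * sf + Nb * sv + sf + sv + M + Nb + D + 10 <= B.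
Hypothesis trie_size : forall L, trie M Nb bl L -> size L <= D.

Notation ST cur top cnt v vs q l f fs x y mem out :=
  (State [:: 0; 1; 2; 3; 4; M; Nb; sf; sv; W; base; d; dir; cur; top; cnt;
             v; vs; q; l; f; fs; x; y] mem out).
Notation wp := (wp 24 B K).

Variables (L : seq (seq nat)) (mem : seq nat).
Hypotheses (trL : trie M Nb bl L) (stL : stored M Nb sf sv W base bl mem L).
Hypothesis subseqL : forall S T : seq nat, S \in L -> subseq T S -> T \in L.
Notation addr := (addr W base L).
Notation top := (base + size L * W).

Lemma node_size_le (S : seq nat) : S \in L -> size S <= M.
Proof.
suff bound : S \in L -> size S <= label S.
  by move=> /[dup] /bound; case: S {bound} => // g S le /(trie_node trL)[_ _ lt_g _]; apply: leq_trans le lt_g.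
elim: S => //= g S IHS /(trie_node trL)[SL le_g _ _].
by rewrite ltnS (leq_trans (IHS SL)).
Qed.

Lemma wp_climb (S : seq nat) u out (Q : state -> nat -> nat -> Prop) :
  S \in L -> u <= size S ->
  forall n w cur v q l fs x t z, n = u - w -> w <= u ->
    (forall l' t', t' <= t + 5 * n + 1 ->
       Q (ST cur top (size L) v (addr (drop u S)) q l' u fs x u mem out) t' z) ->
  wp climb_loop (ST cur top (size L) v (addr (drop w S)) q l u fs x w mem out) t z Q.
Proof.
move=> SL le_u; elim=> [|n IHn] w cur v q l fs x t z nE le_w HQ.
  have -> : w = u by lia.
  by apply: wp_while; wp_simpl; rewrite ltnn; apply: HQ; lia.
have lt_w : w < u by lia.
have dropE : drop w S = nth 0 S w :: drop w.+1 S by rewrite -drop_nth // (leq_trans lt_w).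
have wL : nth 0 S w :: drop w.+1 S \in L by rewrite -dropE (subseqL SL) // drop_subseq.
have lt_addr := addr_lt K_eq trie_size trL wL.
have := node_size_le SL => le_M.
apply: wp_while; wp_simpl; rewrite lt_w dropE.
do 5 wp_step; rewrite (stored_parent stL wL) addn1.
by apply: IHn => [||l' t' le_t']; [lia|lia|apply: HQ; lia].
Qed.

(** With the items at positions u, ..., k - 1 put back, the descent has reached
    [drop u (take k S) ++ R]; this node exists because the trie is closed under sublists. *)
Lemma wp_descend (S : seq nat) k out (Q : state -> nat -> nat -> Prop) :
  S \in L -> k < size S -> let R := drop k.+1 S in
  forall u v vs q l fs x y t z, u <= k -> x = addr (drop u (take k S) ++ R) ->
    (forall vs' l' y' t', t' <= t + u * (5 * size S + 15) + 1 ->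
       Q (ST (addr S) top (size L) v vs' q l' 0 fs (addr (take k S ++ R)) y' mem out) t' z) ->
  wp descend_loop
    (ST (addr S) top (size L) v vs q l u fs x y mem out) t z Q.
Proof.
move=> SL lt_k R; elim=> [|u IHu] v vs q l fs x y t z le_u -> HQ.
  apply: wp_while; wp_simpl; rewrite ltnn drop0.
  by have := HQ vs l y t.+1; apply; lia.
have lt_addr := addr_lt K_eq trie_size trL SL.
have le_M := node_size_le SL.
have lt_uS : u < size S by lia.
have stepE : drop u (take k S) ++ R = nth 0 S u :: drop u.+1 (take k S) ++ R.
  rewrite (drop_nth 0) ?size_take; last by case: ifP; lia.
  by rewrite nth_take //; lia.
have inL j : drop j (take k S) ++ R \in L.
  apply: (subseqL SL); rewrite -[X in subseq _ X](cat_take_drop k S).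
  apply: cat_subseq; first exact: drop_subseq.
  by rewrite /R -addn1 addnC -drop_drop drop_subseq.
have lt_addr' := addr_lt K_eq trie_size trL (inL u.+1).
have := inL u; rewrite stepE => inLu; have [_ le_lab lt_lab _] := trie_node trL inLu.
have dropS : drop u S = nth 0 S u :: drop u.+1 S by rewrite -drop_nth.
have dropL : drop u S \in L by rewrite (subseqL SL) // drop_subseq.
apply: wp_while; wp_simpl; rewrite /=.
do 7 wp_step; rewrite addn0 subn1 /=.
rewrite -{2}(drop0 S); apply: (wp_climb SL _ (n := u)) => //; [lia|lia|].
move=> l' t' le_t'.
do 2 wp_step; rewrite (stored_label stL dropL) dropS /=.
do 5 wp_step.
(* The label is the item plus one, so adding 3 to it gives the offset of the child cell, 4 plus the
   item. *)
rewrite (_ : _ + 3 = addr (drop u.+1 (take k S) ++ R) + 4 + nth 0 S u); last by lia.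
rewrite (stored_child stL) ?le_lab // inLu -stepE.
apply: IHu => [||vs'' l'' y'' t'' le_t'']; [lia|by []|].
by apply: HQ; lia.
Qed.

Definition arc_out (i j : nat) : seq nat := if dir == 0 then [:: i; j] else [:: j; i].

Lemma wp_emit_arc x y s t z (Q : state -> nat -> nat -> Prop) : reg s rSwap = dir -> reg s 0 = 0 ->
  Q (State (regs s) (memory s) (output s ++ arc_out (reg s x) (reg s y))) t.+3 z ->
  wp (emit_arc x y) s t z Q.
Proof.
move=> sdir s0 HQ; apply: wp_if; rewrite /eval_test sdir s0; move: HQ; rewrite /arc_out.
by case: eqP => _ HQ; apply: wp_seq; apply: wp_emit; apply: wp_emit; move: HQ;
  rewrite /emit /= -!cats1 -catA.
Qed.

Definition delete (j : nat) (S : seq nat) : seq nat := take j S ++ drop j.+1 S.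

Definition arcs_out (S : seq nat) (k : nat) : seq nat :=
  flatten [seq arc_out (index S L) (index (delete j S) L) | j <- iota k (size S - k)].

Lemma wp_arc_loop (S : seq nat) (Q : state -> nat -> nat -> Prop) : S \in L ->
  forall n k vs f x y out t z, n = size S - k -> k <= size S ->
    (forall vs' q' l' f' x' y' t',
       t' <= t + n * (size S * (5 * size S + 15) + 20) + 1 ->
       Q (ST (addr S) top (size L) (size S) vs' q' l' f' (index S L) x' y' mem
            (out ++ arcs_out S k)) t' z) ->
  wp arc_loop
    (ST (addr S) top (size L) k vs (addr (drop k S)) (label (drop k S)) f (index S L) x y mem out)
    t z Q.
Proof.
move=> SL; have le_M := node_size_le SL.
elim=> [|n IHn] k vs f x y out t z nE le_k HQ.
  have kS : k = size S by lia.
  apply: wp_while; wp_simpl; rewrite kS drop_size /=.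
  have := HQ vs (addr [::]) 0 f x y t.+1.
  by rewrite /arcs_out kS subnn /= cats0; apply; lia.
have lt_k : k < size S by lia.
have dropE : drop k S = nth 0 S k :: drop k.+1 S by rewrite -drop_nth.
have kL : nth 0 S k :: drop k.+1 S \in L by rewrite -dropE (subseqL SL) // drop_subseq.
have k1L : drop k.+1 S \in L by rewrite (subseqL SL) // drop_subseq.
have lt_addr := addr_lt K_eq trie_size trL kL.
have lt_addr1 := addr_lt K_eq trie_size trL k1L.
have delL : delete k S \in L.
  apply: (subseqL SL); rewrite -[X in subseq _ X](cat_take_drop k S).
  by apply: cat_subseq; rewrite // -addn1 addnC -drop_drop drop_subseq.
have lt_addrd := addr_lt K_eq trie_size trL delL.
apply: wp_while; wp_simpl; rewrite dropE /=.
do 4 wp_step; rewrite (stored_parent stL kL).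
do 5 wp_step; rewrite !addn0.
have take_k : drop k (take k S) ++ drop k.+1 S = drop k.+1 S.
  by rewrite (drop_oversize (s := take k S)) // size_take; case: ifP; lia.
apply: (wp_descend SL lt_k) => [//||vs' l' y' t' le_t']; first by rewrite take_k.
rewrite -/(delete k S); do 4 wp_step; rewrite (stored_number stL delL).
wp_step; apply: wp_emit_arc => //; wp_simpl.
do 3 wp_step; rewrite (stored_label stL k1L) addn1.
apply: IHn => [||vs'' q'' l'' f'' x'' y'' t'' le_t'']; [lia|lia|].
rewrite -catA (_ : arc_out _ _ ++ _ = arcs_out S k).
  apply: HQ; move: le_t'' le_t'; rewrite mulSn; set c := size S * _.
  have : k * (5 * size S + 15) <= c by [rewrite /c leq_mul2r ltnW ?orbT]; lia.
rewrite /arcs_out (_ : size S - k = (size S - k.+1).+1); last by lia.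
by [].
Qed.

Definition node_out (S : seq nat) : seq nat :=
  arcs_out S 0 ++ (if size S == d then arc_out (size L) (index S L) else [::]).

Definition output_cost (S : seq nat) : nat := size S * (size S * (5 * size S + 15) + 20) + 20.

Lemma wp_output_loop (Q : state -> nat -> nat -> Prop) :
  forall n i v vs q l f fs x y out t z, n = size L - i -> i <= size L ->
    (forall s' t',
       output s' = out ++ flatten [seq node_out U | U <- drop i L] ->
       t' <= t + \sum_(U <- drop i L) output_cost U + 1 ->
       Q s' t' z) ->
  wp output_loop (ST (base + i * W) top (size L) v vs q l f fs x y mem out) t z Q.
Proof.
have le_D := trie_size trL.
have le_top : base + size L * W <= K by rewrite K_eq leq_add2l leq_mul2r le_D orbT.
elim=> [|n IHn] i v vs q l f fs x y out t z nE le_i HQ.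
  have iL : i = size L by lia.
  apply: wp_while; wp_simpl; rewrite iL ltnn; apply: HQ.
    by rewrite iL drop_size cats0.
  by rewrite iL drop_size big_nil; lia.
have lt_i : i < size L by lia.
set S := nth [::] L i; have SL : S \in L by exact: mem_nth.
have dropE : drop i L = S :: drop i.+1 L by rewrite -drop_nth.
have le_iW : i * W + W <= size L * W by rewrite -mulSnr leq_mul2r lt_i orbT.
have addrS : base + i * W = addr S by rewrite (addr_nth W base trL).
have numS : i = index S L by rewrite index_uniq // (trie_uniq trL).
have le_M := node_size_le SL.
apply: wp_while; wp_simpl; rewrite ltn_add2l ifT; last by lia.
do 6 wp_step; rewrite addn0 addrS (stored_label stL SL).
do 4 wp_step; rewrite (stored_number stL SL).
wp_step; rewrite -{2 3}(drop0 S); apply: (wp_arc_loop SL (n := size S)) => //.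
  by rewrite subn0.
move=> vs' q' l' f' x' y' t' le_t'.
wp_step; apply: wp_if; wp_simpl.
have finish out' x'' t'' : out' = out ++ node_out S -> t'' <= t' + 6 ->
    wp (Add rCur rCur rWidth)
      (ST (addr S) top (size L) (size S) vs' q' l' f' (index S L) x'' y' mem out') t'' z
      (fun s1 t1 z1 => wp output_loop s1 t1 z1 Q).
  move=> -> le_t''; rewrite -addrS; wp_step; rewrite -addnA -mulSnr.
  apply: IHn => [||s1 t1 out1 le_t1]; [lia|lia|].
  apply: HQ; first by rewrite out1 dropE /= catA.
  by rewrite dropE big_cons [output_cost S]/output_cost; move: le_t1; set c := \sum_(_ <- _) _; lia.
rewrite /=; case: ifP => eq_d.
  by apply: wp_emit_arc => //; wp_simpl; apply: finish; [rewrite /node_out eq_d -catA|lia].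
by wp_step; apply: finish; [rewrite /node_out eq_d cats0|lia].
Qed.

End Output.

(* Rows of the matrix are the items if there are at most as many rows as
   columns, which is the case for every simple polytope; a polytope with equally
   many facets and vertices is simple if it is simplicial. *)
Definition orient : prog :=
  Const r23 0 ;; Const 1 1 ;; Const 2 2 ;; Const 3 3 ;; Const 4 4 ;;
  MemGet rItems 0 ;; MemGet rBlocks 1 ;;
  If (Lt rBlocks rItems)
    (Add r23 rItems 0 ;; Add rItems rBlocks 0 ;; Add rBlocks r23 0 ;;
     Const rItemStep 1 ;; Add rBlockStep rItems 0 ;; Const rSwap 1)
    (Add rItemStep rBlocks 0 ;; Const rBlockStep 1 ;; Const rSwap 0).

(** The size of the input is accumulated row by row, for lack of a multiplication; the same pass
    counts the items of block 0, which yields [d], a number that the input does not contain. *)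
Definition size_loop : prog :=
  While (Lt r16 rItems)
   (Add rBase rBase rBlocks ;; MemGet r22 r21 ;; Add rDim rDim r22 ;;
    Add r21 r21 rItemStep ;; Add r16 r16 1).

(** The label, number and child cells of the root are 0 already, so only its cell 1 is written. The
    number of faces is emitted as [rCount] plus one, for the extra face. *)
Definition main : prog :=
  Const rBase 2 ;; Const rDim 0 ;; Const r16 0 ;; Const r21 2 ;; size_loop ;;
  Add rWidth rItems 4 ;; Add rCur rBase 0 ;; Add rTop rBase rWidth ;; Const rCount 1 ;;
  Add r23 rBase 1 ;; MemSet r23 2 ;;
  build_loop ;;
  Add r22 rCount 1 ;; Emit r22 ;; Add rCur rBase 0 ;; output_loop.

(** * The lists contained in a finished trie *)

Section Characterization.
Variables (M Nb : nat) (bl : nat -> nat -> bool).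

Lemma label_le_sorted (f : nat) S : sorted gtn S -> (label S <= f) = sorted gtn (f :: S).
Proof. by case: S => //= g S ->; rewrite andbT. Qed.

Lemma trie_sorted L (S : seq nat) : trie M Nb bl L -> S \in L -> sorted gtn S /\ all (gtn M) S.
Proof.
move=> trL; elim: S => [|f S IHS] // fSL; have [SL le_f lt_f _] := trie_node trL fSL.
have [sortS ltS] := IHS SL; rewrite -label_le_sorted //; split=> //.
by apply/andP.
Qed.

(** Induction along tails: the head of a decreasing list is its largest item, so it is tried when
    the node of the tail is processed with the common block. *)
Lemma closed_trieP L (S : seq nat) : 0 < Nb -> trie M Nb bl L ->
    (forall T : seq nat, T \in L -> closed_at M Nb bl L T) ->
  S \in L <-> [/\ sorted gtn S, all (gtn M) S & exists2 v, v < Nb & all (bl^~ v) S].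
Proof.
move=> Nb0 trL closedL; split=> [SL|[]].
  have [sortS ltS] := trie_sorted trL SL; split=> //.
  by case: S SL {sortS ltS} => [|f S] SL; [exists 0|have [] := trie_node trL SL].
elim: S => [_ _ _|f S IHS sortfS /andP[lt_f lt_S] [v lt_v /andP[blf blS]]].
  exact: trie_root trL.
have sortS := path_sorted sortfS.
have SL : S \in L by apply: IHS => //; exists v.
by apply: (closedL S SL v) => //; rewrite label_le_sorted // sortfS.
Qed.

Lemma closed_trie_subseq L (S T : seq nat) : 0 < Nb -> trie M Nb bl L ->
    (forall U : seq nat, U \in L -> closed_at M Nb bl L U) ->
  S \in L -> subseq T S -> T \in L.
Proof.
move=> Nb0 trL closedL SL sub.
have [sortS ltS [v lt_v allS]] := (closed_trieP S Nb0 trL closedL).1 SL.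
apply/(closed_trieP T Nb0 trL closedL); split.
- by apply: subseq_sorted sub sortS => x y z /= lt1 lt2; apply: ltn_trans lt2 lt1.
- by apply/allP => f /(mem_subseq sub); exact: (allP ltS).
- by exists v => //; apply/allP => f /(mem_subseq sub); exact: (allP allS).
Qed.

End Characterization.

Section Main.
Variables (M Nb sf sv W base d dir : nat) (bl : nat -> nat -> bool) (D B K : nat).
Variable mem : seq nat.
Hypotheses (W_eq : W = M + 4) (base_eq : base = 2 + M * Nb) (K_eq : K = base + D * W).
Hypothesis d_eq : d = \sum_(0 <= f < M) bl f 0.
Hypothesis B_ge : K + W + M * sf + Nb * sv + sf + sv + M + Nb + D + 10 <= B.
Hypothesis matrix_lt_base : forall f v, f < M -> v < Nb -> 2 + f * sf + v * sv < base.
Hypothesis trie_size : forall L, trie M Nb bl L -> size L <= D.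
Hypotheses (Nb_gt0 : 0 < Nb) (D_gt0 : 0 < D).
Hypothesis size_mem : size mem <= base.
Hypothesis mem_matrix : forall f v, f < M -> v < Nb ->
  nth 0 mem (2 + f * sf + v * sv) = bl f v.

Notation ST W base d cur top cnt v vs q l f fs x y mem out :=
  (State [:: 0; 1; 2; 3; 4; M; Nb; sf; sv; W; base; d; dir; cur; top; cnt;
             v; vs; q; l; f; fs; x; y] mem out).
Notation wp := (wp 24 B K).

Lemma wp_size_loop y out (Q : state -> nat -> nat -> Prop) :
  forall n i x t z, n = M - i -> i <= M ->
    (forall fs' x' t', t' <= t + 7 * n + 1 ->
       Q (ST 0 base d 0 0 0 M 0 0 0 0 fs' x' y mem out) t' z) ->
  wp size_loop (ST 0 (2 + i * Nb) (\sum_(0 <= f < i) bl f 0) 0 0 0 i 0 0 0 0 (2 + i * sf) x y mem out)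
    t z Q.
Proof.
elim=> [|n IHn] i x t z nE le_i HQ.
  have -> : i = M by lia.
  by apply: wp_while; wp_simpl; rewrite ltnn -base_eq -d_eq; apply: HQ; lia.
have lt_i : i < M by lia.
have le_iN : i * Nb + Nb <= M * Nb by rewrite -mulSnr leq_mul2r lt_i orbT.
have le_if : i * sf + sf <= M * sf by rewrite -mulSnr leq_mul2r lt_i orbT.
have sum_le j : \sum_(0 <= f < j) bl f 0 <= j.
  apply: leq_trans (_ : \sum_(0 <= f < j) 1 <= j); last by rewrite sum_nat_const_nat; lia.
  by apply: leq_sum => f _; case: (bl f 0).
apply: wp_while; wp_simpl; rewrite lt_i.
have := mem_matrix lt_i Nb_gt0; rewrite mul0n addn0 => mem_i.
do 4 wp_step; rewrite mem_i.
have := sum_le i => le_sum; have bl1 : bl i 0 <= 1 by case: (bl i 0).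
do 5 wp_step.
rewrite (_ : 2 + i * Nb + Nb = 2 + (i + 1) * Nb); last by lia.
rewrite (_ : 2 + i * sf + sf = 2 + (i + 1) * sf); last by lia.
rewrite (_ : \sum_(0 <= f < i) bl f 0 + bl i 0 = \sum_(0 <= f < i + 1) bl f 0); last first.
  by rewrite addn1 big_nat_recr.
by apply: IHn => [||fs' x' t' le_t']; [lia|lia|apply: HQ; lia].
Qed.

Lemma root_stored : stored M Nb sf sv W base bl (set_nth 0 mem (base + 1) 2) [:: [::]].
Proof.
have free a : base <= a -> nth 0 mem a = 0 by move=> le_a; rewrite nth_default // (leq_trans size_mem).
split.
- by move=> S; rewrite inE => /eqP->; rewrite /addr /= mul0n addn0 nth_set_nth /= ifF ?free //; lia.
- by move=> S; rewrite inE => /eqP->; rewrite /addr /= !mul0n addn0 nth_set_nth /= eqxx.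
- by move=> f S; rewrite inE.
- move=> S; rewrite inE => /eqP->; rewrite /addr /= mul0n addn0 nth_set_nth /= ifF ?free //; lia.
- move=> S f; rewrite inE => /eqP-> /andP[_ lt_f]; rewrite /addr /= mul0n addn0 nth_set_nth /=.
  by rewrite ifF ?free //; lia.
- move=> a; rewrite /= mul1n W_eq => le_a; rewrite nth_set_nth /= ifF ?free //; lia.
- move=> f v lt_f lt_v; have := matrix_lt_base lt_f lt_v => lt_b.
  by rewrite nth_set_nth /= ifF ?mem_matrix //; lia.
Qed.

Definition total_cost (L : seq (seq nat)) : nat :=
  \sum_(U <- L) (node_cost M Nb bl U + output_cost U).

Lemma wp_main y (Q : state -> nat -> nat -> Prop) t z :
    (forall L s' t' z', trie M Nb bl L ->
       (forall S : seq nat, S \in L <->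
          [/\ sorted gtn S, all (gtn M) S & exists2 v, v < Nb & all (bl^~ v) S]) ->
       output s' = (size L).+1 :: flatten [seq node_out d dir L U | U <- L] ->
       t' <= t + 7 * M + total_cost L + 40 -> z' <= z + 1 + 5 * size L -> Q s' t' z') ->
  wp main (ST 0 0 0 0 0 0 0 0 0 0 0 0 0 y mem [::]) t z Q.
Proof.
move=> HQ; have WDK : W <= D * W by rewrite leq_pmull.
do 9 wp_step.
have -> : State [:: 0; 1; 2; 3; 4; M; Nb; sf; sv; 0; 2; 0; dir; 0; 0; 0; 0; 0; 0; 0; 0; 2; 0; y]
    mem [::] = ST 0 (2 + 0 * Nb) (\sum_(0 <= f < 0) bl f 0) 0 0 0 0 0 0 0 0 (2 + 0 * sf) 0 y mem [::].
  by rewrite !mul0n big_geq.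
apply: (wp_size_loop (n := M)) => [||fs' x' t' le_t']; rewrite ?subn0 //.
do 13 wp_step; set s1 := State _ _ _.
have -> : s1 = ST W base d (base + 0 * W) (base + size [:: [::] : seq nat] * W)
    (size [:: [::] : seq nat]) M 0 0 0 0 fs' x' (base + 1) (set_nth 0 mem (base + 1) 2) [::].
  by rewrite /s1 /= W_eq mul0n mul1n !addn0.
apply: (wp_build_loop W_eq K_eq B_ge matrix_lt_base trie_size (n := D - 0) (L := [:: [::]])) => //.
  exact: root_stored.
move=> L v' vs' q' l' f' fs'' x'' y'' mem' t'' trL stL preL closedL le_t''.
have size_L := trie_size trL.
have le_top : base + size L * W <= K by rewrite K_eq leq_add2l leq_mul2r size_L orbT.
do 6 wp_step; set s2 := State _ _ _.
have -> : s2 = ST W base d (base + 0 * W) (base + size L * W) (size L) v' vs' q' l' f' fs''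
    (size L + 1) y'' mem' [:: size L + 1] by rewrite /s2 mul0n addn0.
apply: (wp_output_loop W_eq K_eq B_ge trie_size trL stL _ (n := size L - 0)) => //.
  by move=> S T; apply: (closed_trie_subseq Nb_gt0 trL).
rewrite drop0 (addn1 (size L)) => s' t1 out1 le_t1; apply: (HQ L) => //.
- by move=> S; exact: closed_trieP.
- rewrite /total_cost big_split /=; move: le_t1 le_t''.
  rewrite -(big_nth [::] predT (node_cost M Nb bl)).
  by set c1 := \sum_(_ <- _) _; set c2 := \sum_(_ <- _) _; lia.
- by rewrite /=; lia.
Qed.

End Main.

(** * Pure simplicial complexes *)

Section Complex.
Variables (q p : nat) (blocks : 'I_p -> {set 'I_q}) (d : nat).

Definition complex : {set {set 'I_q}} := [set U : {set 'I_q} | [exists v, U \subset blocks v]].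

(* [None] stands for the one face that does not come from the complex: the
   empty face of a simple polytope, the whole of a simplicial one. *)
Definition is_node (x : option {set 'I_q}) : bool :=
  if x is Some U then U \in complex else true.

(** Oriented as in a simple polytope, where the larger set is the smaller face and the extra face
    lies below the sets with [d] items. *)
Definition covers (x y : option {set 'I_q}) : bool :=
  match x, y with
  | Some U, Some V => (V \subset U) && (#|U| == #|V|.+1)
  | None, Some U => #|U| == d
  | _, None => false
  end.

(** For d = 0 the time bound is a constant; [blocks_dim0] together with [items_le_blocks] then
    leaves a single item and a single block. *)
Record pure_complex : Prop := PureComplex {
  card_block : forall v, #|blocks v| = d;
  blocks_inj : injective blocks;
  items_le_blocks : q <= p;
  item_covered : 0 < d -> forall f, exists v, f \in blocks v;
  items_gt0 : 0 < q;
  blocks_dim0 : d = 0 -> p = 1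
}.

Lemma complexP (U : {set 'I_q}) : reflect (exists v, U \subset blocks v) (U \in complex).
Proof. by rewrite inE; apply: existsP. Qed.

Definition incident (f v : nat) : bool :=
  [exists i : 'I_q, exists j : 'I_p, [&& val i == f, val j == v & i \in blocks j]].

Lemma incident_ord (i : 'I_q) (j : 'I_p) : incident i j = (i \in blocks j).
Proof.
apply/existsP/idP => [[i' /existsP[j' /and3P[/eqP/val_inj-> /eqP/val_inj->]]]|ij] //.
by exists i; apply/existsP; exists j; rewrite !eqxx.
Qed.

Definition node_list (S : seq nat) : Prop :=
  [/\ sorted gtn S, all (gtn q) S & exists2 v, v < p & all (incident^~ v) S].

Definition to_set (S : seq nat) : {set 'I_q} := [set i | val i \in S].

Lemma gtn_sorted_uniq S : sorted gtn S -> uniq S.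
Proof.
apply: sorted_uniq => [x y z lt1 lt2|x]; last by rewrite /= ltnn.
exact: ltn_trans lt2 lt1.
Qed.

Lemma map_val_to_set S : uniq S -> all (gtn q) S -> perm_eq (map val (enum (to_set S))) S.
Proof.
move=> uS ltS; apply: uniq_perm => // [|x]; first by rewrite map_inj_uniq ?enum_uniq //; exact: val_inj.
apply/mapP/idP => [[i iS ->]|xS]; first by move: iS; rewrite mem_enum inE.
by exists (Ordinal (allP ltS x xS)); rewrite // mem_enum inE.
Qed.

Lemma card_to_set S : uniq S -> all (gtn q) S -> #|to_set S| = size S.
Proof. by move=> uS ltS; rewrite cardE -(perm_size (map_val_to_set uS ltS)) size_map. Qed.

Lemma to_set_inj S T : sorted gtn S -> all (gtn q) S -> sorted gtn T -> all (gtn q) T ->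
  to_set S = to_set T -> S = T.
Proof.
move=> sS ltS sT ltT eqST.
apply: (irr_sorted_eq (leT := gtn)) => // [x y z lt1 lt2|x|x]; last 1 first.
- have := perm_mem (map_val_to_set (gtn_sorted_uniq sS) ltS) x.
  by rewrite eqST (perm_mem (map_val_to_set (gtn_sorted_uniq sT) ltT)).
- exact: ltn_trans lt2 lt1.
- by rewrite /= ltnn.
Qed.

Lemma to_set_complex S : node_list S -> to_set S \in complex.
Proof.
move=> [_ ltS [v lt_v allS]]; apply/complexP; exists (Ordinal lt_v).
by apply/fintype.subsetP => i; rewrite inE => /(allP allS); rewrite -(incident_ord i (Ordinal lt_v)).
Qed.

Lemma to_set_surj U : U \in complex -> exists2 S, node_list S & to_set S = U.
Proof.
move=> /complexP[v /fintype.subsetP sub]; exists (rev (map val (enum U))).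
  split.
  - rewrite rev_sorted; apply: (subseq_sorted ltn_trans (s2 := iota 0 q)); last exact: iota_ltn_sorted.
    rewrite -val_enum_ord map_subseq // enumT; exact: filter_subseq.
  - by rewrite all_rev; apply/allP => x /mapP[i _ ->]; exact: ltn_ord.
  - exists (val v); [exact: ltn_ord|rewrite all_rev]; apply/allP => x /mapP[i]; rewrite mem_enum.
    by move=> /sub iv ->; rewrite incident_ord.
by apply/finset.setP => i; rewrite inE mem_rev mem_map ?mem_enum //; exact: val_inj.
Qed.

Lemma trie_size_complex L : 0 < p -> trie q p incident L -> size L <= #|complex|.
Proof.
move=> p_gt0 trL.
have nodeL S : S \in L -> node_list S.
  move=> SL; have [sortS ltS] := trie_sorted trL SL; split=> //.
  by case: S SL {sortS ltS} => [|f S] SL; [exists 0|have [] := trie_node trL SL].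
rewrite -(size_map to_set) cardE; apply: uniq_leq_size.
  rewrite map_inj_in_uniq ?(trie_uniq trL) // => S T /nodeL[sS ltS _] /nodeL[sT ltT _].
  exact: to_set_inj.
by move=> U /mapP[S /nodeL nS ->]; rewrite mem_enum; exact: to_set_complex.
Qed.

Section Listing.
Variable L : seq (seq nat).
Hypothesis uniqL : uniq L.
Hypothesis memL : forall S, S \in L <-> node_list S.

Lemma to_set_injL : {in L &, injective to_set}.
Proof. by move=> S T /memL[sS ltS _] /memL[sT ltT _]; exact: to_set_inj. Qed.

Lemma size_listing : size L = #|complex|.
Proof.
rewrite -(size_map to_set) cardE; apply: perm_size; apply: uniq_perm.
- by rewrite map_inj_in_uniq //; exact: to_set_injL.
- exact: enum_uniq.
move=> U; rewrite mem_enum; apply/mapP/idP => [[S /memL nS ->]|/to_set_surj[S nS <-]].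
  exact: to_set_complex.
by exists S => //; apply/memL.
Qed.

Lemma sum_listing (F : {set 'I_q} -> nat) : \sum_(S <- L) F (to_set S) = \sum_(U in complex) F U.
Proof.
rewrite -(big_map to_set predT F) -big_enum; apply: perm_big; apply: uniq_perm.
- by rewrite map_inj_in_uniq //; exact: to_set_injL.
- exact: enum_uniq.
move=> U; rewrite mem_enum; apply/mapP/idP => [[S /memL nS ->]|/to_set_surj[S nS <-]].
  exact: to_set_complex.
by exists S => //; apply/memL.
Qed.

Definition node_at (i : nat) : option {set 'I_q} :=
  if i < size L then Some (to_set (nth [::] L i)) else None.

Lemma node_at_node i : is_node (node_at i).
Proof.
rewrite /node_at; case: ifP => // lt_i; apply: to_set_complex; apply/memL; exact: mem_nth.
Qed.

Lemma node_at_inj i j : i <= size L -> j <= size L -> node_at i = node_at j -> i = j.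
Proof.
rewrite /node_at => le_i le_j; case: ltnP => [lt_i|ge_i]; case: ltnP => [lt_j|ge_j] //.
  move=> [/to_set_injL eq_ij]; apply/eqP; rewrite -(nth_uniq [::] lt_i lt_j uniqL).
  by apply/eqP; apply: eq_ij; exact: mem_nth.
by move=> _; lia.
Qed.

Lemma node_at_surj x : is_node x -> exists2 i, i <= size L & node_at i = x.
Proof.
case: x => [U|_] /=; last by exists (size L) => //; rewrite /node_at ltnn.
move=> /to_set_surj[S /memL SL <-]; exists (index S L); first exact: index_size.
by rewrite /node_at index_mem SL nth_index.
Qed.

Lemma node_at_index S : S \in L -> node_at (index S L) = Some (to_set S).
Proof. by move=> SL; rewrite /node_at index_mem SL nth_index. Qed.

Lemma delete_subseq j (S : seq nat) : subseq (delete j S) S.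
Proof.
rewrite -[X in subseq _ X](cat_take_drop j S); apply: cat_subseq => //.
by rewrite -addn1 addnC -drop_drop drop_subseq.
Qed.

Lemma size_delete j (S : seq nat) : j < size S -> (size (delete j S)).+1 = size S.
Proof. by move=> lt_j; rewrite size_cat size_take size_drop lt_j; lia. Qed.

Lemma mem_delete (j : nat) (S : seq nat) : uniq S -> j < size S ->
  delete j S =i [predD1 S & nth 0 S j].
Proof.
move=> uS lt_j x; rewrite !inE mem_cat.
have eS : S = take j S ++ nth 0 S j :: drop j.+1 S by rewrite -drop_nth // cat_take_drop.
move: eS; move: (nth 0 S j) (take j S) (drop j.+1 S) => y s1 s2 eS.
move: uS; rewrite eS cat_uniq /= negb_or => /and4P[_ /andP[y1 _] y2 _].
by rewrite mem_cat inE; case: eqP => [->|_] //=; rewrite (negPf y1) (negPf y2).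
Qed.

Lemma node_list_subseq S T : node_list S -> subseq T S -> node_list T.
Proof.
move=> [sS ltS [v lt_v allS]] sub; split.
- by apply: subseq_sorted sub sS => x y z lt1 lt2; exact: ltn_trans lt2 lt1.
- by apply/allP => f /(mem_subseq sub); exact: (allP ltS).
- by exists v => //; apply/allP => f /(mem_subseq sub); exact: (allP allS).
Qed.

Lemma deleteL j S : S \in L -> delete j S \in L.
Proof. by move=> /memL nS; apply/memL; exact: node_list_subseq nS (delete_subseq j S). Qed.

Definition arc_pairs (S : seq nat) : seq (nat * nat) :=
  [seq (index S L, index (delete j S) L) | j <- iota 0 (size S)] ++
  (if size S == d then [:: (size L, index S L)] else [::]).

Lemma index_inj (S T : seq nat) : S \in L -> T \in L -> index S L = index T L -> S = T.
Proof. by move=> SL TL eq_i; rewrite -(nth_index [::] SL) eq_i nth_index. Qed.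

Lemma arc_pairs_uniq S : S \in L -> uniq (arc_pairs S).
Proof.
move=> SL; have [sS ltS _] := (memL S).1 SL; have uS := gtn_sorted_uniq sS.
rewrite cat_uniq map_inj_in_uniq ?iota_uniq /=; last first.
  move=> i j; rewrite !mem_iota /= !add0n => lt_i lt_j [].
  move=> /(index_inj (deleteL i SL) (deleteL j SL)) eq_d; apply/eqP; rewrite -(nth_uniq 0 lt_i lt_j uS).
  have := mem_delete uS lt_i (nth 0 S j); rewrite eq_d mem_delete // !inE eqxx /=.
  by rewrite mem_nth // andbT eq_sym => /esym/negbFE.
case: ifP => _ /=; rewrite ?andbT //= orbF; apply/negP => /mapP[j _ [eq_i _]].
by have := index_mem S L; rewrite -eq_i ltnn SL.
Qed.

Lemma flatten_map_uniq (T1 T2 : eqType) (g : T1 -> seq T2) s : uniq s ->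
    (forall x, x \in s -> uniq (g x)) ->
    (forall x y a, x \in s -> y \in s -> a \in g x -> a \in g y -> x = y) ->
  uniq (flatten (map g s)).
Proof.
elim: s => //= x s IHs /andP[xs us] ug disj; rewrite cat_uniq ug ?mem_head //=.
apply/andP; split; last first.
  apply: IHs => // [y ys|y z a ys zs]; first by apply: ug; rewrite inE ys orbT.
  by apply: disj; rewrite inE ?ys ?zs orbT.
apply/hasPn => a /flatten_mapP[y ys ay]; apply/negP => ax.
by move: xs; rewrite (disj x y a) ?mem_head ?ys // inE ys orbT.
Qed.

Lemma all_arcs_uniq : uniq (flatten (map arc_pairs L)).
Proof.
apply: flatten_map_uniq => // [S SL|S T a SL TL]; first exact: arc_pairs_uniq.
rewrite !mem_cat => /orP[/mapP[i _ ->]|].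
  case/orP => [/mapP[j _ [eq_i _]]|]; first exact: index_inj.
  case: ifP => // _; rewrite inE => /eqP[eq_i _].
  by have := index_mem S L; rewrite eq_i ltnn SL.
case: ifP => // _; rewrite inE => /eqP-> /orP[/mapP[j _ [eq_i _]]|].
  by have := index_mem T L; rewrite -eq_i ltnn TL.
by case: ifP => // _; rewrite inE => /eqP[/index_inj->].
Qed.

Lemma mem_all_arcs i j : i <= size L -> j <= size L ->
  ((i, j) \in flatten (map arc_pairs L)) = covers (node_at i) (node_at j).
Proof.
move=> le_i le_j; apply/flatten_mapP/idP => [[S SL]|].
  have [sS ltS _] := (memL S).1 SL; have uS := gtn_sorted_uniq sS.
  rewrite mem_cat => /orP[/mapP[l]|].
    rewrite mem_iota /= add0n => lt_l [-> ->]; have dL := deleteL l SL.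
    have [sT ltT _] := (memL _).1 dL; have uT := gtn_sorted_uniq sT.
    rewrite !node_at_index // /covers !card_to_set // size_delete // eqxx andbT.
    by apply/fintype.subsetP => x; rewrite !inE; exact: (mem_subseq (delete_subseq l S)).
  case: ifP => // size_S; rewrite inE => /eqP[-> ->].
  by rewrite node_at_index // /node_at ltnn /= card_to_set.
rewrite /covers; case eq_i : (node_at i) => [U|]; case eq_j : (node_at j) => [V|] //.
- move: eq_i eq_j; rewrite {1 2}/node_at; case: ifP => // lt_i [eU]; case: ifP => // lt_j [eV].
  set S := nth [::] L i in eU; set T := nth [::] L j in eV.
  have SL : S \in L by exact: mem_nth.
  have TL : T \in L by exact: mem_nth.
  have [sS ltS _] := (memL S).1 SL; have uS := gtn_sorted_uniq sS.
  have [sT ltT _] := (memL T).1 TL; have uT := gtn_sorted_uniq sT.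
  rewrite -eU -eV !card_to_set // => /andP[/fintype.subsetP sub /eqP size_S].
  have subTS : {subset T <= S}.
    by move=> x xT; have := sub (Ordinal (allP ltT x xT)); rewrite !inE; apply.
  exists S => //; rewrite mem_cat; apply/orP; left.
  have [x xS xT] : exists2 x, x \in S & x \notin T.
    apply/hasP; rewrite -[has _ _]negbK -all_predC; apply/negP => /allP ST.
    have : size S <= size T by apply: uniq_leq_size => // y /ST; rewrite /= negbK.
    by rewrite size_S ltnn.
  have lt_x : index x S < size S by rewrite index_mem.
  apply/mapP; exists (index x S); first by rewrite mem_iota.
  congr (_, _); first by rewrite /S index_uniq.
  (* Decreasing lists with the same members are equal, and the members agree by an inclusion between
     lists of the same size. *)
  suff -> : delete (index x S) S = T by rewrite /T index_uniq.
  have [sD ltD _] := (memL _).1 (deleteL (index x S) SL).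
  apply: (irr_sorted_eq (leT := gtn)) => // [a b c lt1 lt2|a|].
  + exact: ltn_trans lt2 lt1.
  + by rewrite /= ltnn.
  have subTd : {subset T <= delete (index x S) S}.
    move=> y yT; rewrite mem_delete // !inE nth_index // subTS // andbT.
    by apply: contraNneq xT => <-.
  have [|_ eqTd y] := uniq_min_size uT subTd; last by rewrite eqTd.
  by rewrite -ltnS size_delete // size_S.
- move: eq_i eq_j; rewrite {1 2}/node_at; case: ifP => // ge_i _; case: ifP => // lt_j [eV].
  set T := nth [::] L j in eV; have TL : T \in L by exact: mem_nth.
  have [sT ltT _] := (memL T).1 TL; have uT := gtn_sorted_uniq sT.
  rewrite -eV card_to_set // => size_T; exists T => //.
  rewrite mem_cat size_T inE /T index_uniq // orbC; apply/orP; left; apply/eqP; congr (_, _).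
  lia.
Qed.

Lemma node_out_pairs dir S : node_out d dir L S =
  flatten [seq (if dir == 0 then [:: a.1; a.2] else [:: a.2; a.1]) | a <- arc_pairs S].
Proof.
rewrite /node_out /arc_pairs map_cat flatten_cat -map_comp; congr (_ ++ _).
  by rewrite /arcs_out subn0.
by case: ifP => //= _; rewrite /arc_out cats0.
Qed.

Lemma output_arcs dir : exists arcs : seq ('I_(size L).+1 * 'I_(size L).+1),
  [/\ uniq arcs,
      forall i j, (i, j) \in arcs =
        if dir == 0 then covers (node_at i) (node_at j) else covers (node_at j) (node_at i) &
      flatten [seq node_out d dir L U | U <- L] = flatten [seq [:: val a.1; val a.2] | a <- arcs]].
Proof.
pose A := flatten (map arc_pairs L).
pose swap (a : nat * nat) := if dir == 0 then a else (a.2, a.1).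
have swapK : involutive swap by rewrite /swap => -[a b]; case: (dir == 0).
have bound a : a \in A -> a.1 <= size L /\ a.2 <= size L.
  move=> /flatten_mapP[S SL]; rewrite mem_cat => /orP[/mapP[j _ ->]|]; first by split; exact: index_size.
  by case: ifP => // _; rewrite inE => /eqP->; split; rewrite ?index_size.
pose ord2 (a : nat * nat) : 'I_(size L).+1 * 'I_(size L).+1 := (inord a.1, inord a.2).
have swap_bound a : a \in A -> (swap a).1 <= size L /\ (swap a).2 <= size L.
  by move=> /bound[le1 le2]; rewrite /swap; case: ifP.
exists [seq ord2 (swap a) | a <- A]; split.
- rewrite map_inj_in_uniq; first exact: all_arcs_uniq.
  move=> a b /swap_bound[a1 a2] /swap_bound[b1 b2] [/(congr1 val) + /(congr1 val)].
  rewrite /= !inordK // => eq1 eq2; apply: (inv_inj swapK).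
  by move: eq1 eq2; case: (swap a) (swap b) => [? ?] [? ?] /= -> ->.
- move=> i j; have swap_ij : (swap (val i, val j)).1 <= size L /\ (swap (val i, val j)).2 <= size L.
    by rewrite /swap; case: ifP => _ /=; split; rewrite -ltnS ltn_ord.
  transitivity (swap (val i, val j) \in A).
    apply/mapP/idP => [[a aA eq_ij]|aA]; last first.
      by exists (swap (val i, val j)) => //; rewrite swapK /ord2 !inord_val.
    have [le1 le2] := swap_bound a aA; move: eq_ij => [-> ->]; rewrite /= !inordK //.
    by rewrite -surjective_pairing swapK.
  have le_ord (l : 'I_(size L).+1) : l <= size L by rewrite -ltnS ltn_ord.
  rewrite /swap; case: (dir == 0); first exact: (mem_all_arcs (le_ord i) (le_ord j)).
  exact: (mem_all_arcs (le_ord j) (le_ord i)).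
- transitivity (flatten [seq [:: (swap a).1; (swap a).2] | a <- A]); last first.
    rewrite -map_comp; congr flatten; apply/eq_in_map => a /swap_bound[le1 le2] /=.
    by rewrite !inordK.
  rewrite /A; elim: {2 3}L => //= S s IHs; rewrite map_cat flatten_cat -IHs node_out_pairs.
  by congr (flatten _ ++ _); apply: eq_map => a; rewrite /swap; case: (dir == 0).
Qed.

End Listing.

Section Counting.
Hypothesis pure : pure_complex.

Lemma complex_gt0 : 0 < #|complex|.
Proof.
have p_gt0 : 0 < p := leq_trans (items_gt0 pure) (items_le_blocks pure).
apply/card_gt0P; exists finset.set0; apply/complexP; exists (Ordinal p_gt0); exact: finset.sub0set.
Qed.

Lemma blocks_le_complex : p <= #|complex|.
Proof.
rewrite -[p]card_ord -(card_imset _ (blocks_inj pure)); apply: subset_leq_card.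
by apply/fintype.subsetP => _ /imsetP[v _ ->]; apply/complexP; exists v.
Qed.

Lemma complex_le : #|complex| <= 2 ^ q.
Proof.
rewrite -[q in 2 ^ q]card_ord -cardsT -card_powerset; apply: subset_leq_card.
by apply/fintype.subsetP => U _; rewrite powersetE finset.subsetT.
Qed.

Lemma dim_le : d <= q.
Proof.
have p_gt0 : 0 < p := leq_trans (items_gt0 pure) (items_le_blocks pure).
by rewrite -(card_block pure (Ordinal p_gt0)) -[X in _ <= X]card_ord max_card.
Qed.

(* Count the pairs (f, U) with f \in U: every item f lies in a block, half of
   whose subsets contain f. *)
Lemma items_pow_le : 0 < d -> q * 2 ^ d <= 2 * d * #|complex|.
Proof.
move=> d_gt0; have [e dE] : exists e, d = e.+1 by exists d.-1; rewrite prednK.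
suff le_e : q * 2 ^ e <= d * #|complex| by rewrite dE expnS; lia.
have item_le (f : 'I_q) : 2 ^ e <= \sum_(U in complex) (f \in U).
  have [v fv] := item_covered pure d_gt0 f.
  have card_f : #|blocks v :\ f| = e.
    by have := cardsD1 f (blocks v); rewrite fv card_block // dE => -[].
  rewrite -card_f -card_powerset -big_mkcondr /= sum1_card.
  have inj : {in powerset (blocks v :\ f) &, injective (fun U => f |: U)}.
    move=> U V; rewrite !powersetE => /fintype.subsetP Uv /fintype.subsetP Vv eqUV.
    have notin (X : {set 'I_q}) : {subset X <= blocks v :\ f} -> f \notin X.
      by move=> sub; apply/negP => /sub; rewrite !inE eqxx.
    by rewrite -(finset.setU1K (notin U Uv)) eqUV finset.setU1K // notin.
  rewrite -(card_in_imset inj); apply: subset_leq_card; apply/fintype.subsetP => X /imsetP[U].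
  rewrite powersetE => /fintype.subsetP sub ->.
  rewrite unfold_in finset.setU11 andbT; apply/complexP; exists v.
  by apply/fintype.subsetP => g; rewrite !inE => /predU1P[->|/sub]; rewrite ?inE // => /andP[].
apply: leq_trans (_ : \sum_(f < q) \sum_(U in complex) (f \in U) <= _).
  by rewrite -[X in X * _]card_ord -sum_nat_const; apply: leq_sum => f _.
rewrite exchange_big /= mulnC -sum_nat_const; apply: leq_sum => U /complexP[v sub].
rewrite -(card_block pure v); apply: leq_trans (subset_leq_card sub).
by rewrite -sum1_card [leqRHS]big_mkcond; apply: leq_sum => f _; case: (f \in U).
Qed.

(** Double counting: each of the [p] blocks has 2^d subsets, and all of them belong to the
    complex. *)
Lemma sum_incident L : (forall S, S \in L <-> node_list S) -> uniq L ->
  \sum_(S <- L) \sum_(0 <= v < p) (all (incident^~ v) S) = p * 2 ^ d.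
Proof.
move=> memL uniqL.
transitivity (\sum_(S <- L) \sum_(v < p) (to_set S \subset blocks v)).
  rewrite !big_seq; apply: eq_bigr => S /memL[_ ltS _]; rewrite big_mkord.
  apply: eq_bigr => v _; congr (nat_of_bool _); apply/allP/fintype.subsetP => [allS i|sub f fS].
    by rewrite inE => /allS; rewrite incident_ord.
  have := sub (Ordinal (allP ltS f fS)); rewrite inE => /(_ fS).
  by rewrite -incident_ord.
rewrite (sum_listing uniqL memL (fun U => \sum_(v < p) (U \subset blocks v))) exchange_big /=.
rewrite -[X in X * _]card_ord -sum_nat_const; apply: eq_bigr => v _.
rewrite -big_mkcondr sum1_card -(card_block pure v) -card_powerset; apply: eq_card => U.
rewrite unfold_in powersetE; apply/andP/idP => [[]//|sub]; split=> //.
by apply/complexP; exists v.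
Qed.

Lemma node_size_le_dim S : node_list S -> size S <= d.
Proof.
move=> nS; have [sS ltS _] := nS; rewrite -(card_to_set (gtn_sorted_uniq sS) ltS).
have /complexP[v sub] := to_set_complex nS.
by rewrite -(card_block pure v); exact: subset_leq_card.
Qed.

(** The target is of order p d^2 D. Extensions are absorbed by [items_pow_le]. The arcs of one node
    cost of order d^3, which is at most p d^2 because d <= q <= p. The summands 7 q and 60 pay for
    [size_loop] and for the instructions outside the loops. *)
Lemma total_cost_le L : (forall S, S \in L <-> node_list S) -> uniq L ->
  total_cost q p incident L + 7 * q + 60 <= 400 * maxn 1 (d * (p * d) * #|complex|.+1).
Proof.
move=> memL uniqL; have size_L := size_listing uniqL memL.
have le_qp := items_le_blocks pure; have p_gt0 := leq_trans (items_gt0 pure) le_qp.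
set D := #|complex| in size_L *; have le_dq := dim_le.
have cost : total_cost q p incident L <= D * (p * (30 + 12 * d) + 10) + 30 * q * (p * 2 ^ d)
    + D * (d * (d * (5 * d + 15) + 20) + 20).
  rewrite /total_cost big_split /= leq_add //; last first.
    rewrite -size_L mulnC -[size L]sum1_size big_distrr /= !big_seq; apply: leq_sum => S /memL nS.
    have le_d := node_size_le_dim nS; rewrite muln1 /output_cost leq_add2r.
    by rewrite leq_mul // leq_add2r leq_mul // leq_add2r leq_mul2l le_d orbT.
  rewrite -(sum_incident memL uniqL) -size_L mulnC -[size L]sum1_size !big_distrr /= -big_split /=.
  rewrite !big_seq; apply: leq_sum => S /memL nS; have le_d := node_size_le_dim nS.
  rewrite muln1 /node_cost big_split /= sum_nat_const_nat subn0 addnAC.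
  rewrite -big_distrl /= (mulnC _ (30 * q)) !leq_add2r leq_mul2l leq_add2l leq_mul2l le_d.
  by rewrite !orbT.
have [d0|d_gt0] := posnP d.
  have p1 := blocks_dim0 pure d0; move: cost; rewrite d0 p1 expn0.
  have q1 : q = 1 by have := items_gt0 pure; lia.
  have := complex_le; rewrite -/D q1.
  have : D <= 1.
    rewrite /D -(cards1 (finset.set0 : {set 'I_q})); apply: subset_leq_card.
    apply/fintype.subsetP => U /complexP[v].
    by rewrite (cards0_eq (etrans (card_block pure v) d0)) finset.subset0 inE.
  lia.
have := items_pow_le d_gt0; rewrite -/D => le_pow.
have D_gt0 : 0 < D := complex_gt0.
pose a := d * (p * d) * D.
have f1 : p * d * D <= a by rewrite /a -(mulnA d (p * d) D) leq_pmull.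
have f2 : p * D <= p * d * D by rewrite leq_mul2r leq_pmulr ?orbT.
have f3 : D <= p * D by rewrite leq_pmull.
have le_dp := leq_trans le_dq le_qp.
have f4 : d * d * d * D <= a by rewrite /a !mulnA leq_mul2r !leq_mul2r leq_mul2l le_dp !orbT.
have f5 : d * d * D <= p * d * D by rewrite !leq_mul2r le_dp !orbT.
have f6 : d * D <= p * D by rewrite leq_mul2r le_dp orbT.
have f7 : p <= p * D by rewrite leq_pmulr.
have f8 : 30 * q * (p * 2 ^ d) <= 60 * (p * d * D).
  by have : p * (q * 2 ^ d) <= p * (2 * d * D) by [rewrite leq_mul2l le_pow orbT]; lia.
have : 400 * a <= 400 * maxn 1 (d * (p * d) * D.+1).
  by rewrite leq_mul2l /= (leq_trans _ (leq_maxr _ _)) // /a leq_mul2l leqnSn orbT.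
by lia.
Qed.

End Counting.

End Complex.

(** * The algorithm on a matrix in memory *)

Definition algorithm : prog := orient ;; main.

Section Algorithm.
Variables (q p sf sv dir m n d : nat) (blocks : 'I_p -> {set 'I_q}) (mem : seq nat).
Hypothesis pure : pure_complex blocks d.
Hypothesis layout : (q, p, sf, sv, dir) = if n < m then (n, m, 1, n, 1) else (m, n, n, 1, 0).
Hypotheses (mem0 : nth 0 mem 0 = m) (mem1 : nth 0 mem 1 = n) (size_mem : size mem = 2 + q * p).
Hypothesis mem_bits : all (leq^~ 1) (drop 2 mem).
Hypothesis mem_matrix : forall i j, i < q -> j < p ->
  nth 0 mem (2 + i * sf + j * sv) = incident blocks i j.
Notation D := #|complex blocks|.

Let K := 2 + q * p + D * (q + 4).
Let B := K + (q + 4) + q * sf + p * sv + sf + sv + q + p + D + 10.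

Lemma layout_lt f v : f < q -> v < p -> 2 + f * sf + v * sv < 2 + q * p.
Proof.
move=> lt_f lt_v; case: ifP layout => _ [qE pE -> -> _].
  rewrite -qE muln1.
  have : v.+1 * q <= p * q by rewrite leq_mul2r lt_v orbT.
  by rewrite mulSn; lia.
rewrite -pE muln1.
have : f.+1 * p <= q * p by rewrite leq_mul2r lt_f orbT.
by rewrite mulSn; lia.
Qed.

(** Distinct blocks are distinct sets of the complex, and these are subsets of the items, so p <= D
    <= 2^q. Hence every summand of [B] is at most a small multiple of 2^(2 q), and the constant
    factor 16 is absorbed since q >= 1. *)
Lemma log_bound : trunc_log 2 B <= 6 * q.
Proof.
have q_gt0 := items_gt0 pure; have le_pD := blocks_le_complex pure; have le_D := complex_le blocks.
pose X := 2 ^ q; have le_q : q <= X by rewrite ltnW // ltn_expl.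
have X_ge2 : 2 <= X by rewrite -[2]expn1 leq_pexp2l.
have le_B : B <= 2 ^ (6 * q).
  apply: leq_trans (_ : 2 ^ (2 * q + 4) <= _); last by rewrite leq_pexp2l //; lia.
  rewrite expnD mulnC [2 * q]mulnC expnM -/X.
  have le_qp : q * p <= X * X by rewrite leq_mul // (leq_trans le_pD).
  have le_Dq : D * q <= X * X by rewrite leq_mul.
  have le_p : p <= X := leq_trans le_pD le_D.
  have le_X : 2 * X <= X * X by rewrite leq_mul2r X_ge2 orbT.
  have steps : q * sf + p * sv + sf + sv <= q * p + q + p + q + p + 1.
    by case: ifP layout => _ [-> -> -> -> _]; lia.
  have le_D' : D <= X := le_D.
  rewrite /B /K (_ : 2 ^ 4 = 16) // expnS expn1; lia.
by rewrite -(@trunc_expnK 2 (6 * q)) // leq_trunc_log.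
Qed.

Lemma wp_orient (Q : state -> nat -> nat -> Prop) :
  (forall y t, t <= 20 ->
     Q (State [:: 0; 1; 2; 3; 4; q; p; sf; sv; 0; 0; 0; dir; 0; 0; 0; 0; 0; 0; 0; 0; 0; 0; y] mem [::])
       t 0) ->
  wp 24 B K orient (State [::] mem [::]) 0 0 Q.
Proof.
(* The first instruction writes the last register, which turns the empty register list into a
   literal list of 24 cells. *)
have le_B : q + p + 10 <= B by rewrite /B; lia.
move=> HQ; do 2 wp_step; rewrite /=; do 12 wp_step; rewrite mem0 mem1.
apply: wp_if; wp_simpl; move: layout.
case: ifP => _ [qE pE sfE svE dirE]; rewrite -qE -pE.
  do 11 wp_step; rewrite !addn0.
  by have := HQ p 14 isT; rewrite sfE svE dirE -qE.
do 5 wp_step; rewrite !addn0.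
by have := HQ 0 11 isT; rewrite sfE svE dirE -pE.
Qed.

Lemma dimension_sum : d = \sum_(0 <= f < q) incident blocks f 0.
Proof.
have p_gt0 : 0 < p := leq_trans (items_gt0 pure) (items_le_blocks pure).
rewrite -(card_block pure (Ordinal p_gt0)) big_mkord -sum1_card big_mkcond.
by apply: eq_bigr => f _; rewrite -(incident_ord blocks f (Ordinal p_gt0)); case: incident.
Qed.

(** For space, the matrix takes q p <= q D cells and the nodes D (q + 4). Numbers above 1 occur
    initially only as m and n, and the run performs one write for the root and five per further node
    at most, each of at most 6 q extra bits. *)
Lemma algorithm_correct : exists time peak final, exec algorithm (State [::] mem [::]) time peak final /\
  exists L : seq (seq nat),
  [/\ uniq L, forall S : seq nat, S \in L <-> node_list blocks S,
      output final = (size L).+1 :: flatten [seq node_out d dir L U | U <- L],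
      time <= 400 * maxn 1 (d * (p * d) * D.+1) &
      peak <= 300 * (D.+1 * q)].
Proof.
have q_gt0 := items_gt0 pure; have le_qp := items_le_blocks pure.
have p_gt0 := leq_trans q_gt0 le_qp; have D_gt0 := complex_gt0 pure.
have [dt [dz [s' [[peak ex fit] [L [uniqL memL outL [time_le z_le]]]]]]] : wp 24 B K algorithm
    (State [::] mem [::]) 0 0 (fun s' t z => exists L : seq (seq nat),
      [/\ uniq L, forall S : seq nat, S \in L <-> node_list blocks S,
          output s' = (size L).+1 :: flatten [seq node_out d dir L U | U <- L] &
          t <= 400 * maxn 1 (d * (p * d) * D.+1) /\ z <= 1 + 5 * size L]).
  apply: wp_seq; apply: wp_orient => y t le_t.
  apply: (wp_main erefl erefl erefl dimension_sum (leqnn B) layout_lt _ p_gt0 D_gt0 _ mem_matrix).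
  - by move=> L; exact: trie_size_complex.
  - by rewrite size_mem.
  move=> L s' t' z' trL memL outL le_t' le_z'; exists L; split=> //; first exact: trie_uniq trL.
  have := total_cost_le pure memL (trie_uniq trL); split; lia.
exists dt, peak, s'; split=> //; exists L; split=> //.
have memE : mem = [:: m, n & drop 2 mem].
  by move: mem0 mem1 size_mem; case: (mem) => [|x [|y s]] //= -> ->; rewrite drop0.
have log_le := log_bound.
have le_mB : m <= B.
  by move: layout; case: ifP => _ [eq1 eq2 _ _ _]; rewrite /B; lia.
have le_nB : n <= B.
  by move: layout; case: ifP => _ [eq1 eq2 _ _ _]; rewrite /B; lia.
have weight_mem : weight mem <= 12 * q.
  rewrite memE /weight !big_cons big1_seq ?addn0 => [|a /andP[_ /(allP mem_bits)]].
    by have := leq_trunc_log 2 le_mB; have := leq_trunc_log 2 le_nB; lia.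
  by case: a => [|[|a]].
have /fit[_ _] : fits 24 B K (State [::] mem [::]).
  split=> //=; last by rewrite size_mem leq_addr.
  rewrite memE /= le_mB le_nB; apply: sub_all mem_bits => a; rewrite /B; lia.
rewrite /peak_bound /= => le_peak.
have size_L := size_listing uniqL memL; rewrite size_L add0n in z_le.
have le_z : dz * trunc_log 2 B <= (1 + 5 * D) * (6 * q) by exact: leq_mul.
have le_log : 24 * (trunc_log 2 B).+1 <= 24 * (6 * q).+1 by rewrite leq_mul2l ltnS log_le.
have le_qpD : q * p <= q * D by rewrite leq_mul2l (blocks_le_complex pure) orbT.
have le_qD : q <= D * q by rewrite leq_pmull.
have le_D : D <= D * q by rewrite leq_pmulr.
move: le_peak le_z le_log le_qpD le_qD le_D weight_mem; rewrite /K.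
move: #|complex blocks| (weight mem) (trunc_log 2 B) (dz * trunc_log 2 B) => D w y x.
by clear -q_gt0; lia.
Qed.

End Algorithm.

Import Order.TTheory GRing.Theory Num.Theory.
Import numFieldNormedType.Exports.

Local Open Scope classical_set_scope.
Local Open Scope ring_scope.

(** * Faces of a polyhedron given by inequalities *)

Section AffineDimension.
Variables (R : realType) (k : nat).
Implicit Types (S : set 'rV[R]_k).

Lemma affdim_le S n :
  (forall p (X : 'M[R]_(p, k)), affinely_independent X ->
     (forall i, S (row i X)) -> (p <= n)%N) ->
  affdim S <= n%:Z - 1.
Proof.
move=> H; rewrite /affdim lerD2r lez_nat; apply/bigmax_leqP => p /asboolP.
by case=> X [/H].
Qed.

Lemma affdim_ge S p (X : 'M[R]_(p, k)) :
  affinely_independent X -> (forall i, S (row i X)) -> p%:Z - 1 <= affdim S.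
Proof.
move=> indX SX; rewrite /affdim lerD2r lez_nat.
have lt_p : (p < k.+2)%N.
  have := rank_leq_col (row_mx X (const_mx 1 : 'cV[R]_p)).
  by rewrite (eqP indX) addn1.
have P_p : `[< exists X : 'M[R]_(Ordinal lt_p, k),
      affinely_independent X /\ forall i, S (row i X) >] by apply/asboolP; exists X.
exact: (@leq_bigmax_cond _ _ (@nat_of_ord _) (Ordinal lt_p) P_p).
Qed.

Lemma affdim_witness S : exists (p : nat) (X : 'M[R]_(p, k)),
  [/\ affdim S = p%:Z - 1, affinely_independent X & forall i, S (row i X)].
Proof.
have P0 : `[< exists X : 'M[R]_(0, k),
      affinely_independent X /\ forall i, S (row i X) >].
  by apply/asboolP; exists 0; split; [rewrite /affinely_independent flatmx0 /row_free mxrank0|case].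
pose Q (p : 'I_k.+2) := `[< exists X : 'M[R]_(p, k),
      affinely_independent X /\ forall i, S (row i X) >].
have [p Qp maxp] := @arg_maxnP 'I_k.+2 ord0 Q val P0.
have /asboolP[X [indX SX]] := Qp.
exists p, X; split=> //; rewrite /affdim; congr (_%:Z - 1).
apply/eqP; rewrite eqn_leq; apply/andP; split; first exact/bigmax_leqP.
exact: leq_bigmax_cond.
Qed.

Lemma affdim_set0 : affdim (set0 : set 'rV[R]_k) = -1.
Proof.
have [[|p] [X [-> _ X0]]] := affdim_witness set0; first by [].
by case: (X0 0).
Qed.

Lemma affdim_sub S S' : S `<=` S' -> affdim S <= affdim S'.
Proof.
move=> sSS'; have [p [X [-> indX SX]]] := affdim_witness S.
by apply: (affdim_ge indX) => i; apply: sSS'.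
Qed.

Lemma affdim_eq S r (B : 'M[R]_(r, k)) z eps :
    S z -> row_free B -> eps != 0 ->
    (forall x, S x -> (x - z <= B)%MS) ->
    (forall i, S (z + eps *: row i B)) ->
  affdim S = r%:Z.
Proof.
move=> Sz freeB eps0 subB Seps; apply/eqP; rewrite eq_le; apply/andP; split.
- rewrite -[r%:Z](addrK 1) -PoszD; apply: affdim_le => p X /eqP indX SX.
  rewrite -[X in (X <= _)%N]indX.
  pose Y := col_mx (row_mx z 1) (row_mx B 0) : 'M[R]_(1 + r, k + 1).
  rewrite [(r + 1)%N]addnC; apply: leq_trans (rank_leq_row Y); apply: mxrankS.
  apply/row_subP => i; have /submxP[D eD] := subB _ (SX i).
  apply/submxP; exists (row_mx 1 D).
  rewrite mul_row_col !mul_mx_row mulmx0 !mul1mx add_row_mx -eD addr0 addrC subrK.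
  rewrite row_row_mx row_const; congr row_mx.
  by apply/matrixP => a b; rewrite !ord1 !mxE.
- have -> : r%:Z = (1 + r)%N%:Z - 1 by rewrite PoszD addrAC subrr add0r.
  pose X := col_mx z (\matrix_i (z + eps *: row i B)) : 'M[R]_(1 + r, k).
  apply: (@affdim_ge _ _ X).
    apply: inj_row_free => v; rewrite -[v]hsubmxK.
    set a := lsubmx v; set D := rsubmx v.
    rewrite /X; have -> : \matrix_i (z + eps *: row i B) = const_mx 1 *m z + eps *: B.
      apply/row_matrixP => i; rewrite rowK linearD /= linearZ /= row_mul row_const.
      by congr (_ + _); apply/rowP => j; rewrite mxE big_ord1 !mxE mul1r.
    rewrite mul_mx_row -[const_mx 1 : 'cV_(1 + r)]vsubmxK !mul_row_col.
    rewrite -[0 in RHS]hsubmxK => /eq_row_mx[].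
    rewrite !linear0 mulmxDr -scalemxAr addrA mulmxA -mulmxDl.
    have -> : usubmx (const_mx 1 : 'cV[R]_(1 + r)) = const_mx 1.
      by apply/matrixP => i j; rewrite !mxE.
    have -> : dsubmx (const_mx 1 : 'cV[R]_(1 + r)) = const_mx 1.
      by apply/matrixP => i j; rewrite !mxE.
    have -> : a *m const_mx 1 = a.
      by apply/matrixP => i j; rewrite !ord1 mxE big_ord1 !mxE mulr1.
    move=> eq1 eq2; rewrite eq2 mul0mx add0r in eq1.
    have D0 : D = 0.
      apply: (row_free_inj freeB); rewrite mul0mx; apply/eqP.
      by have /eqP := eq1; rewrite scalemx_eq0 (negPf eps0).
    by move: eq2; rewrite D0 mul0mx addr0 => ->; rewrite row_mx0.
  move=> i; case: (split_ordP i) => j ->.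
    by rewrite rowKu row_id.
  by rewrite rowKd rowK.
Qed.

Lemma affdim_set1 (z : 'rV[R]_k) : affdim [set z] = 0.
Proof.
apply: (@affdim_eq _ 0 0 z 1) => //.
- by rewrite /row_free mxrank0.
- exact: oner_neq0.
- by move=> x ->; rewrite subrr sub0mx.
- by case.
Qed.

Lemma affdim_ge0 S z : S z -> 0 <= affdim S.
Proof. by move=> Sz; rewrite -(affdim_set1 z); apply: affdim_sub => x ->. Qed.

End AffineDimension.

Section Presentation.
Variables (R : realType) (k e q : nat).
Variables (E : 'M[R]_(k, e)) (c : 'rV[R]_e) (N : 'M[R]_(k, q)) (b : 'rV[R]_q).

(** Equations are kept apart from inequalities, so that a polytope of dimension below [k] can also
    be described with one inequality per facet. *)
Definition sol : set 'rV[R]_k :=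
  [set x | x *m E = c /\ forall j, (x *m N) 0 j <= b 0 j].
Definition active (x : 'rV[R]_k) : {set 'I_q} :=
  finset (fun j => (x *m N) 0 j == b 0 j).
Definition tight (S : {set 'I_q}) : set 'rV[R]_k :=
  [set x | sol x /\ S \subset active x].
(** Columns outside [S] are zeroed rather than removed, so that the matrices for different [S] have
    one size. The left kernel is the direction space of a face whose active set is [S]. *)
Definition tight_mx (S : {set 'I_q}) : 'M[R]_(k, e + q) :=
  row_mx E (\matrix_(i, j) (N i j *+ (j \in S))).

Lemma activeP x j : reflect ((x *m N) 0 j = b 0 j) (j \in active x).
Proof. by rewrite inE; apply: eqP. Qed.

Lemma sub_ker_tight S (u : 'rV[R]_k) :
  (u <= kermx (tight_mx S))%MS <->
  u *m E = 0 /\ forall j, j \in S -> (u *m N) 0 j = 0.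
Proof.
have entry j : (u *m \matrix_(i, j) (N i j *+ (j \in S))) 0 j = (u *m N) 0 j *+ (j \in S).
  rewrite !mxE -sumrMnl; apply: eq_bigr => i _; rewrite !mxE mulrnAr //.
split=> [/sub_kermxP|[uE uN]].
  rewrite mul_mx_row -[0]hsubmxK => /eq_row_mx[-> uN]; split; first exact: linear0.
  move=> j Sj; have := entry j; rewrite uN Sj mulr1n => <-.
  by rewrite linear0 mxE.
apply/sub_kermxP; rewrite mul_mx_row uE -[0 in RHS]hsubmxK; congr row_mx; first by rewrite linear0.
apply/rowP => j; rewrite entry linear0 [RHS]mxE.
case: (boolP (j \in S)) => [/uN ->|_]; rewrite ?mul0rn ?mulr0n //.

Qed.

Lemma tight_active x : sol x -> tight (active x) x. Proof. by []. Qed.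

Lemma exists_common_eps (Q : 'I_q -> R -> Prop) :
  (forall j, exists2 eps, 0 < eps & forall t, 0 < t <= eps -> Q j t) ->
  exists2 eps, 0 < eps & forall t, 0 < t <= eps -> forall j, Q j t.
Proof.
move=> /(_ _)/cid2-/all_sig2[] eps /= eps0 epsQ.
exists (\big[Num.min/1]_j eps j).
  by elim/big_ind: _ => // x y x0 y0; rewrite lt_min x0.
move=> t /andP[t0 tle] j; apply: epsQ; rewrite t0 (le_trans tle) //.
by rewrite (bigD1 j) //= ge_min lexx.
Qed.

(** Slack inequalities survive every sufficiently small step, so the sign of [u *m N] at the active
    ones decides. *)
Lemma push z u : sol z -> u *m E = 0 ->
    (forall j, j \in active z -> (u *m N) 0 j <= 0) ->
  exists2 eps, 0 < eps & forall t, 0 < t <= eps ->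
    sol (z + t *: u) /\
    active (z + t *: u) = finset (fun j => (j \in active z) && ((u *m N) 0 j == 0)).
Proof.
move=> [zE zN] uE uN.
have moved t j : ((z + t *: u) *m N) 0 j = (z *m N) 0 j + t * (u *m N) 0 j.
  by rewrite mulmxDl -scalemxAl !mxE.
have [j|eps eps0 epsP] := @exists_common_eps (fun j t =>
    ((z + t *: u) *m N) 0 j <= b 0 j /\
    (j \in active (z + t *: u)) = (j \in active z) && ((u *m N) 0 j == 0)).
  have [/activeP act|] := boolP (j \in active z).
    exists 1 => // t /andP[t0 _]; rewrite inE !moved act -[X in _ + _ == X]addr0.
    rewrite (inj_eq (addrI _)) mulf_eq0 gt_eqF //=; split=> //.
    by rewrite gerDl pmulr_rle0 // uN //; apply/activeP.
  rewrite inE -/(_ < _) => nact.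
  have slack : 0 < b 0 j - (z *m N) 0 j by rewrite subr_gt0 lt_neqAle nact zN.
  set s := b 0 j - _ in slack; set v := (u *m N) 0 j.
  have v1 : 0 < `|v| + 1 by rewrite ltr_wpDl.
  (* The summand 1 keeps the denominator positive when [v] is 0. *)
  exists (s / (`|v| + 1)); first exact: divr_gt0.
  move=> t /andP[t0]; rewrite ler_pdivlMr // => tle.
  have lt : t * v < s.
    apply: (@le_lt_trans _ _ (t * `|v|)); first by rewrite ler_pM2l // ler_norm.
    by apply: lt_le_trans tle; rewrite mulrDr mulr1 ltrDl.
  have ltb : ((z + t *: u) *m N) 0 j < b 0 j by rewrite moved -ltrBrDl.
  by rewrite inE (ltW ltb) (lt_eqF ltb).
exists eps => // t /epsP tP; split; last by apply/setP=> j; rewrite (tP j).2 inE.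
split=> [|j]; last by case: (tP j).
by rewrite mulmxDl -scalemxAl uE scaler0 addr0.
Qed.

(** From [z] every kernel direction can be followed a little within the face, and differences of
    points of the face lie in the kernel. *)
Lemma affdim_tight z : sol z ->
  affdim (tight (active z)) = (\rank (kermx (tight_mx (active z))))%:Z.
Proof.
move=> solz; set K := kermx _.
have push_ker u : (u <= K)%MS ->
    exists2 eps, 0 < eps & forall t, 0 < t <= eps -> tight (active z) (z + t *: u).
  move=> /sub_ker_tight[uE uN].
  have [j jz|eps eps0 epsP] := @push z u solz uE; first by rewrite uN.
  exists eps => // t /epsP[solt actt]; split=> //; rewrite actt.
  by apply/fintype.subsetP => j jz; rewrite inE jz uN ?eqxx.
have /cid2[] : exists2 eps, 0 < eps & forall i, tight (active z) (z + eps *: row i (row_base K)).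
  have /(_ _)/cid2-/all_sig2[f f0 fP] : forall i, exists2 eps, 0 < eps &
      forall t, 0 < t <= eps -> tight (active z) (z + t *: row i (row_base K)).
    by move=> i; apply: push_ker; rewrite (submx_trans (row_sub _ _)) ?eq_row_base.
  exists (\big[Num.min/1]_j f j).
    by elim/big_ind: _ => // x y x0 y0; rewrite lt_min x0.
  move=> i; apply: fP; apply/andP; split; last by rewrite (bigD1 i) //= ge_min lexx.
  by elim/big_ind: _ => // x y x0 y0; rewrite lt_min x0.
move=> d d0 dP.
apply: (affdim_eq (tight_active solz) (row_base_free K) (lt0r_neq0 d0) _ dP).
move=> x [[xE xN] /fintype.subsetP sub]; rewrite eq_row_base; apply/sub_ker_tight.
rewrite !mulmxBl xE solz.1 subrr; split=> // j jz.
have /activeP xj := sub j jz; have /activeP zj := jz.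
by rewrite !mxE in xj zj *; rewrite xj zj subrr.
Qed.

End Presentation.

Lemma bounded_set_norm_le (R : realType) (k : nat) (P : set 'rV[R]_k) :
  bounded_set P -> exists2 B : R, 0 < B & forall x, P x -> `|x| <= B.
Proof.
have [->|/set0P[x Px]] := eqVneq P set0; first by exists 1.
move=> /ex_bound -/(_ (globally_properfilter Px))[B PB].
exists (`|B| + 1) => [|y /PB /= yB]; first by rewrite ltr_wpDl.
by rewrite (le_trans yB) // (le_trans (ler_norm B)) // lerDl.
Qed.

Section Faces.
Variables (R : realType) (k e q : nat).
Variables (E : 'M[R]_(k, e)) (c : 'rV[R]_e) (N : 'M[R]_(k, q)) (b : 'rV[R]_q).
Notation P := (sol E c N b).
Notation active := (active N b).
Notation tight := (tight E c N b).
Notation kernel S := (kermx (tight_mx E N S)).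

Implicit Types (S T : {set 'I_q}) (x y z u v : 'rV[R]_k) (G : set 'rV[R]_k).

(** The supporting functional is the sum of the inequalities in [S]; it reaches its bound exactly
    where all of them are tight. *)
Lemma faces_tight S : faces P (tight S).
Proof.
pose a := \sum_(j in S) col j N; pose delta := \sum_(j in S) b 0 j.
have xa x : (x *m a) 0 0 = \sum_(j in S) (x *m N) 0 j.
  rewrite mulmx_sumr summxE; apply: eq_bigr => j _.
  by rewrite !mxE; apply: eq_bigr => i _; rewrite mxE.
exists a, delta; split=> [x [_ xN]|]; first by rewrite xa; apply: ler_sum.
apply/seteqP; split=> x /= [Px].
  move=> /fintype.subsetP sub; split=> //; rewrite xa; apply: eq_bigr => j /sub.
  by move/activeP.
rewrite xa => eq_sum; split=> //; apply/fintype.subsetP => j jS; apply/activeP/eqP.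
have := eq_sum; move/eqP; rewrite -subr_eq0 -sumrB -oppr_eq0 -sumrN psumr_eq0.
  by move=> /allP/(_ j (mem_index_enum j)); rewrite jS opprB subr_eq0 eq_sym.
by move=> i _; rewrite opprB subr_ge0; case: Px.
Qed.

Lemma active_mid x y : P x -> P y ->
  P (2^-1 *: (x + y)) /\ active (2^-1 *: (x + y)) = active x :&: active y.
Proof.
move=> [xE xN] [yE yN].
have mid j : ((2^-1 *: (x + y)) *m N) 0 j = 2^-1 * ((x *m N) 0 j + (y *m N) 0 j).
  by rewrite -scalemxAl mulmxDl !mxE.
split; first split.
- by rewrite -scalemxAl mulmxDl xE yE -mulr2n -[c *+ 2]scaler_nat scalerA mulVf ?scale1r // pnatr_eq0.
- by move=> j; rewrite mid; have := xN j; have := yN j; lra.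
- apply/setP=> j; rewrite !inE mid; have := xN j; have := yN j.
  move: (_ 0 j) (_ 0 j) (b 0 j) => s t r sr tr.
  apply/eqP/andP => [?|[/eqP-> /eqP->]]; last by lra.
  by split; apply/eqP; lra.
Qed.

(** Take a point [z] of [G] with the fewest active inequalities: by midpoints, they are active on
    all of [G]. Conversely, if they are active at [x], a small step from [z] away from [x] stays in
    [P], and the supporting functional would exceed its bound unless [x] lies in [G]. *)
Lemma face_relint G : faces P G -> G !=set0 ->
  exists2 z, P z & G = tight (active z).
Proof.
move=> [a [delta [Pa eG]]] [x0 Gx0].
pose Q n := `[< exists2 z, G z & #|active z| = n >].
have exQ : exists n, Q n by exists #|active x0|; apply/asboolP; exists x0.
have [n /asboolP[z Gz zn] minn] := ex_minnP exQ.
have GP x : G x -> P x by rewrite eG => -[].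
have Ga x : G x -> (x *m a) 0 0 = delta by rewrite eG => -[].
have zact x : G x -> active z \subset active x.
  move=> Gx; have [Pm am] := active_mid (GP _ Gz) (GP _ Gx).
  apply/finset.setIidPl/eqP; rewrite eqEcard finset.subsetIl zn -am; apply: minn.
  apply/asboolP; exists (2^-1 *: (z + x)) => //; rewrite eG; split=> //=.
  rewrite -scalemxAl mulmxDl; have := Ga _ Gz; have := Ga _ Gx; rewrite !mxE.
  by move=> -> ->; lra.
exists z; first exact: GP.
apply/seteqP; split=> x; first by move=> Gx; split; [exact: GP|exact: zact].
move=> [Px xact]; rewrite eG; split=> //=; apply/eqP; rewrite eq_le Pa //=.
have [||eps eps0 /(_ eps)] := @push R k e q E c N b z (z - x) (GP _ Gz).
- by rewrite mulmxBl (GP _ Gz).1 Px.1 subrr.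
- move=> j jz; have /activeP xj := fintype.subsetP xact j jz; have /activeP zj := jz.
  by rewrite mulmxBl !mxE in xj zj *; rewrite xj zj subrr.
rewrite eps0 lexx => /(_ isT) [/Pa + _].
rewrite mulmxDl -scalemxAl mulmxBl; have := Ga _ Gz; rewrite !mxE => ->.
by rewrite gerDl pmulr_rle0 // subr_le0.
Qed.

Lemma tight_subset S T : S \subset T -> tight T `<=` tight S.
Proof. by move=> sST x [Px sT]; split=> //; apply: fintype.subset_trans sT. Qed.

Lemma tight_sub_active S z : P z -> tight (active z) `<=` tight S <-> S \subset active z.
Proof.
move=> Pz; split=> [sub|]; last exact: tight_subset.
by have [] := sub z (tight_active Pz).
Qed.

(** If the kernels had the same rank they would coincide; then [z' - z] would be a direction of the
    smaller face, which would put [z'] and with it all of [G'] into [G]. *)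
Lemma faces_lt_affdim G G' : faces P G -> faces P G' -> G `<` G' ->
  affdim G < affdim G'.
Proof.
move=> fG fG' [sub nsub].
have [x G'x] : G' !=set0 by apply/set0P/negP => /eqP e0; apply: nsub; rewrite e0.
have [->|/set0P Gn] := eqVneq G set0.
  by rewrite affdim_set0; apply: lt_le_trans (affdim_ge0 G'x).
have [z' Pz' eG'] := face_relint fG' (ex_intro _ x G'x).
have [z Pz eG] := face_relint fG Gn.
have sact : active z' \subset active z.
  by apply/tight_sub_active => //; rewrite -eG -eG'.
have subker : (kernel (active z) <= kernel (active z'))%MS.
  apply/rV_subP => u /sub_ker_tight[uE uN]; apply/sub_ker_tight; split=> // j.
  by move/(fintype.subsetP sact)/uN.
rewrite eG eG' !affdim_tight // ltz_nat ltn_neqAle mxrankS // andbT.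
apply/negP => eqr; apply: nsub; rewrite eG'.
have /andP[_ subker'] : (kernel (active z) == kernel (active z'))%MS.
  by rewrite -mxrank_leqif_eq.
have Gz' : G z'.
  rewrite eG; split=> //; apply/fintype.subsetP => j jz.
  have /sub_ker_tight[_ /(_ j jz)] : (z' - z <= kernel (active z))%MS.
    apply: submx_trans subker'; apply/sub_ker_tight; split.
      by rewrite mulmxBl Pz'.1 Pz.1 subrr.
    move=> i iz; have /activeP iz1 := iz.
    have /activeP iz2 := fintype.subsetP sact i iz.
    by rewrite mulmxBl !mxE in iz1 iz2 *; rewrite iz1 iz2 subrr.
  move=> e0; apply/activeP; have /activeP zj := jz.
  by rewrite mulmxBl !mxE in e0 zj *; rewrite -zj; lra.
by rewrite eG; apply: tight_subset; move: Gz'; rewrite eG => -[].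
Qed.

Lemma vertices_ker v : vertices P v <-> P v /\ kernel (active v) = 0.
Proof.
split=> [fv|[Pv ker0]].
  have [|z Pz ev] := face_relint fv; first by exists v.
  have vz : v = z by have : [set v] z by rewrite ev; exact: tight_active.
  subst z; split=> //; apply/eqP; rewrite -mxrank_eq0; apply/eqP.
  by have := affdim_tight Pz; rewrite -ev affdim_set1 => -[].
rewrite /vertices /= (_ : [set v] = tight (active v)); first exact: faces_tight.
apply/seteqP; split=> [x ->|x [Px sub]]; first exact: tight_active.
have : (x - v <= kernel (active v))%MS.
  apply/sub_ker_tight; split; first by rewrite mulmxBl Px.1 Pv.1 subrr.
  move=> i iz; have /activeP iz1 := iz; have /activeP iz2 := fintype.subsetP sub i iz.
  by rewrite mulmxBl !mxE in iz1 iz2 *; rewrite iz1 iz2 subrr.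
by rewrite ker0 submx0 subr_eq0 => /eqP.
Qed.

(* Simplex step: from a point that is not a vertex, slide along its minimal
   face in a direction that does not increase the objective until another
   constraint becomes tight. *)
Lemma vertex_below (a : 'cV[R]_k) z : bounded_set P -> P z ->
  exists v, [/\ vertices P v, active z \subset active v &
                (v *m a) 0 0 <= (z *m a) 0 0].
Proof.
move=> /bounded_set_norm_le[B B0 PB].
have [n] := ubnP (q - #|active z|); elim: n z => // n IHn z lt_n Pz.
have [ker0|kern0] := eqVneq (kernel (active z)) 0.
  by exists z; split=> //; apply/vertices_ker.
have [u [uK u0 ua]] : exists u, [/\ (u <= kernel (active z))%MS, u != 0 & (u *m a) 0 0 <= 0].
  have /rowV0Pn[u uK u0] := kern0.
  have [ua|ua] := leP ((u *m a) 0 0) 0; first by exists u.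
  exists (- u); split; first by rewrite eqmx_opp.
    by rewrite oppr_eq0.
  by rewrite mulNmx mxE oppr_le0 ltW.
have /sub_ker_tight[uE uN] := uK.
have moved t j : ((z + t *: u) *m N) 0 j = (z *m N) 0 j + t * (u *m N) 0 j.
  by rewrite mulmxDl -scalemxAl !mxE.
have zb j : (z *m N) 0 j <= b 0 j by case: Pz.
(* Otherwise the whole ray from [z] along [u] would lie in [P]; the chosen [t] carries it out of the
   ball of radius [B]. *)
have [j0 uj0] : exists j, 0 < (u *m N) 0 j.
  apply: contrapT => nex; have un : 0 < `|u| by rewrite normr_gt0.
  pose t := (B + `|z| + 1) / `|u|.
  have t0 : 0 < t by rewrite divr_gt0 // ltr_wpDl // addr_ge0 // ltW.
  have /PB : P (z + t *: u).
    split=> [|j]; first by rewrite mulmxDl -scalemxAl uE scaler0 addr0 Pz.1.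
    rewrite moved (le_trans _ (zb j)) // gerDl pmulr_rle0 // leNgt.
    by apply/negP => uj; apply: nex; exists j.
  apply/negP; rewrite -ltNge [z + _]addrC; have := lerB_normD (t *: u) z.
  rewrite normrZ gtr0_norm // mulfVK ?normr_eq0 // => h.
  by apply: lt_le_trans h; lra.
pose ratio j := (b 0 j - (z *m N) 0 j) / (u *m N) 0 j.
have [j uj minj] := @arg_minP _ _ _ j0 (fun j => 0 < (u *m N) 0 j) ratio uj0.
pose t := ratio j; have t0 : 0 <= t by rewrite divr_ge0 ?subr_ge0 // ltW.
pose z' := z + t *: u.
have Pz' : P z'.
  split=> [|i]; first by rewrite mulmxDl -scalemxAl uE scaler0 addr0 Pz.1.
  rewrite moved; have [ui|ui] := leP ((u *m N) 0 i) 0.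
    by rewrite (le_trans _ (zb i)) // gerDl mulr_ge0_le0.
  by rewrite -lerBrDl -ler_pdivlMr // minj.
have sub : active z \subset active z'.
  apply/fintype.subsetP => i iz; have /activeP iz' := iz; apply/activeP.
  by rewrite moved uN // mulr0 addr0.
have lt : (#|active z| < #|active z'|)%N.
  apply: proper_card; rewrite properE sub; apply/fintype.subsetPn; exists j.
    by apply/activeP; rewrite moved mulfVK ?lt0r_neq0 // addrC subrK.
  by apply/negP => /uN uj'; rewrite uj' ltxx in uj.
have [|v [vv vsub va]] := IHn z' _ Pz'.
  apply: leq_trans (_ : q - #|active z| <= n)%N; last by rewrite -ltnS.
  by rewrite ltn_sub2l // (leq_trans lt) // -[X in (_ <= X)%N]card_ord max_card.
exists v; split=> //; first exact: fintype.subset_trans vsub.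
apply: le_trans va _; rewrite mulmxDl -scalemxAl !mxE gerDl.
by move: ua; rewrite !mxE => ua; exact: mulr_ge0_le0.
Qed.

(** Adding one inequality changes [tight_mx] by a matrix of rank at most one, so the kernel loses at
    most one dimension. *)
Lemma rank_kernel_le S T : S \subset T ->
  (\rank (kernel S) <= \rank (kernel T) + #|T :\: S|)%N.
Proof.
have [n] := ubnP #|T :\: S|; elim: n S => // n IHn S lt_n sST.
have [/eqP|[j jD]] := set_0Vmem (T :\: S).
  rewrite finset.setD_eq0 => sTS; have -> : S = T by apply/eqP; rewrite finset.eqEsubset sST.
  exact: leq_addr.
have [jT jS] : j \in T /\ j \notin S by move: jD; rewrite inE => /andP[].
have card_jS : #|T :\: S| = #|T :\: (j |: S)|.+1.
  by rewrite (cardsD1 j) jD finset.setDDl finset.setUC.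
have := IHn (j |: S); rewrite finset.subUset finset.sub1set jT sST.
move=> /(_ _ isT) le_jS; apply: leq_trans (_ : \rank (kernel (j |: S)) + 1 <= _)%N.
  have -> : tight_mx E N (j |: S) = tight_mx E N S + col j N *m row_mx 0 (delta_mx 0 j).
    rewrite mul_mx_row mulmx0 add_row_mx addr0; congr row_mx.
    apply/matrixP => x y; rewrite !mxE big_ord1 !mxE eqxx /= in_setU1.
    by have [->|] := eqVneq y j; rewrite ?(negPf jS) ?mulr0 ?addr0 ?mulr1 ?mulr0n ?add0r.
  rewrite !mxrank_ker; set A := tight_mx _ _ _; set D := _ *m row_mx _ _.
  have : (\rank (A + D)%R <= \rank A + 1)%N.
    apply: leq_trans (mxrankS (addmx_sub_adds (submx_refl A) (submx_refl D))) _.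
    apply: leq_trans (mxrank_adds_leqif _ _) _; rewrite leq_add2l.
    by apply: leq_trans (mxrankM_maxr _ _) (rank_leq_row _).
  by have := rank_leq_row (A + D)%R; have := rank_leq_row A; lia.
rewrite card_jS in lt_n *; have := le_jS _; lia.
Qed.

Lemma rank_kernel_lt S T u : S \subset T -> (u <= kernel S)%MS ->
  ~~ (u <= kernel T)%MS -> (\rank (kernel T) < \rank (kernel S))%N.
Proof.
move=> /fintype.subsetP sST uS uT; apply: rank_ltmx; rewrite ltmxE; apply/andP; split.
  apply/rV_subP => w /sub_ker_tight[wE wN]; apply/sub_ker_tight; split=> // j.
  by move/sST/wN.
by apply: contra uT => /(submx_trans uS).
Qed.

End Faces.

(** * Irredundant descriptions and facets *)

Definition irredundant (R : realType) (k e q : nat)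
    (E : 'M[R]_(k, e)) (c : 'rV[R]_e) (N : 'M[R]_(k, q)) (b : 'rV[R]_q) : Prop :=
  (exists2 w, sol E c N b w & active N b w = finset.set0) /\
  (forall j, exists2 z, sol E c N b z & active N b z = finset.set1 j).

(** Inequalities active at a relative interior point [w] become equations; of the others a minimal
    family still describing [P] is kept. By minimality some [y] violates inequality [j] alone, and
    the segment from [w] to [y] crosses its hyperplane at a point where the remaining inequalities
    are strict. *)
Lemma irredundant_presentation (R : realType) (k : nat) (P : set 'rV[R]_k) :
    polyhedron P -> P !=set0 ->
  exists (e q : nat) (E : 'M[R]_(k, e)) (c : 'rV[R]_e) (N : 'M[R]_(k, q)) (b : 'rV[R]_q),
    P = sol E c N b /\ irredundant E c N b.
Proof.
move=> [q [M [b eP]]] P0.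
have eP' : P = sol (0 : 'M_(k, 0)) 0 M b.
  by rewrite eP; apply/seteqP; split=> x; [split=> //; rewrite mulmx0|case].
have [w Pw Pact] : exists2 w, P w & forall x, P x -> active M b w \subset active M b x.
  have fP : faces (sol (0 : 'M_(k, 0)) 0 M b) P.
    exists 0, 0; rewrite -eP'; split=> [x _|]; first by rewrite mulmx0 mxE.
    by apply/seteqP; split=> [x Px|x []] //; split=> //=; rewrite mulmx0 mxE.
  have [z Pz ePz] := face_relint fP P0.
  by exists z; [rewrite eP'|move=> x; rewrite ePz => -[]].
pose I0 := active M b w.
pose Q (J : {set 'I_q}) := `[< forall x, (forall i, i \in I0 -> (x *m M) 0 i = b 0 i) ->
  (forall j, j \in J -> (x *m M) 0 j <= b 0 j) -> P x >].
have QC : Q (~: I0)%SET.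
  apply/asboolP => x xI xC; rewrite eP => i.
  by have [/xI ->|iI] := boolP (i \in I0); rewrite ?lexx // xC // inE.
have [J /minsetP[/asboolP QJ minJ] sJ] := minset_exists QC.
have Jw j : j \in J -> (w *m M) 0 j < b 0 j.
  move=> jJ; have := fintype.subsetP sJ j jJ; rewrite inE => jI.
  rewrite lt_neqAle; move: jI; rewrite inE => -> /=.
  by move: Pw; rewrite eP => /(_ j).
pose E : 'M_(k, q) := \matrix_(x, i) (M x i *+ (i \in I0)).
pose c : 'rV_q := \row_i (b 0 i *+ (i \in I0)).
pose N : 'M_(k, #|J|) := colsub enum_val M.
pose b' : 'rV_#|J| := \row_i b 0 (enum_val i).
have xE (x : 'rV_k) : x *m E = c <-> forall i, i \in I0 -> (x *m M) 0 i = b 0 i.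
  have eq_xE i : (x *m E) 0 i = (x *m M) 0 i *+ (i \in I0).
    by rewrite !mxE -sumrMnl; apply: eq_bigr => j _; rewrite !mxE mulrnAr.
  split=> [eq_x i iI|eq_x]; first by have := eq_xE i; rewrite eq_x mxE iI !mulr1n.
  by apply/rowP => i; rewrite eq_xE [RHS]mxE; case: (boolP (i \in I0)) => [/eq_x ->|].
have xN (x : 'rV_k) i : (x *m N) 0 i = (x *m M) 0 (enum_val i).
  by rewrite !mxE; apply: eq_bigr => j _; rewrite !mxE.
have ePN : P = sol E c N b'.
  apply/seteqP; split=> x.
    move=> Px; split; last by move=> j; rewrite xN [b' _ _]mxE; move: Px; rewrite eP.
    by apply/xE => i iI; apply/activeP; apply: (fintype.subsetP (Pact x Px)).
  move=> [/xE eqx leqx]; apply: QJ => // j jJ.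
  by have := leqx (enum_rank_in jJ j); rewrite xN [b' _ _]mxE enum_rankK_in.
exists q, #|J|, E, c, N, b'; split=> //; split.
  exists w; first by rewrite -ePN.
  by apply/setP => j; rewrite !inE xN [b' _ _]mxE lt_eqF // Jw // enum_valP.
move=> j0; have jJ := enum_valP j0; set j := enum_val j0 in jJ.
have [y [yE yJ Py]] : exists y, [/\ forall i, i \in I0 -> (y *m M) 0 i = b 0 i,
    forall i, i \in J -> i != j -> (y *m M) 0 i <= b 0 i & ~ P y].
  apply: contrapT => nex; have : Q (J :\ j)%SET.
    apply/asboolP => x xI xJ; apply: contrapT => Px; apply: nex; exists x; split=> // i iJ ij.
    by apply: xJ; rewrite !inE ij.
  move=> /minJ /(_ (finset.subD1set _ _)) eJ.
  by move: jJ; rewrite -eJ !inE eqxx.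
have yj : b 0 j < (y *m M) 0 j.
  rewrite ltNge; apply/negP => yj; apply: Py; apply: QJ => // i iJ.
  by have [->|ij] := eqVneq i j; last exact: yJ.
have wj := Jw j jJ.
pose t := (b 0 j - (w *m M) 0 j) / ((y *m M) 0 j - (w *m M) 0 j).
have den0 : 0 < (y *m M) 0 j - (w *m M) 0 j by rewrite subr_gt0 (lt_trans wj).
have t0 : 0 < t by rewrite divr_gt0 // subr_gt0.
have t1 : t < 1 by rewrite ltr_pdivrMr // mul1r ltrD2r.
pose z := w + t *: (y - w).
have zM i : (z *m M) 0 i = (w *m M) 0 i + t * ((y *m M) 0 i - (w *m M) 0 i).
  by rewrite mulmxDl -scalemxAl mulmxBl !mxE.
have zj : (z *m M) 0 j = b 0 j by rewrite zM divfK ?lt0r_neq0 // addrC subrK.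
have zJ i : i \in J -> i != j -> (z *m M) 0 i < b 0 i.
  move=> iJ ij; rewrite zM; have := Jw i iJ; have := yJ i iJ ij.
  by move: (_ 0 i) (_ 0 i) (b 0 i) => s r v; nra.
have zI i : i \in I0 -> (z *m M) 0 i = b 0 i.
  by move=> iI; rewrite zM yE //; have /activeP -> := iI; rewrite subrr mulr0 addr0.
exists z.
  rewrite -ePN; apply: QJ => // i iJ.
  by have [->|ij] := eqVneq i j; [rewrite zj|exact/ltW/zJ].
apply/setP => i; rewrite !inE xN [b' _ _]mxE.
have [->|ij] := eqVneq i j0; first by rewrite zj eqxx.
by rewrite lt_eqF // zJ ?enum_valP // (inj_eq enum_val_inj).
Qed.

Section Facets.
Variables (R : realType) (k e q : nat).
Variables (E : 'M[R]_(k, e)) (c : 'rV[R]_e) (N : 'M[R]_(k, q)) (b : 'rV[R]_q).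
Notation P := (sol E c N b).
Notation active := (active N b).
Notation tight := (tight E c N b).
Notation kernel S := (kermx (tight_mx E N S)).
Hypothesis irr : irredundant E c N b.
Variable d : nat.
Hypothesis dimP : affdim P = d%:Z.

Lemma tight_set0 : tight finset.set0 = P.
Proof. by apply/seteqP; split=> [x []|x] // Px; split=> //; apply: finset.sub0set. Qed.

Lemma rank_kernel_set0 : \rank (kernel finset.set0) = d.
Proof.
have [[w Pw aw] _] := irr.
by have := affdim_tight Pw; rewrite aw tight_set0 dimP => -[].
Qed.

Lemma affdim_tight1 j : affdim (tight (finset.set1 j)) = d%:Z - 1.
Proof.
have [[w Pw aw] /(_ j)[z Pz az]] := irr.
rewrite -az affdim_tight // az.
have le := @rank_kernel_le _ _ _ _ E N _ _ (finset.sub0set (finset.set1 j)).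
have lt : (\rank (kernel (finset.set1 j)) < \rank (kernel finset.set0))%N.
  apply: (@rank_kernel_lt _ _ _ _ _ _ _ _ (z - w)); first exact: finset.sub0set.
    apply/sub_ker_tight; split; last by move=> i; rewrite inE.
    by rewrite mulmxBl Pz.1 Pw.1 subrr.
  apply/negP => /sub_ker_tight[_ /(_ j)]; rewrite finset.set11 => /(_ isT).
  have zj : (z *m N) 0 j = b 0 j by apply/activeP; rewrite az finset.set11.
  have : j \notin active w by rewrite aw inE.
  rewrite inE mulmxBl; move: zj; rewrite !mxE => -> ne /eqP.
  by rewrite subr_eq0 eq_sym (negPf ne).
move: le lt; rewrite rank_kernel_set0 finset.setD0 cards1; lia.
Qed.

Lemma facets_tight j : facets P (tight (finset.set1 j)).
Proof. by split; [exact: faces_tight|rewrite affdim_tight1 dimP]. Qed.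

Lemma face_tight_sub1 G : faces P G -> G !=set0 -> G <> P ->
  exists j, G `<=` tight (finset.set1 j).
Proof.
move=> fG Gn nP; have [z Pz eG] := face_relint fG Gn.
have [e0|[j jz]] := set_0Vmem (active z).
  by case: nP; rewrite eG e0 tight_set0.
by exists j; rewrite eG; apply/tight_sub_active => //; rewrite finset.sub1set.
Qed.

(** For d > 0 a facet is nonempty and proper, hence contained in the face of one inequality, and
    equal dimensions force equality. A point is different: its facet is empty, while every [tight]
    of one index is nonempty. *)
Lemma facets_eq_tight F : (0 < d)%N -> facets P F -> exists j, F = tight (finset.set1 j).
Proof.
move=> d0 [fF dimF].
have Fn : F !=set0.
  by apply/set0P/negP => /eqP F0; move: dimF; rewrite F0 affdim_set0 dimP; lia.
have nP : F <> P by move=> eF; move: dimF; rewrite eF; lia.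
have [j sub] := face_tight_sub1 fF Fn nP; exists j; apply: contrapT => ne.
have : F `<` tight (finset.set1 j).
  by split=> // sub'; apply: ne; apply/seteqP.
by move=> /(faces_lt_affdim fF (faces_tight _ _ _ _ _)); rewrite affdim_tight1 dimF dimP ltxx.
Qed.

Lemma tight1_inj : injective (fun j => tight (finset.set1 j)).
Proof.
move=> i j /= eij; have [_ /(_ i)[z Pz az]] := irr.
have : tight (finset.set1 i) z by split=> //; rewrite az.
by rewrite eij => -[_]; rewrite az finset.sub1set inE => /eqP.
Qed.

End Facets.

(** The inequalities are renumbered by the facets, so that active sets become sets of rows of the
    incidence matrix. *)
Lemma facet_presentation (R : realType) (k d m : nat) (P : set 'rV[R]_k)
    (facet : 'I_m -> set 'rV[R]_k) :
    polytope d P -> (0 < d)%N -> set_bij setT (facets P) facet ->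
  exists (e : nat) (E : 'M[R]_(k, e)) (c : 'rV[R]_e) (N : 'M[R]_(k, m)) (b : 'rV[R]_m),
    [/\ P = sol E c N b, irredundant E c N b &
        forall f, facet f = tight E c N b (finset.set1 f)].
Proof.
move=> [polyP _ dimP] d0 [fsub finj fsurj].
have Pn : P !=set0.
  by apply/set0P/negP => /eqP P0; move: dimP; rewrite P0 affdim_set0.
have [e [q [E [c [N [b [eP irr]]]]]]] := irredundant_presentation polyP Pn.
rewrite eP in dimP.
have /(_ _)/cid-/all_sig[s facet_s] : forall f, exists j, facet f = tight E c N b (finset.set1 j).
  move=> f; apply: (facets_eq_tight irr dimP d0); rewrite -eP; exact: fsub.
have s_inj : injective s.
  by move=> f f' eqs; apply: finj; rewrite ?inE // !facet_s eqs.
have s_surj j : exists f, s f = j.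
  have := facets_tight irr dimP j; rewrite -eP => /fsurj[f _].
  by rewrite facet_s => /(tight1_inj irr); exists f.
pose N' : 'M_(k, m) := colsub s N; pose b' : 'rV_m := \row_f b 0 (s f).
have xN (x : 'rV_k) f : (x *m N') 0 f = (x *m N) 0 (s f).
  by rewrite !mxE; apply: eq_bigr => j _; rewrite !mxE.
have act x f : (f \in active N' b' x) = (s f \in active N b x).
  by rewrite !inE xN [b' _ _]mxE.
have eP' : sol E c N b = sol E c N' b'.
  apply/seteqP; split=> x [xE xle]; split=> // j; first by rewrite xN [b' _ _]mxE.
  by have [f <-] := s_surj j; have := xle f; rewrite xN [b' _ _]mxE.
exists e, E, c, N', b'; split; first by rewrite -eP'.
- have [[w Pw aw] irr1] := irr; split.
    by exists w; rewrite -?eP' //; apply/setP => f; rewrite act aw !inE.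
  move=> f; have [z Pz az] := irr1 (s f); exists z; rewrite -?eP' //.
  by apply/setP => g; rewrite act az !inE (inj_eq s_inj).
- move=> f; rewrite facet_s /tight eP'; apply/seteqP.
  by split=> x [Px]; rewrite finset.sub1set => sx; split=> //;
    rewrite finset.sub1set ?act // -act.
Qed.

Lemma card_range_ord (T : Type) (p : nat) (g : 'I_p -> T) :
  injective g -> (range g #= `I_p)%card.
Proof.
move=> g_inj; apply: card_eq_trans (card_esym card_II).
by apply: inj_card_eq => x y _ _; apply: g_inj.
Qed.

Lemma card_eq_finset (T : Type) (p : nat) (B : {set 'I_p}) (g : 'I_p -> T) (X : set T) (d : nat) :
  injective g -> X = g @` [set` B] -> (X #= `I_d)%card -> #|B| = d.
Proof.
move=> g_inj -> Xd; apply/card_eq_II; apply: card_eq_trans Xd; apply: card_esym.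
have -> : g @` [set` B] = range (g \o (enum_val : 'I_#|B| -> 'I_p)).
  apply/seteqP; split=> [_ [x /= xB <-]|_ [i _ <-]] /=.
    by exists (enum_rank_in xB x) => //=; rewrite enum_rankK_in.
  by exists (enum_val i) => //=; apply: enum_valP.
by apply: card_range_ord => x y /g_inj /enum_val_inj.
Qed.

Lemma homogenized_mul (R : realType) (k : nat) (x : 'rV[R]_k) (w : 'cV[R]_(k + 1)) :
  (row_mx x (const_mx 1) *m w) 0 0 = (x *m usubmx w) 0 0 + dsubmx w 0 0.
Proof.
rewrite -[in LHS](vsubmxK w) mul_row_col mxE; congr (_ + _).
by rewrite mxE big_ord1 mxE mul1r.
Qed.

(** * Simple and simplicial polytopes *)

Section Incidence.
Variables (R : realType) (k d m n : nat) (P : set 'rV[R]_k) (A : 'M[bool]_(m, n)).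
Variables (facet : 'I_m -> set 'rV[R]_k) (vertex : 'I_n -> 'rV[R]_k).
Hypotheses (polyP : polytope d P) (d_gt0 : (0 < d)%N).
Hypotheses (facet_bij : set_bij setT (facets P) facet)
           (vertex_bij : set_bij setT (vertices P) vertex).
Hypothesis AE : forall f v, A f v <-> facet f (vertex v).
Variables (e : nat) (E : 'M[R]_(k, e)) (c : 'rV[R]_e) (N : 'M[R]_(k, m)) (b : 'rV[R]_m).
Hypotheses (eP : P = sol E c N b) (irr : irredundant E c N b).
Hypothesis facetE : forall f, facet f = tight E c N b (finset.set1 f).

Notation active := (active N b).
Notation tight := (tight E c N b).
Notation kernel S := (kermx (tight_mx E N S)).
Notation facets_of v := (finset (fun f => A f v)).
Notation vertices_of f := (finset (fun v => A f v)).

Let bndP : bounded_set (sol E c N b). Proof. by rewrite -eP; case: polyP. Qed.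
Let dimP : affdim (sol E c N b) = d%:Z. Proof. by rewrite -eP; case: polyP. Qed.

Lemma vertex_inj : injective vertex.
Proof. by case: vertex_bij => _ inj _ x y; apply: inj; rewrite inE. Qed.

Lemma facet_inj : injective facet.
Proof. by case: facet_bij => _ inj _ x y; apply: inj; rewrite inE. Qed.

Lemma vertexP v : vertices (sol E c N b) (vertex v).
Proof. by case: vertex_bij => sub _ _; rewrite -eP; apply: sub. Qed.

Lemma vertex_sol v : sol E c N b (vertex v).
Proof. by have /vertices_ker[] := vertexP v. Qed.

Lemma vertex_surj x : vertices (sol E c N b) x -> exists v, vertex v = x.
Proof. by case: vertex_bij => _ _ surj; rewrite -eP => /surj[v _ <-]; exists v. Qed.

Lemma active_vertex v : active (vertex v) = facets_of v.
Proof.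
apply/setP => f; rewrite [RHS]inE; apply/idP/idP => [fv|/AE].
  by apply/AE; rewrite facetE; split; [exact: vertex_sol|rewrite finset.sub1set].
by rewrite facetE => -[_]; rewrite finset.sub1set.
Qed.

Lemma point_active z : sol E c N b z ->
  exists v, active z \subset active (vertex v).
Proof.
move=> Pz; have [x [vx sub _]] := vertex_below 0 bndP Pz.
by have [v vE] := vertex_surj vx; exists v; rewrite vE.
Qed.

(** At a vertex the kernel has shrunk from dimension d to 0, by at most one for each active
    inequality. *)
Lemma degree_ge v : (d <= #|facets_of v|)%N.
Proof.
have := @rank_kernel_le _ _ _ _ E N _ _ (finset.sub0set (active (vertex v))).
have /vertices_ker[_ ->] := vertexP v.
by rewrite mxrank0 add0n finset.setD0 (rank_kernel_set0 irr dimP) active_vertex.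
Qed.

(* An affine functional that vanishes at all vertices of a face vanishes on
   the whole face. *)
Lemma face_span (S : {set 'I_m}) r (X : 'M[R]_(r, k)) (y : 'rV[R]_k) :
    (forall v, S \subset active (vertex v) -> exists i, row i X = vertex v) ->
    tight S y ->
  (row_mx y (const_mx 1 : 'cV[R]_1) <= row_mx X (const_mx 1 : 'cV[R]_r))%MS.
Proof.
move=> Xall [Py Sy]; set X' := row_mx X _; rewrite submxE; apply/eqP/rowP => j.
(* A column of the cokernel is an affine functional vanishing at the rows of [X]. Its values at [y]
   are squeezed between values at vertices of the face, obtained by descending along [a] and along
   [- a]. *)
pose w := col j (cokermx X'); pose a := usubmx w; pose delta := dsubmx w.
have X'w : X' *m w = 0 by rewrite /w colE mulmxA mulmx_coker mul0mx.
have aX i : (row i X *m a) 0 0 = - delta 0 0.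
  move: X'w; rewrite -[w]vsubmxK mul_row_col => /matrixP/(_ i 0).
  rewrite mxE [X in _ + X]mxE big_ord1 !mxE mul1r => /eqP; rewrite addr_eq0 => /eqP <-.
  by apply: eq_bigr => x _; rewrite !mxE.
have av v : S \subset active (vertex v) -> (vertex v *m a) 0 0 = - delta 0 0.
  by move=> /Xall[i <-]; exact: aX.
have ya : (y *m a) 0 0 = - delta 0 0.
  apply/eqP; rewrite eq_le; apply/andP; split.
    have [x [vx sub]] := vertex_below (- a) bndP Py.
    have [v vE] := vertex_surj vx; rewrite -vE in sub *.
    have := av v (fintype.subset_trans Sy sub).
    by rewrite !mulmxN !mxE lerN2 => ->.
  have [x [vx sub]] := vertex_below a bndP Py.
  have [v vE] := vertex_surj vx; rewrite -vE in sub *.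
  by rewrite (av v (fintype.subset_trans Sy sub)).
have -> : (row_mx y (const_mx 1 : 'cV[R]_1) *m cokermx X') 0 j =
          (row_mx y (const_mx 1) *m w) 0 0.
  by rewrite !mxE; apply: eq_bigr => i _; rewrite [w _ _]mxE.
by rewrite homogenized_mul ya [RHS]mxE addNr.
Qed.

Definition points (T : {set 'I_n}) : 'M[R]_(#|T|, k) :=
  \matrix_(i < #|T|) vertex (enum_val i).

Lemma points_row (T : {set 'I_n}) v : v \in T -> exists i, row i (points T) = vertex v.
Proof. by move=> vT; exists (enum_rank_in vT v); rewrite rowK enum_rankK_in. Qed.

(** The vertices of a facet span it affinely and its dimension is d - 1, so there are at least d of
    them, and d spanning points must be independent. *)
Lemma facet_independent f : (d <= #|vertices_of f|)%N /\
  (#|vertices_of f| = d -> affinely_independent (points (vertices_of f))).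
Proof.
have [p [Y [dimY indY Yf]]] := affdim_witness (tight (finset.set1 f)).
have pd : p = d by move: dimY; rewrite (affdim_tight1 irr dimP); lia.
have sub : (row_mx Y (const_mx 1 : 'cV[R]_p) <=
            row_mx (points (vertices_of f)) (const_mx 1 : 'cV[R]__))%MS.
  apply/row_subP => i; rewrite row_row_mx row_const.
  apply: face_span (Yf i) => v; rewrite finset.sub1set active_vertex inE => Afv.
  by apply: points_row; rewrite inE.
have := mxrankS sub; rewrite (eqP indY) pd => le_rank.
split; first exact: leq_trans le_rank (rank_leq_row _).
move=> card_f; rewrite /affinely_independent /row_free eqn_leq rank_leq_row.
by rewrite [X in (X <= _)%N]card_f.
Qed.

Lemma sum_degrees : (\sum_v #|facets_of v| = \sum_f #|vertices_of f|)%N.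
Proof.
transitivity (\sum_v \sum_f A f v)%N.
  apply: eq_bigr => v _; rewrite -sum1_card big_mkcond; apply: eq_bigr => f _.
  by rewrite inE; case: (A f v).
rewrite exchange_big /=; apply: eq_bigr => f _.
by rewrite -sum1_card [RHS]big_mkcond; apply: eq_bigr => v _; rewrite inE; case: (A f v).
Qed.

(** Count incidences in two ways: each vertex has d, and each facet has at least d. *)
Lemma facets_le_vertices : (forall v, #|facets_of v| = d) -> (m <= n)%N.
Proof.
move=> degd; have := sum_degrees.
rewrite (eq_bigr (fun=> d)) // sum_nat_const card_ord => eq_sum.
rewrite -(leq_pmul2r d_gt0) eq_sum -[X in (X * _)%N]card_ord -sum_nat_const.
by apply: leq_sum => f _; case: (facet_independent f).
Qed.

Lemma vertices_le_facets : (forall f, #|vertices_of f| = d) -> (n <= m)%N.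
Proof.
move=> degd; have := sum_degrees.
rewrite [RHS](eq_bigr (fun=> d)) // sum_nat_const card_ord => eq_sum.
rewrite -(leq_pmul2r d_gt0) -eq_sum -[X in (X * _)%N]card_ord -sum_nat_const.
by apply: leq_sum => v _; exact: degree_ge.
Qed.

(** With m = n the degrees sum to n d, so the lower bound d is attained at every vertex. *)
Lemma simplicial_square_simple : (forall f, #|vertices_of f| = d) -> (m <= n)%N ->
  forall v, #|facets_of v| = d.
Proof.
move=> degd le_mn.
have eq_mn : m = n by apply/eqP; rewrite eqn_leq le_mn vertices_le_facets.
have eq_sum : (\sum_(v < n) d = \sum_v #|facets_of v|)%N.
  rewrite sum_degrees [RHS](eq_bigr (fun=> d)) // !sum_nat_const !card_ord.
  by congr (_ * _)%N.
move=> v; apply/esym/eqP.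
have /leqif_sum/leqifP : forall i : 'I_n, predT i ->
    (d <= #|facets_of i| ?= iff (d == #|facets_of i|))%N.
  by move=> i _; split; first exact: degree_ge.
by case: ifP => [/forallP/(_ v)//|_]; rewrite eq_sum ltnn.
Qed.

Lemma exists_vertex : exists v : 'I_n, True.
Proof.
have [[w Pw _] _] := irr; have [v _] := point_active Pw; by exists v.
Qed.


Lemma faces_set0 : faces P set0.
Proof.
exists 0, 1; split=> [x _|]; first by rewrite mulmx0 mxE.
by apply/seteqP; split=> // x [_ /=]; rewrite mulmx0 mxE => /eqP; rewrite eq_sym oner_eq0.
Qed.

Section Simple.
Hypothesis degd : forall v, #|facets_of v| = d.

(* The d constraints tight at a vertex are linearly independent, so that each
   of them can be relaxed without affecting the others. *)
Lemma relax v (S : {set 'I_m}) : S \subset facets_of v ->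
  exists2 z, sol E c N b z & active z = S.
Proof.
rewrite -active_vertex; set T := active (vertex v) => sST.
have cardT : #|T| = d by rewrite /T active_vertex degd.
have kerT : kernel T = 0 by have /vertices_ker[] := vertexP v.
(* Without [j] only d - 1 inequalities remain, so their kernel is nonzero; since the kernel for all
   of [T] is 0, a nonzero vector in it cannot vanish at [j] and can be scaled to -1 there. *)
have dir j : exists u : 'rV[R]_k, j \in T -> [/\ u *m E = 0,
    forall i, i \in T -> i != j -> (u *m N) 0 i = 0 & (u *m N) 0 j = -1].
  have [jT|] := boolP (j \in T); last by exists 0.
  have card_Tj : #|(T :\ j)%SET|.+1 = d by rewrite -cardT [in RHS](cardsD1 j) jT.
  have := @rank_kernel_le _ _ _ _ E N _ _ (finset.sub0set (T :\ j)%SET).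
  rewrite (rank_kernel_set0 irr dimP) finset.setD0 => le_d.
  have /rowV0Pn[u uK u0] : kernel (T :\ j)%SET != 0.
    by rewrite -mxrank_eq0; apply/eqP => rank0; move: le_d; rewrite rank0; lia.
  have /sub_ker_tight[uE uN] := uK.
  have uj : (u *m N) 0 j != 0.
    apply: contraNneq u0 => uj0; rewrite -submx0 -kerT; apply/sub_ker_tight.
    split=> // i iT; have [->|ij] := eqVneq i j; first exact: uj0.
    by apply: uN; rewrite in_setD1 ij.
  exists (- ((u *m N) 0 j)^-1 *: u) => _; split.
  - by rewrite -scalemxAl uE scaler0.
  - by move=> i iT ij; rewrite -scalemxAl mxE uN ?mulr0 // in_setD1 ij.
  - by rewrite -scalemxAl mxE mulNr mulVf.
have /(_ _)/cid-/all_sig[u uP] := dir.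
pose w := \sum_(j in T :\: S) u j.
have wE : w *m E = 0.
  by rewrite mulmx_suml big1 // => j; rewrite inE => /andP[_ /uP[]].
have wN i : i \in T -> (w *m N) 0 i = - (i \notin S)%:R.
  move=> iT; rewrite mulmx_suml summxE; have [iS|iS] := boolP (i \in S).
    rewrite big1 ?oppr0 // => j; rewrite inE => /andP[jS /uP[_ uN _]].
    by apply: uN => //; apply: contraNneq jS => <-.
  rewrite (bigD1 i) /=; last by rewrite inE iS.
  have [_ _ ->] := uP i iT; rewrite big1 ?addr0 // => j /andP[].
  by rewrite inE => /andP[_ /uP[_ uN _]] ji; apply: uN; rewrite // eq_sym.
have [i iT|eps eps0 /(_ eps)] := push (vertex_sol v) wE.
  by rewrite wN // oppr_le0.
rewrite eps0 lexx => /(_ isT)[Pz az]; exists (vertex v + eps *: w) => //.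
rewrite az; apply/setP => i; rewrite inE -/T.
have [iT|iT] := boolP (i \in T); last by apply/esym/(contraNF _ iT)/fintype.subsetP.
by rewrite wN // oppr_eq0 pnatr_eq0 eqb0 negbK.
Qed.

(** Each inequality at the vertex lowers the dimension by at most one, and all d together lower it
    by d; so each lowers it by exactly one. *)
Lemma affdim_simple v (S : {set 'I_m}) : S \subset facets_of v ->
  affdim (tight S) = d%:Z - #|S|%:Z.
Proof.
move=> sSv; have [z Pz az] := relax sSv; rewrite -az affdim_tight // az.
have le1 := @rank_kernel_le _ _ _ _ E N _ _ (finset.sub0set S).
rewrite -active_vertex in sSv; have le2 := @rank_kernel_le _ _ _ _ E N _ _ sSv.
move: le1 le2; rewrite (rank_kernel_set0 irr dimP) finset.setD0 cardsDS //.
have /vertices_ker[_ ->] := vertexP v; rewrite mxrank0.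
by have := subset_leq_card sSv; rewrite active_vertex degd; lia.
Qed.

Definition simple_face (x : option {set 'I_m}) : set 'rV[R]_k :=
  if x is Some U then tight U else set0.

Lemma simple_face_sub v (S : {set 'I_m}) (T : {set 'I_m}) : S \subset facets_of v ->
  tight S `<=` tight T <-> T \subset S.
Proof. by move=> /relax[z Pz <-]; exact: tight_sub_active. Qed.

Lemma simple_hasse :
  [/\ pure_complex (fun v => facets_of v) d,
      set_bij [set x | is_node (fun v => facets_of v) x] (faces P) simple_face &
      forall x y, is_node (fun v => facets_of v) x -> is_node (fun v => facets_of v) y ->
        (hasse_arc (simple_face x) (simple_face y) <-> covers d x y)].
Proof.
split.
- split=> //.
  + move=> u v /= eq_uv; apply: vertex_inj.
    have /vertices_ker[Pu ku] := vertexP u; have /vertices_ker[Pv kv] := vertexP v.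
    rewrite !active_vertex eq_uv in ku kv.
    apply/eqP; rewrite -subr_eq0 -submx0 -ku; apply/sub_ker_tight; split.
      by rewrite mulmxBl Pu.1 Pv.1 subrr.
    move=> i iv; have iv' := iv; rewrite -eq_uv in iv'.
    have /activeP e1 : i \in active (vertex u) by rewrite active_vertex.
    have /activeP e2 : i \in active (vertex v) by rewrite active_vertex.
    by rewrite mulmxBl !mxE in e1 e2 *; rewrite e1 e2 subrr.
  + exact: facets_le_vertices.
  + move=> _ f; have [_ /(_ f)[z Pz az]] := irr.
    have [v] := point_active Pz; rewrite az active_vertex finset.sub1set.
    by exists v.
  + have [v _] := exists_vertex; rewrite (leq_trans d_gt0) // -(degd v).
    by rewrite -[X in (_ <= X)%N]card_ord max_card.
  + by move=> d0; move: d_gt0; rewrite d0.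
- split.
  + by case=> [U _|_] /=; rewrite ?eP; [exact: faces_tight|rewrite -eP; exact: faces_set0].
  + case=> [U|] [V|]; rewrite !inE /=.
    * move=> /complexP[u Uu] /complexP[v Vv] eqUV; congr Some; apply/eqP.
      rewrite finset.eqEsubset; apply/andP; split.
        by apply/(simple_face_sub _ Vv); rewrite eqUV.
      by apply/(simple_face_sub _ Uu); rewrite eqUV.
    * move=> /complexP[u /relax[z Pz az]] _ e0.
      by have : tight U z by [rewrite -az]; rewrite e0.
    * move=> _ /complexP[u /relax[z Pz az]] e0.
      by have : tight V z by [rewrite -az]; rewrite -e0.
    * by [].
  + move=> G fG; have [->|/set0P Gn] := eqVneq G set0; first by exists None.
    rewrite eP in fG; have [z Pz ->] := face_relint fG Gn.
    exists (Some (active z)) => //=; apply/complexP.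
    by have [v] := point_active Pz; rewrite active_vertex; exists v.
- case=> [U|] [V|] //=.
  + move=> /complexP[u Uu] /complexP[v Vv].
    rewrite /hasse_arc (affdim_simple Uu) (affdim_simple Vv).
    have := simple_face_sub V Uu; have := simple_face_sub U Vv => subVU subUV.
    have cU := subset_leq_card Uu; rewrite degd in cU.
    split=> [[[/subUV VU _] dimUV]|/andP[VU /eqP cUV]].
      rewrite VU /=; apply/eqP; move: dimUV cU; move: #|U| #|V| => x y; clear; lia.
    split; last by move: cUV cU; move: #|U| #|V| => x y; clear; lia.
    split; first exact/subUV.
    by move=> /subVU /subset_leq_card; rewrite cUV ltnn.
  + by move=> _ _; split=> // -[[_ nsub] _]; case: nsub.
  + move=> _ /complexP[v Vv]; have cV := subset_leq_card Vv; rewrite degd in cV.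
    rewrite /hasse_arc affdim_set0 (affdim_simple Vv).
    split=> [[_ dimV]|/eqP cV'].
      by apply/eqP; move: dimV; move: #|V| => x; clear; lia.
    split; last by move: cV'; move: #|V| => x; clear; lia.
    have [z Pz az] := relax Vv; split=> // /(_ z); apply.
    by rewrite -az.
  + by move=> _ _; split=> // -[[_ /(_ (fun _ => id))]].
Qed.

End Simple.

Section Simplicial.
Hypothesis degd : forall f, #|vertices_of f| = d.

(** The functional is a column of a right inverse of the homogenized vertex matrix. It is
    nonnegative on the whole facet because below each point of the facet there is a vertex of the
    facet. *)
Lemma barycentric f u : u \in vertices_of f -> exists a : 'cV[R]_k, exists delta : R,
  (forall v, v \in vertices_of f -> (vertex v *m a) 0 0 - delta = (v == u)%:R) /\
  (forall x, tight (finset.set1 f) x -> delta <= (x *m a) 0 0).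
Proof.
move=> uf; have [_ /(_ (degd f))] := facet_independent f.
rewrite /affinely_independent => /row_freeP[B XB].
pose w := col (enum_rank_in uf u) B; pose a := usubmx w; pose delta := - dsubmx w 0 0.
have aw v : v \in vertices_of f -> (vertex v *m a) 0 0 - delta = (v == u)%:R.
  move=> vf; pose i := enum_rank_in vf v.
  have : (row i (row_mx (points (vertices_of f)) (const_mx 1 : 'cV[R]__)) *m w) 0 0 =
         (v == u)%:R.
    rewrite -row_mul /w colE mulmxA XB mul1mx !mxE eqxx andbT.
    congr (_%:R); rewrite -(inj_eq enum_val_inj) !enum_rankK_in //.
  rewrite row_row_mx rowK enum_rankK_in // row_const homogenized_mul => <-.
  by rewrite opprK.
exists a, delta; split=> // x [Px fx].
have [y [vy sub]] := vertex_below a bndP Px.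
have [v vE] := vertex_surj vy; rewrite -vE in sub *; apply: le_trans.
have := fintype.subset_trans fx sub; rewrite finset.sub1set active_vertex inE => Afv.
rewrite -subr_ge0 aw ?inE //; exact: ler0n.
Qed.

Definition common (T : {set 'I_n}) : {set 'I_m} := finset (fun f => T \subset vertices_of f).

Lemma commonP (T : {set 'I_n}) f : (f \in common T) = [forall v in T, f \in active (vertex v)].
Proof.
rewrite inE; apply/fintype.subsetP/forall_inP => sub v /sub;
  by rewrite active_vertex !inE.
Qed.

(** Repeated midpoints keep active only what is active at all vertices in [T]. The last clause
    expresses that the point is an affine combination of [T], without naming coefficients. *)
Lemma common_point (T : {set 'I_n}) : T != finset.set0 ->
  exists z, [/\ sol E c N b z, active z = common T &
    forall (a : 'cV[R]_k) delta, (forall v, v \in T -> (vertex v *m a) 0 0 = delta) ->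
      (z *m a) 0 0 = delta].
Proof.
have [s] := ubnP #|T|; elim: s T => // s IHs T lt_s /set0Pn[v vT].
have [T0|Tv0] := eqVneq (T :\ v)%SET finset.set0.
  have T1 u : u \in T -> u = v.
    by move=> uT; apply/eqP; have := in_setD1 u T v; rewrite T0 inE uT andbT => /esym/negbFE.
  exists (vertex v); split; first exact: vertex_sol.
    apply/setP => f; rewrite commonP; apply/idP/forall_inP => [fv u /T1 ->//|].
    by apply.
  by move=> a delta; apply.
have [|z [Pz az az0]] := IHs (T :\ v)%SET _ Tv0.
  by move: lt_s; rewrite (cardsD1 v T) vT.
have [Pm am] := active_mid Pz (vertex_sol v).
exists (2^-1 *: (z + vertex v)); split=> //.
  apply/setP => f; rewrite am inE az !commonP.
  apply/andP/forall_inP => [[/forall_inP sub fv] u uT|sub].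
    by have [->//|uv] := eqVneq u v; apply: sub; rewrite in_setD1 uv.
  by split; [apply/forall_inP => u; rewrite in_setD1 => /andP[_ /sub]|exact: sub].
move=> a delta Ta; have za : (z *m a) 0 0 = delta.
  by apply: az0 => u; rewrite in_setD1 => /andP[_ /Ta].
have va := Ta v vT; rewrite -scalemxAl mulmxDl; move: za va; rewrite !mxE => -> ->.
by lra.
Qed.

Definition simplicial_face (x : option {set 'I_n}) : set 'rV[R]_k :=
  if x is Some T then (if T == finset.set0 then set0 else tight (common T)) else P.

Definition vertex_set (G : set 'rV[R]_k) : {set 'I_n} :=
  finset (fun v => `[< G (vertex v) >]).

(** Suppose a vertex [u] outside [T] lay on the face. It belongs to the facet [f], and its
    barycentric coordinate is 0 at the point [z] common to [T]. A small step from [z] away from [u]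
    would stay in the facet and make this coordinate negative. *)
Lemma vertex_set_face f (T : {set 'I_n}) : T \subset vertices_of f ->
  vertex_set (simplicial_face (Some T)) = T.
Proof.
move=> Tf /=; have [->|T0] := eqVneq T finset.set0.
  by apply/setP => v; rewrite !inE; apply/asboolP.
have [z [Pz az za]] := common_point T0.
apply/setP => u; rewrite inE; apply/asboolP/idP => [[Pu sub]|uT]; last first.
  split; first exact: vertex_sol.
  by apply/fintype.subsetP => g; rewrite commonP => /forall_inP; apply.
apply/negP => /negP uT; have fcom : f \in common T by rewrite inE.
have uf : u \in vertices_of f.
  by have := fintype.subsetP sub f fcom; rewrite active_vertex !inE.
have [a [delta [aT adelta]]] := barycentric uf.
have za0 : (z *m a) 0 0 = delta.
  apply: za => v vT; apply/eqP; rewrite -subr_eq0 aT ?(fintype.subsetP Tf) //.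
  by rewrite (_ : v == u = false) //; apply: contraNF uT => /eqP <-.
have ua : (vertex u *m a) 0 0 = delta + 1.
  by have := aT u uf; rewrite eqxx => /eqP; rewrite subr_eq addrC => /eqP.
have dirN g : g \in active z -> ((z - vertex u) *m N) 0 g = 0.
  move=> gz; have /activeP zg := gz.
  have /activeP ug : g \in active (vertex u) by apply: (fintype.subsetP sub); rewrite -az.
  by rewrite mulmxBl !mxE in zg ug *; rewrite zg ug subrr.
have [||eps eps0 /(_ eps)] := @push R k e m E c N b z (z - vertex u) Pz.
- by rewrite mulmxBl Pz.1 Pu.1 subrr.
- by move=> g /dirN ->.
rewrite eps0 lexx => /(_ isT)[Pm am].
have /adelta : tight (finset.set1 f) (z + eps *: (z - vertex u)).
  by split=> //; rewrite finset.sub1set am inE dirN ?eqxx ?andbT ?az.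
rewrite mulmxDl -scalemxAl mulmxBl; move: za0 ua; rewrite !mxE => -> ->.
by rewrite lerDl pmulr_rge0 //; lra.
Qed.

(** All vertices of the face are in [T], so they span it; barycentric coordinates recover the
    coefficients of a combination, which gives independence. *)
Lemma affdim_simplicial f (T : {set 'I_n}) : T \subset vertices_of f ->
  affdim (simplicial_face (Some T)) = #|T|%:Z - 1.
Proof.
move=> Tf; have := vertex_set_face Tf; rewrite /=.
have [->|T0] := eqVneq T finset.set0; first by rewrite affdim_set0 cards0.
move=> VT; have inT v : v \in T <-> tight (common T) (vertex v).
  by rewrite -[in X in X <-> _]VT inE; split=> /asboolP.
apply/eqP; rewrite eq_le; apply/andP; split.
  apply: affdim_le => p Y indY YT.
  have sub : (row_mx Y (const_mx 1 : 'cV[R]_p) <=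
              row_mx (points T) (const_mx 1 : 'cV[R]__))%MS.
    apply/row_subP => i; rewrite row_row_mx row_const.
    apply: face_span (YT i) => v sv; apply: points_row; apply/inT.
    by split=> //; exact: vertex_sol.
  have := mxrankS sub; rewrite (eqP indY) => le_rank.
  exact: leq_trans le_rank (rank_leq_row _).
apply: (@affdim_ge _ _ _ _ (points T)); last first.
  by move=> i; rewrite rowK; apply/inT; exact: enum_valP.
apply: inj_row_free => v; rewrite mul_mx_row -[0 in X in X -> _]hsubmxK => /eq_row_mx[].
rewrite !linear0 => vX v1; apply/rowP => i; rewrite [RHS]mxE.
have iT := enum_valP i; set u := enum_val i in iT.
have [a [delta [aT _]]] := barycentric (fintype.subsetP Tf u iT).
have : ((v *m points T) *m a - delta *: (v *m const_mx 1)) 0 0 = v 0 i.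
  rewrite -mulmxA scalemxAr -mulmxBr mxE (bigD1 i) //= big1 => [|j ji].
    rewrite addr0 -[RHS]mulr1; congr (_ * _).
    have := aT u (fintype.subsetP Tf u iT); rewrite eqxx mulr1n => eq1.
    rewrite -[RHS]eq1 !mxE mulr1; congr (_ - _); apply: eq_bigr => l _; rewrite mxE //.
  have := aT _ (fintype.subsetP Tf _ (enum_valP j)).
  rewrite (inj_eq enum_val_inj) (negPf ji) => eq0.
  suff -> : (points T *m a - delta *: const_mx 1) j 0 = 0 by rewrite mulr0.
  rewrite -[RHS]eq0 !mxE mulr1; congr (_ - _); apply: eq_bigr => l _; rewrite mxE //.
by rewrite vX v1 mul0mx scaler0 subrr mxE.
Qed.

(** An inequality tight at all vertices of a face is tight on the whole face, since below each point
    of the face its left-hand side takes its value at some vertex of the face. *)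
Lemma vertex_face_surj G : faces P G -> G <> P -> 
  (exists f, vertex_set G \subset vertices_of f) /\
  simplicial_face (Some (vertex_set G)) = G.
Proof.
move=> fG nP; have [->|/set0P Gn] := eqVneq G set0.
  have -> : vertex_set set0 = finset.set0 by apply/setP => v; rewrite !inE; apply/asboolP.
  rewrite /= eqxx; split=> //; have [v _] := exists_vertex.
  have : (0 < #|facets_of v|)%N := leq_trans d_gt0 (degree_ge v).
  by case/card_gt0P => f _; exists f; exact: finset.sub0set.
rewrite eP in fG nP; have [f sub] := face_tight_sub1 fG Gn nP.
have [z Pz eG] := face_relint fG Gn.
have inG v : v \in vertex_set G <-> active z \subset active (vertex v).
  rewrite inE eG; split=> [/asboolP[]//|sz]; apply/asboolP; split=> //.
  exact: vertex_sol.
split.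
  exists f; apply/fintype.subsetP => v; rewrite inE => /asboolP/sub[_].
  by rewrite finset.sub1set active_vertex !inE.
have [v0 v0z] := point_active Pz; move/inG in v0z.
rewrite /= ifF; last by apply/negP => /eqP V0; move: v0z; rewrite V0 inE.
rewrite eG; apply/seteqP; split; last first.
  move=> x [Px zx]; split=> //; apply/fintype.subsetP => g; rewrite -eG commonP.
  move=> /forall_inP Vg; apply/activeP/eqP; rewrite eq_le Px.2 /=.
  have [y [vy suby]] := vertex_below (col g N) bndP Px.
  have [v vE] := vertex_surj vy; rewrite -vE in suby *.
  have /Vg/activeP vg : v \in vertex_set G by apply/inG; exact: fintype.subset_trans suby.
  have col_entry (t : 'rV[R]_k) : (t *m col g N) 0 0 = (t *m N) 0 g.
    by rewrite !mxE; apply: eq_bigr => i _; rewrite mxE.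
  by rewrite !col_entry vg.
apply: tight_subset; apply/fintype.subsetP => g gz; rewrite -eG commonP.
by apply/forall_inP => v /inG/fintype.subsetP; apply.
Qed.

Lemma simplicial_face_sub f g (T U : {set 'I_n}) :
    T \subset vertices_of f -> U \subset vertices_of g ->
  simplicial_face (Some T) `<=` simplicial_face (Some U) <-> T \subset U.
Proof.
move=> Tf Ug; split=> [sub|TU].
  rewrite -(vertex_set_face Tf) -(vertex_set_face Ug); apply/fintype.subsetP => v.
  rewrite inE => /asboolP Tv; rewrite inE; apply/asboolP; exact: sub.
rewrite /=; have [_|T0] := eqVneq T finset.set0; first exact: sub0set.
have -> : U == finset.set0 = false.
  by apply/negP => /eqP U0; move: TU T0; rewrite U0 finset.subset0 => ->.
apply: tight_subset; apply/fintype.subsetP => h; rewrite !inE.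
exact: fintype.subset_trans.
Qed.

Lemma simplicial_face_neq f (T : {set 'I_n}) : T \subset vertices_of f ->
  simplicial_face (Some T) <> P.
Proof.
move=> Tf eTP; have := affdim_simplicial Tf; rewrite eTP eP dimP.
by have := subset_leq_card Tf; rewrite degd; lia.
Qed.

Lemma simplicial_face_face x : faces P (simplicial_face x).
Proof.
case: x => [T|] /=; last first.
  by rewrite -[X in faces _ X](etrans (tight_set0 E c N b) (esym eP)) eP; exact: faces_tight.
by case: ifP => _; [exact: faces_set0|rewrite eP; exact: faces_tight].
Qed.

Lemma simplicial_hasse :
  [/\ pure_complex (fun f => vertices_of f) d,
      set_bij [set x | is_node (fun f => vertices_of f) x] (faces P) simplicial_face &
      forall x y, is_node (fun f => vertices_of f) x -> is_node (fun f => vertices_of f) y ->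
        (hasse_arc (simplicial_face x) (simplicial_face y) <-> covers d y x)].
Proof.
have facet_node f : simplicial_face (Some (vertices_of f)) = facet f.
  have fP : faces P (facet f) by case: facet_bij => sub _ _; case: (sub f).
  have nP : facet f <> P.
    case: facet_bij => sub _ _; have [_ dimf] := sub f I.
    by move=> eP'; move: dimf; rewrite eP'; lia.
  rewrite -[RHS](vertex_face_surj fP nP).2; congr (simplicial_face (Some _)).
  by apply/setP => v; rewrite !inE; apply/idP/asboolP => /AE.
split.
- split=> //.
  + by move=> f g /= eq_fg; apply: facet_inj; rewrite -!facet_node eq_fg.
  + exact: vertices_le_facets.
  + move=> _ v; have : (0 < #|facets_of v|)%N := leq_trans d_gt0 (degree_ge v).
    by case/card_gt0P => f; rewrite inE => Afv; exists f; rewrite inE.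
  + by have [[]] := exists_vertex; case: (n) => // -[].
  + by move=> d0; move: d_gt0; rewrite d0.
- split.
  + by move=> x _; exact: simplicial_face_face.
  + case=> [T|] [U|]; rewrite !inE //.
    * move=> /complexP[f Tf] /complexP[g Ug] eTU; congr Some.
      by rewrite -(vertex_set_face Tf) -(vertex_set_face Ug) eTU.
    * by move=> /complexP[f /simplicial_face_neq].
    * by move=> _ /complexP[f /simplicial_face_neq ne] /esym/ne.
  + move=> G fG; have [->|/eqP nP] := eqVneq G P; first by exists None.
    have [Vf eG] := vertex_face_surj fG nP.
    by exists (Some (vertex_set G)) => //; apply/complexP.
- case=> [T|] [U|]; rewrite /is_node /covers.
  + move=> /complexP[f Tf] /complexP[g Ug].
    rewrite /hasse_arc (affdim_simplicial Tf) (affdim_simplicial Ug).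
    have subTU := simplicial_face_sub Tf Ug; have subUT := simplicial_face_sub Ug Tf.
    split=> [[[/subTU TU _] dimTU]|/andP[TU /eqP cTU]].
      by rewrite TU /=; apply/eqP; move: dimTU; move: #|U| #|T| => x y; clear; lia.
    split; last by move: cTU; move: #|U| #|T| => x y; clear; lia.
    split; first exact/subTU.
    by move=> /subUT /subset_leq_card; rewrite cTU ltnn.
  + move=> /complexP[f Tf] _; have dimN : affdim (simplicial_face None) = d%:Z by rewrite /= eP dimP.
    rewrite /hasse_arc (affdim_simplicial Tf) dimN.
    split=> [[_ dimT]|/eqP cT].
      by apply/eqP; move: dimT; move: #|T| => x; clear; lia.
    split; last by move: cT; move: #|T| => x; clear; lia.
    split; first by have [a [delta [_ ->]]] := simplicial_face_face (Some T); move=> x [].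
    move=> sub; apply: (simplicial_face_neq Tf); apply/seteqP; split=> //.
    by have [a [delta [_ ->]]] := simplicial_face_face (Some T); move=> x [].
  + move=> _ _; split=> // -[[_ nsub] _]; case: nsub.
    by have [a [delta [_ ->]]] := simplicial_face_face (Some U); move=> x [].
  + by move=> _ _; split=> // -[[_ /(_ (fun _ => id))]].
Qed.

End Simplicial.

End Incidence.

(** This is all that the algorithm has to know about the polytope; [swap] marks the orientation of
    the simplicial case. *)
Definition hasse_model (R : realType) (k d q p : nat) (P : set 'rV[R]_k)
    (blocks : 'I_p -> {set 'I_q}) (swap : bool) : Prop :=
  pure_complex blocks d /\
  exists face : option {set 'I_q} -> set 'rV[R]_k,
    set_bij [set x | is_node blocks x] (faces P) face /\
    forall x y, is_node blocks x -> is_node blocks y ->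
      (hasse_arc (face x) (face y) <-> if swap then covers d y x else covers d x y).

(** * Polytopes of dimension zero *)

Section DimensionZero.
Variables (R : realType) (k m n : nat) (P : set 'rV[R]_k) (A : 'M[bool]_(m, n)).
Hypotheses (polyP : polytope 0 P) (incA : incidence_matrix P A).

Lemma polytope0_point : exists w, P = [set w].
Proof.
have [polyhP _ dimP] := polyP.
have Pn : P !=set0 by apply/set0P/negP => /eqP P0; move: dimP; rewrite P0 affdim_set0.
have [e [q [E [c [N [b [eP irr]]]]]]] := irredundant_presentation polyhP Pn.
rewrite eP in dimP; have rk0 := rank_kernel_set0 irr dimP.
have [[w Pw _] _] := irr; exists w; rewrite eP; apply/seteqP; split=> [x Px|x ->] //.
have : (x - w <= kermx (tight_mx E N finset.set0))%MS.
  apply/sub_ker_tight; split=> [|j]; last by rewrite inE.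
  by rewrite mulmxBl Px.1 Pw.1 subrr.
move/eqP: rk0; rewrite mxrank_eq0 => /eqP ->.
by rewrite submx0 subr_eq0 => /eqP.
Qed.

Lemma faces0 G : faces P G <-> G = set0 \/ G = P.
Proof.
have [w Pw] := polytope0_point; split=> [[a [delta [_ eG]]]|].
  have [Gw|nGw] := pselect (G w); [right|left].
    by rewrite Pw; apply/seteqP; split=> [x|x ->] //; rewrite eG Pw => -[].
  apply/seteqP; split=> // x Gx; apply: nGw; have : P x by move: Gx; rewrite eG => -[].
  by rewrite Pw => <-.
case=> ->; first exact: faces_set0.
exists 0, 0; split=> [x _|]; first by rewrite mulmx0 mxE.
by apply/seteqP; split=> [x Px|x []] //; split=> //=; rewrite mulmx0 mxE.
Qed.

Lemma dim0_ord (p : nat) (T : Type) (X : set T) (g : 'I_p -> T) (t : T) :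
  set_bij setT X g -> X = [set t] -> p = 1%N.
Proof.
move=> [sub inj surj] Xt; have [i _ _] : (g @` setT) t by apply: surj; rewrite Xt.
apply/eqP; rewrite eqn_leq (leq_ltn_trans (leq0n i) (ltn_ord i)) andbT.
rewrite -[p]card_ord; apply/fintype_le1P => x y; apply: inj; rewrite ?inE //.
by have := sub x I; have := sub y I; rewrite Xt /= => -> ->.
Qed.

(** The only facet of a point is the empty set, so [A] is a zero matrix with one entry, its block is
    empty, and the complex contains just the empty set, which stands for the point. *)
Lemma dim0_model :
  [/\ m = 1%N, n = 1%N, forall f v, ~~ A f v &
      hasse_model 0 P (fun v => finset (fun f => A f v)) false].
Proof.
have [w Pw] := polytope0_point; have [facet [vertex [fbij vbij AE]]] := incA.
have [_ _ dimP] := polyP.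
have facetsE : facets P = [set set0].
  apply/seteqP; split=> [G [/faces0[->|->]] //|G ->]; first by rewrite dimP.
  by split; [apply/faces0; left|rewrite affdim_set0 dimP].
have verticesE : vertices P = [set w].
  apply/seteqP; split=> [x|x ->]; last by apply/faces0; right; rewrite Pw.
  move=> /faces0[e0|]; first by have : [set x] x by []; rewrite e0.
  by rewrite Pw => e1; have : [set x] x by []; rewrite e1.
have m1 := dim0_ord fbij facetsE; have n1 := dim0_ord vbij verticesE.
have nA f v : ~~ A f v.
  apply/negP => /AE; case: fbij => /(_ f I); rewrite facetsE => -> //.
have blocks0 v : finset (fun f => A f v) = finset.set0.
  by apply/setP => f; rewrite !inE; apply: negbTE.
have in_complex U : U \in complex (fun v => finset (fun f => A f v)) -> U = finset.set0.
  by move=> /complexP[v]; rewrite blocks0 finset.subset0 => /eqP.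
split=> //; split.
  split=> //.
  - by move=> v; rewrite blocks0 cards0.
  - by move=> u v _; apply/val_inj; case: u v => [u lu] [v lv] /=; lia.
  - by rewrite m1 n1.
  - by rewrite m1.
exists (fun x => if x is Some U then P else set0); split; first split.
- by case=> [U|] _; apply/faces0; [right|left].
- case=> [U|] [V|]; rewrite !inE //=.
  + by move=> /in_complex-> /in_complex->.
  + by move=> _ _; rewrite Pw => e0; have : [set w] w by []; rewrite e0.
  + by move=> _ _; rewrite Pw => e0; have : [set w] w by []; rewrite -e0.
- move=> G /faces0[->|->]; first by exists None.
  exists (Some finset.set0) => //=; apply/complexP.
  have n0 : (0 < n)%N by rewrite n1.
  by exists (Ordinal n0); exact: finset.sub0set.
- have arcPP G : ~ hasse_arc G G by case=> [[_ nsub] _]; case: nsub.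
  case=> [U|] [V|] //=.
  + move=> /in_complex-> /in_complex->; rewrite cards0 andbF; split=> //.
    by move=> /arcPP.
  + by move=> _ _; split=> // -[[_ nsub] _]; case: nsub.
  + move=> _ /in_complex->; rewrite cards0 eqxx; split=> // _.
    rewrite /hasse_arc affdim_set0 dimP; split=> //; split=> //.
    by rewrite Pw => /(_ w); apply.
  + by move=> _ _; split=> // /arcPP.
Qed.

End DimensionZero.

Section Model.
Variables (R : realType) (k d m n : nat) (P : set 'rV[R]_k) (A : 'M[bool]_(m, n)).
Hypotheses (polyP : polytope d P) (incA : incidence_matrix P A).

Let num_incidences_sum : num_incidences A = (\sum_v #|finset (fun f => A f v)|)%N.
Proof.
rewrite sum_degrees /num_incidences; apply: eq_bigr => f _.
by rewrite -sum1_card [RHS]big_mkcond; apply: eq_bigr => v _; rewrite inE; case: (A f v).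
Qed.

Lemma simple_degrees : simple d P -> forall v, #|finset (fun f => A f v)| = d.
Proof.
have [facet [vertex [fbij vbij AE]]] := incA; move=> simP v.
have [fsub finj fsurj] := fbij; have [vsub _ _] := vbij.
apply: (card_eq_finset (g := facet) _ _ (simP (vertex v) (vsub v I))).
  by move=> f g; apply: finj; rewrite inE.
apply/seteqP; split=> [G [/fsurj[f _ <-] fv]|_ [f /= + <-]].
  by exists f => //=; rewrite inE; apply/AE.
by rewrite inE => /AE fv; split=> //; exact: fsub.
Qed.

Lemma simplicial_degrees : simplicial d P -> forall f, #|finset (fun v => A f v)| = d.
Proof.
have [facet [vertex [fbij vbij AE]]] := incA; move=> simP f.
have [vsub vinj vsurj] := vbij; have [fsub _ _] := fbij.
apply: (card_eq_finset (g := vertex) _ _ (simP (facet f) (fsub f I))).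
  by move=> u v; apply: vinj; rewrite inE.
apply/seteqP; split=> [x [/vsurj[v _ <-] fv]|_ [v /= + <-]].
  by exists v => //=; rewrite inE; apply/AE.
by rewrite inE => /AE fv; split=> //; exact: vsub.
Qed.

Lemma simple_le : simple d P -> (m <= n)%N.
Proof.
move=> /simple_degrees degd; have [facet [vertex [fbij vbij AE]]] := incA.
have [d0|d0] := posnP d.
  by have polyP0 : polytope 0 P by [rewrite -d0]; have [m1 n1 _ _] := dim0_model polyP0 incA; lia.
have [e [E [c [N [b [eP irr fE]]]]]] := facet_presentation polyP d0 fbij.
exact: (facets_le_vertices polyP d0 vbij AE eP irr fE degd).
Qed.

Lemma simple_model : simple d P \/ simplicial d P -> (m <= n)%N ->
  hasse_model d P (fun v => finset (fun f => A f v)) false /\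
  num_incidences A = (n * d)%N.
Proof.
move=> simP le_mn; have [facet [vertex [fbij vbij AE]]] := incA.
have [d0|d0] := posnP d.
  have polyP0 : polytope 0 P by [rewrite -d0].
  rewrite d0; have [m1 n1 nA model] := dim0_model polyP0 incA; split=> //.
  by rewrite muln0 /num_incidences big1 // => f _; rewrite big1 // => v _; rewrite (negPf (nA f v)).
have [e [E [c [N [b [eP irr fE]]]]]] := facet_presentation polyP d0 fbij.
have degd v : #|finset (fun f => A f v)| = d.
  case: simP => [/simple_degrees//|/simplicial_degrees degd].
  exact: (simplicial_square_simple polyP d0 vbij AE eP irr fE degd le_mn).
split; last by rewrite num_incidences_sum (eq_bigr (fun=> d)) // sum_nat_const card_ord.
have [pure bij arcs] := simple_hasse polyP d0 vbij AE eP irr fE degd.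
by split=> //; exists (simple_face E c N b).
Qed.

(** A simple polytope has at most as many facets as vertices, so n < m leaves only the simplicial
    case. *)
Lemma simplicial_model : simple d P \/ simplicial d P -> (n < m)%N ->
  hasse_model d P (fun f => finset (fun v => A f v)) true /\
  num_incidences A = (m * d)%N.
Proof.
move=> simP lt_nm; have [facet [vertex [fbij vbij AE]]] := incA.
have [d0|d0] := posnP d.
  by have polyP0 : polytope 0 P by [rewrite -d0]; have [m1 n1 _ _] := dim0_model polyP0 incA; lia.
have [e [E [c [N [b [eP irr fE]]]]]] := facet_presentation polyP d0 fbij.
have degd f : #|finset (fun v => A f v)| = d.
  by case: simP => [/simple_le|/simplicial_degrees//]; rewrite leqNgt lt_nm.
split.
  have [pure bij arcs] := simplicial_hasse polyP d0 fbij vbij AE eP irr fE degd.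
  by split=> //; exists (simplicial_face P A E c N b).
by rewrite num_incidences_sum sum_degrees (eq_bigr (fun=> d)) // sum_nat_const card_ord.
Qed.

End Model.

Close Scope ring_scope.

(** * Layout of the input and the final bounds *)

Lemma nth_flatten_const (T : Type) (x0 : T) (r : nat) (ss : seq (seq T)) i j :
  all (fun s => size s == r) ss -> j < r -> nth x0 (flatten ss) (i * r + j) = nth x0 (nth [::] ss i) j.
Proof.
move=> + lt_j; elim: ss i => [|s ss IHss] [|i] /=; rewrite ?nth_nil // => /andP[/eqP size_s size_ss].
  by rewrite nth_cat size_s mul0n add0n lt_j.
by rewrite nth_cat size_s mulSn ifF -?addnA ?addKn ?IHss //; lia.
Qed.

Section FinalTheorem.
Variables (m n : nat) (A : 'M[bool]_(m, n)).
Notation mem := (memory (input A)).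

Lemma size_input : size mem = 2 + m * n.
Proof. by rewrite /= size_allpairs !size_enum_ord. Qed.

Lemma input_bits : all (leq^~ 1) (drop 2 mem).
Proof. by rewrite /= drop0; apply/allP => _ /allpairsP[[f v] [_ _ ->]] /=; case: (A f v). Qed.

Lemma nth_input (f : 'I_m) (v : 'I_n) : nth 0 mem (2 + f * n + v) = A f v.
Proof.
rewrite -addnA add2n /= nth_flatten_const //; last first.
  by apply/allP => _ /mapP[g _ ->]; rewrite size_map size_enum_ord.
rewrite (nth_map f) ?size_enum_ord // nth_ord_enum.
by rewrite (nth_map v) ?size_enum_ord // nth_ord_enum.
Qed.

(** The number [q] of items is the smaller of m and n, so the single space bound of order phi q
    implies both bounds of the theorem, whichever orientation was chosen. *)
Lemma hasse_output (R : realType) (k d q p sf sv dir : nat) (P : set 'rV[R]_k)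
    (blocks : 'I_p -> {set 'I_q}) :
    hasse_model d P blocks (dir != 0) ->
    num_incidences A = p * d -> q <= m -> q <= n ->
    (q, p, sf, sv, dir) = (if n < m then (n, m, 1, n, 1) else (m, n, n, 1, 0)) ->
    (forall i j, i < q -> j < p -> nth 0 mem (2 + i * sf + j * sv) = incident blocks i j) ->
  exists (time peak : nat) (final : state),
    [/\ exec algorithm (input A) time peak final,
        encodes_hasse_diagram P (output final),
        time <= big_O 400 (d * num_incidences A * num_faces P),
        simple d P -> peak <= big_O 400 (num_faces P * m) &
        simplicial d P -> peak <= big_O 400 (num_faces P * n)].
Proof.
move=> [pure [face [face_bij face_arc]]] alpha le_qm le_qn layout mem_matrix.
have size_mem : size mem = 2 + q * p.
  by rewrite size_input; move: layout; case: ifP => _ [-> -> _ _ _]; rewrite // mulnC.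
have [time [peak [final [ex [L [uniqL memL out time_le peak_le]]]]]] :=
  algorithm_correct (mem := mem) pure layout erefl erefl size_mem input_bits mem_matrix.
have size_L := size_listing uniqL memL.
have [arcs [arcs_uniq arcs_mem arcs_out]] := output_arcs d uniqL memL dir.
pose g (i : 'I_(size L).+1) := face (node_at q L i).
have [face_sub face_inj face_surj] := face_bij.
have g_inj : injective g.
  move=> i j eq_g; apply/val_inj/(node_at_inj uniqL memL); try by rewrite -ltnS ltn_ord.
  by apply: face_inj; rewrite ?inE; [exact: (node_at_node memL)|exact: (node_at_node memL)|].
have g_bij : set_bij setT (faces P) g.
  split=> [i _|i j _ _|G /face_surj[x xn <-]]; [|exact: g_inj|].
    exact/face_sub/(node_at_node memL).
  have [i le_i <-] := node_at_surj memL xn.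
  by exists (Ordinal (le_i : i < (size L).+1)).
have phi : num_faces P = #|complex blocks|.+1.
  rewrite -size_L; apply: card_fset_set.
  have -> : faces P = range g.
    have [gsub _ gsurj] := g_bij; apply/seteqP; split=> [G /gsurj //|_ [i _ <-]].
    exact: gsub.
  exact: card_range_ord.
exists time, peak, final; split=> //.
- exists (size L).+1, arcs, g; split=> //; last by rewrite out arcs_out.
  move=> i j; rewrite arcs_mem.
  have := face_arc _ _ (node_at_node memL i) (node_at_node memL j).
  by case: eqP => _ /=; rewrite /g => ->.
- by rewrite /big_O alpha phi.
- move=> _; apply: leq_trans peak_le _; rewrite /big_O phi leq_mul //.
  by rewrite (leq_trans _ (leq_maxr _ _)) // leq_mul2l le_qm orbT.
- move=> _; apply: leq_trans peak_le _; rewrite /big_O phi leq_mul //.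
  by rewrite (leq_trans _ (leq_maxr _ _)) // leq_mul2l le_qn orbT.
Qed.

End FinalTheorem.

Theorem mainTheorem2 :
  exists (algorithm : prog) (C : nat),
  forall (R : realType) (k d m n : nat)
         (P : set 'rV[R]_k) (A : 'M[bool]_(m, n)),
    polytope d P ->
    simple d P \/ simplicial d P ->
    incidence_matrix P A ->
    exists (time peak : nat) (final : state),
      [/\ exec algorithm (input A) time peak final,
          encodes_hasse_diagram P (output final),
          (time <= big_O C (d * num_incidences A * num_faces P))%N,
          simple d P -> (peak <= big_O C (num_faces P * m))%N &
          simplicial d P -> (peak <= big_O C (num_faces P * n))%N].
Proof.
exists algorithm, 400 => R k d m n P A polyP simP incA.
have [lt_nm|le_mn] := ltnP n m.
  have [model alpha] := simplicial_model polyP incA simP lt_nm.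
  apply: (hasse_output (dir := 1) model alpha (ltnW lt_nm) (leqnn n)); first by rewrite lt_nm.
  move=> i j lt_i lt_j; rewrite muln1 -addnA (addnC i) addnA.
  rewrite (nth_input A (Ordinal lt_j) (Ordinal lt_i)).
  by rewrite (incident_ord _ (Ordinal lt_i) (Ordinal lt_j)) inE.
have [model alpha] := simple_model polyP incA simP le_mn.
apply: (hasse_output (dir := 0) model alpha (leqnn m) le_mn); first by rewrite ltnNge le_mn.
move=> i j lt_i lt_j; rewrite muln1 (nth_input A (Ordinal lt_i) (Ordinal lt_j)).
by rewrite (incident_ord _ (Ordinal lt_i) (Ordinal lt_j)) inE.
Qed.
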